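(* Let $A\subset\mathbb R^n$ be arbitrary, and let $f=\psi+U^\vartheta+U^\omega$ be an external field on $\overline A$ satisfying $\psi\in\Phi(\overline A)$, $\vartheta\in\mathcal E$, $\omega\in\mathfrak M$ bounded with $\inf_{x\in S(\omega),\,y\in A}|x-y|>0$, and $c_*(\{x\in A:\psi(x)<\infty\})>0$. Assume that the minimizer $\lambda_{A,f}$ exists. Then the minimizers $\lambda_{K,f}$ exist for all sufficiently large $K\in\mathfrak C_A$, and $$\lambda_{K,f}\to\lambda_{A,f}\quad\text{strongly and vaguely in }\mathcal E^+\text{ as }K\uparrow A,$$ and moreover $$\lim_{K\uparrow A}c_{K,f}=c_{A,f}.$$
   Context: Fix $n\ge 2$ and $0<\alpha<n$. $\mathfrak M$ is the space of real-valued (signed) Radon measures $\mu$ on $\mathbb R^n$, always assumed to satisfy $\int_{|y|>1}|y|^{\alpha-n}\,d|\mu|(y)<\infty$, with the vague topology (pointwise convergence on continuous functions of compact support); $\mathfrak M^+$ is the cone of positive ones; $\mu$ is bounded if $|\mu|(\mathbb R^n)<\infty$; $S(\mu)$ is the support. $U^\mu(x)=\int|x-y|^{\alpha-n}\,d\mu(y)$, $I(\mu,\nu)=\iint|x-y|^{\alpha-n}\,d\mu(x)\,d\nu(y)$, $I(\mu)=I(\mu,\mu)$. $\mathcal E$ is the pre-Hilbert space of all $\mu\in\mathfrak M$ of finite energy, with inner product $I(\mu,\nu)$ and norm $\|\mu\|=\sqrt{I(\mu)}$; the norm topology is called strong; $\mathcal E^+=\mathcal E\cap\mathfrak M^+$.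 For $A\subset\mathbb R^n$: $\mathfrak M^+(A)$ is the set of $\mu\in\mathfrak M^+$ concentrated on $A$ (i.e. $\mathbb R^n\setminus A$ is $\mu$-negligible); $\mathcal E^+(A)=\mathcal E\cap\mathfrak M^+(A)$; $\breve{\mathcal E}^+(A)=\{\mu\in\mathcal E^+(A):\mu(\mathbb R^n)=1\}$. Inner capacity: $c_*(A)=1/\inf\{I(\mu):\mu\in\breve{\mathcal E}^+(A)\}$ (with $\inf\varnothing=+\infty$, $1/(+\infty)=0$). For closed $F$, $\Phi(F)$ is the class of lower semicontinuous functions $g:F\to(-\infty,\infty]$ that are $\ge0$ unless $F$ is compact. For $\omega=0$ the distance from $S(\omega)=\varnothing$ to $A$ is $+\infty$. The field $f$ is well defined on $\overline A$ outside a set of zero outer capacity. For $Q\subset\overline A$, $\mathcal E^+_f(Q)$ is the set of $\mu\in\mathcal E^+(Q)$ for which $f$ is $\mu$-integrable, $\breve{\mathcal E}^+_f(Q)=\mathcal E^+_f(Q)\cap\breve{\mathcal E}^+(Q)$, $I_f(\mu)=I(\mu)+2\int f\,d\mu$, $w_f(Q)=\inf_{\mu\in\breve{\mathcal E}^+_f(Q)}I_f(\mu)$. The minimizer $\lambda_{Q,f}$ is the measure in $\breve{\mathcal E}^+_f(Q)$ with $I_f(\lambda_{Q,f})=w_f(Q)\in\mathbb R$ (unique if it exists), and $c_{Q,f}:=\int(U^{\lambda_{Q,f}}+f)\,d\lambda_{Q,f}=w_f(Q)-\int f\,d\lambda_{Q,f}$ is the inner $f$-weighted equilibrium constant. $\mathfrak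 C_A$ is the set of compact subsets $K$ of $A$, directed upward by inclusion; limits ''as $K\uparrow A$'' are limits of nets indexed by $\mathfrak C_A$. *)

(* Defs.v *)
From HB Require Import structures.
From mathcomp Require Import all_boot all_order all_algebra.
From mathcomp Require Import all_classical all_reals all_analysis.

Set Implicit Arguments.
Unset Strict Implicit.
Unset Printing Implicit Defensive.

Import Order.TTheory GRing.Theory Num.Theory.
Import numFieldNormedType.Exports.

Local Open Scope classical_set_scope.
Local Open Scope ring_scope.

(* R^n with its usual topology and its Borel sigma-algebra.  The norm [`|x|]
   inherited from row vectors is the sup norm; the Euclidean norm is [enorm]. *)
Definition euclid (R : realType) (n : nat) := 'rV[R]_n.

HB.instance Definition _ (R : realType) (n : nat) :=
  NormedModule.copy (euclid R n) 'rV[R]_n.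
HB.instance Definition _ (R : realType) (n : nat) :=
  Measurable.copy (euclid R n) (g_sigma_algebraType (@open 'rV[R]_n)).

Definition enorm (R : realType) (n : nat) (x : euclid R n) : R :=
  Num.sqrt (\sum_(i < n) x ord0 i ^+ 2).

Local Open Scope ereal_scope.

(* On R^n every Borel measure finite on compact sets is regular. *)
Record radon_pos (R : realType) (n : nat) (alpha : R) := RadonPos {
  radon_measure :> {measure set (euclid R n) -> \bar R} ;
  radon_locally_finite : forall K : set (euclid R n),
    compact K -> radon_measure K < +oo ;
  radon_growth :
    \int[radon_measure]_(y in [set y : euclid R n | (1 < enorm y)%R])
      (enorm y `^ (alpha - n%:R))%:E < +oo }.

(* A signed Radon measure may have both parts infinite, so it is not a set
   function on all Borel sets: it is given by its Jordan decomposition. *)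
Record radon (R : realType) (n : nat) (alpha : R) := Radon {
  posm : radon_pos n alpha ;
  negm : radon_pos n alpha ;
  mutually_singular : exists P : set (euclid R n),
    [/\ measurable P, negm P = 0 & posm (~` P) = 0] }.

Section difference.
Context {R : realType} {n : nat} {alpha : R}.
Local Notation T := (euclid R n).
Local Open Scope ereal_scope.

Lemma open_measurable_euclid (A : set T) : open A -> measurable A.
Proof. by move=> oA; exact: sub_sigma_algebra. Qed.

Lemma closed_measurable_euclid (A : set T) : closed A -> measurable A.
Proof.
by move=> cA; rewrite -[A]setCK; apply: measurableC; apply: open_measurable_euclid;
  exact: closed_openC.
Qed.

Lemma compact_measurable_euclid (A : set T) : compact A -> measurable A.
Proof.
move=> cA; apply: closed_measurable_euclid; apply: compact_closed cA.
exact: norm_hausdorff.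
Qed.

Import HBNNSimple.

(* [ge0_le_measure_integral] without measurability of the integrand. *)
Lemma le_measure_nnintegral (m1 m2 : {measure set T -> \bar R})
    (D : set T) (f : T -> \bar R) :
  (forall S, measurable S -> m1 S <= m2 S) -> (forall x, 0 <= f x) ->
  \int[m1]_(x in D) f x <= \int[m2]_(x in D) f x.
Proof.
move=> m12 f0; rewrite !ge0_integralE//= ge_ereal_sup// => _ [h/= hfS] <-.
by apply: le_ereal_sup_tmp; exists (sintegral m2 h);
  [exists h|exact: le_measure_sintegral].
Qed.

Let S (k : nat) : set T := [set x | (`|x| <= k%:R)%R].

Let S_compact k : compact (S k).
Proof.
apply: bounded_closed_compact.
  exists k%:R; split; first exact: num_real.
  by move=> x kx y /= /le_trans; apply; exact: ltW.
rewrite (_ : S k = (fun x : T => `|x|%R) @^-1` [set r : R | (r <= k%:R)%R])//.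
apply: preimage_closed; last exact: closed_le.
by move=> x _; exact: norm_continuous.
Qed.

Let mS k : measurable (S k).
Proof.
by apply: compact_measurable_euclid; exact: S_compact.
Qed.

Let D := seqDU S.

Let mD k : measurable (D k).
Proof.
apply: measurableD => //; apply: bigsetU_measurable => i _; exact: mS.
Qed.

Let covD : \bigcup_k D k = setT.
Proof.
rewrite /D -seqDU_bigcup_eq -subTset => x _.
exists (Num.truncn `|x|%R).+1 => //=; rewrite /S /=.
by rewrite ltW// Num.Theory.truncnS_gt.
Qed.

Let finD (mu : radon_pos n alpha) k : mu (D k) < +oo.
Proof.
apply: le_lt_trans (radon_locally_finite mu (@S_compact k)).
by apply: le_measure; rewrite ?inE; [exact: mD|exact: mS|exact: subDsetl].
Qed.

Let fin_slice (mu : radon_pos n alpha) A k : measurable A ->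
  mu (A `&` D k) \is a fin_num.
Proof.
move=> mA; rewrite ge0_fin_numE//; apply: le_lt_trans (finD mu k).
by apply: le_measure; rewrite ?inE; [exact: measurableI|exact: mD|exact: subIsetr].
Qed.

Section pq.
Variables p q : radon_pos n alpha.
Let pk k := mfrestr (mD k) (finD p k).
Let qk k := mfrestr (mD k) (finD q k).

Let nu k : {charge set T -> \bar R} :=
  cadd (charge_of_finite_measure (pk k))
       (cscale (-1) (charge_of_finite_measure (qk k))).

Let nuE k A : nu k A = p (A `&` D k) - q (A `&` D k).
Proof. by rewrite /nu /= /cadd /= /cscale /= EFinN mulNe mul1e. Qed.

Let hahn k : {PN : set T * set T | hahn_decomposition (nu k) PN.1 PN.2}.
Proof.
by apply: cid; have [P [N h]] := Hahn_decomposition (nu k); exists (P, N).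
Qed.

Let P k := (sval (hahn k)).1.
Let N k := (sval (hahn k)).2.
Let hPN k : hahn_decomposition (nu k) (P k) (N k) := svalP (hahn k).
Let mP k : measurable (P k). Proof. by have [[]] := hPN k. Qed.
Let mN k : measurable (N k). Proof. by have [_ []] := hPN k. Qed.

Let jp k : {measure set T -> \bar R} := jordan_pos (hPN k).
Let jn k : {measure set T -> \bar R} := jordan_neg (hPN k).
Let pos : {measure set T -> \bar R} := mseries jp 0.
Let neg : {measure set T -> \bar R} := mseries jn 0.
Let posE A : pos A = \sum_(0 <= k <oo) jp k A. Proof. by []. Qed.
Let negE A : neg A = \sum_(0 <= k <oo) jn k A. Proof. by []. Qed.

Let jposE k A : measurable A ->
  jp k A =
  p (A `&` P k `&` D k) - q (A `&` P k `&` D k).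
Proof.
move=> mA; have -> : jp k A = crestr0 (nu k) (mP k) A by [].
by rewrite /crestr0 mem_set// /crestr nuE.
Qed.

Let jnegE k A : measurable A ->
  jn k A =
  q (A `&` N k `&` D k) - p (A `&` N k `&` D k).
Proof.
move=> mA; have -> : jn k A = (-1)%:E * crestr0 (nu k) (mN k) A by [].
rewrite EFinN mulNe mul1e /crestr0 mem_set// /crestr nuE.
by rewrite fin_num_oppeB 1?addeC//; apply: fin_slice; exact: measurableI.
Qed.

Let slice (m : radon_pos n alpha) A : measurable A ->
  m A = \sum_(0 <= k <oo) m (A `&` D k).
Proof.
move=> mA; rewrite -{1}(setIT A) -covD setI_bigcupr.
rewrite measure_bigcup//=.
- by apply: eq_eseriesl => i; rewrite in_setT.
- by move=> i _; exact: measurableI.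
- by apply: trivIset_setIl; exact: trivIset_seqDU.
Qed.

Let pos_le A : measurable A -> pos A <= p A.
Proof.
move=> mA; rewrite slice// posE; apply: lee_nneseries => // k _.
rewrite jposE//; apply: (@le_trans _ _ (p (A `&` P k `&` D k))).
  by rewrite leeBlDr ?leeDl//; apply: fin_slice; exact: measurableI.
apply: le_measure; rewrite ?inE; last by apply: setSI; exact: subIsetl.
- by apply: measurableI; [exact: measurableI|exact: mD].
- by apply: measurableI; [|exact: mD].
Qed.

Let neg_le A : measurable A -> neg A <= q A.
Proof.
move=> mA; rewrite slice// negE; apply: lee_nneseries => // k _.
rewrite jnegE//; apply: (@le_trans _ _ (q (A `&` N k `&` D k))).
  by rewrite leeBlDr ?leeDl//; apply: fin_slice; exact: measurableI.
apply: le_measure; rewrite ?inE; last by apply: setSI; exact: subIsetl.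
- by apply: measurableI; [exact: measurableI|exact: mD].
- by apply: measurableI; [|exact: mD].
Qed.

Let le_radon (m : {measure set T -> \bar R}) (mu : radon_pos n alpha) :
  (forall A, measurable A -> m A <= mu A) ->
  exists m' : radon_pos n alpha, radon_measure m' = m.
Proof.
move=> h; unshelve eexists (RadonPos (radon_measure := m) _ _) => //.
- move=> K cK; apply: le_lt_trans (radon_locally_finite mu cK); apply: h.
  exact: compact_measurable_euclid.
- apply: le_lt_trans (radon_growth mu); apply: le_measure_nnintegral => // x.
  by rewrite lee_fin powR_ge0.
Qed.

Lemma radon_sub_exists : exists rho : radon n alpha,
  forall A, measurable A -> posm rho A + q A = negm rho A + p A.
Proof.
have [pr prE] := le_radon pos_le; have [nr nrE] := le_radon neg_le.
unshelve eexists (Radon (posm := pr) (negm := nr) _) => /=.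
  exists (\bigcup_k (P k `&` D k)); split.
  - by apply: bigcup_measurable => k _; exact: measurableI.
  - rewrite nrE negE eseries0// => k _ _.
    rewrite jnegE; last by apply: bigcup_measurable => *; exact: measurableI.
    rewrite (_ : _ `&` _ = set0) ?measure0 ?sube0//.
    rewrite -subset0 => x [[[j _ [Pj Dj]] Nk] Dk].
    have jk : j = k by apply: (trivIset_seqDU S) => //; exists x.
    have [_ _ _ PN0] := hPN k.
    by rewrite jk in Pj; rewrite -PN0; split.
  - rewrite prE posE eseries0// => k _ _.
    rewrite jposE; last first.
      by apply: measurableC; apply: bigcup_measurable => *; exact: measurableI.
    rewrite (_ : _ `&` _ = set0) ?measure0 ?sube0//.
    by rewrite -subset0 => x [[nx Px] Dx]; apply: nx; exists k.
move=> A mA; rewrite prE nrE posE negE.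
rewrite (slice p mA) (slice q mA) -!nneseriesD//.
apply: eq_eseriesr => k _.
have h : nu k A = jp k A - jn k A.
  by have := jordan_decomp (hPN k) mA; rewrite /cadd/= /cscale/= EFinN mulNe mul1e.
rewrite nuE in h.
have fj : jn k A \is a fin_num by exact: fin_num_measure.
have fJ : jp k A \is a fin_num by exact: fin_num_measure.
move: h fj fJ (fin_slice p k mA) (fin_slice q k mA).
case: (p _) => // a; case: (q _) => // b.
case: (jp k A) => // c; case: (jn k A) => // e.
move=> [abce] _ _ _ _; congr (_%:E).
have -> : a = (c - e + b)%R by rewrite -abce subrK.
by rewrite addrA (addrC e) subrK.
Qed.

End pq.

(* The signed measure p - q, determined on Borel sets by the relation
   (p - q)^+ + q = (p - q)^- + p. *)
Definition radon_sub (p q : radon_pos n alpha) : radon n alpha :=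
  sval (cid (radon_sub_exists p q)).

Lemma radon_subP (p q : radon_pos n alpha) (A : set T) : measurable A ->
  posm (radon_sub p q) A + q A = negm (radon_sub p q) A + p A.
Proof. exact: (svalP (cid (radon_sub_exists p q))). Qed.

End difference.

Definition tvm (R : realType) (n : nat) (alpha : R) (mu : radon n alpha) :
    {measure set (euclid R n) -> \bar R} :=
  measure_add (posm mu) (negm mu).

Definition bounded_radon (R : realType) (n : nat) (alpha : R)
    (mu : radon n alpha) : Prop :=
  tvm mu setT < +oo.

Definition msupport (R : realType) (n : nat)
    (mu : set (euclid R n) -> \bar R) : set (euclid R n) :=
  [set x | forall U : set (euclid R n), open U -> U x -> 0 < mu U].

Section energy.
Context {R : realType} {n : nat}.
Variable alpha : R.
Local Notation T := (euclid R n).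

(* [0 `^ r] is [0] for [r != 0], hence the separate value on the diagonal. *)
Definition riesz_kernel (x y : T) : \bar R :=
  if x == y then +oo else (enorm (x - y)%R `^ (alpha - n%:R))%:E.

Definition potential_pos (mu : {measure set T -> \bar R}) (x : T) : \bar R :=
  \int[mu]_y riesz_kernel x y.

Definition energy_pos (mu nu : {measure set T -> \bar R}) : \bar R :=
  \int[mu]_x \int[nu]_y riesz_kernel x y.

End energy.

Section signed_energy.
Context {R : realType} {n : nat} {alpha : R}.
Implicit Types mu nu : radon n alpha.

(* Where both potentials are +oo the value is -oo instead of being undefined;
   for mu of finite energy this is a Borel set of zero outer capacity, which no
   positive measure of finite energy charges. *)
Definition potential mu (x : euclid R n) : \bar R :=
  potential_pos alpha (posm mu) x - potential_pos alpha (negm mu) x.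

Definition energy mu nu : \bar R :=
  (energy_pos alpha (posm mu) (posm nu) + energy_pos alpha (negm mu) (negm nu))
  - (energy_pos alpha (posm mu) (negm nu) + energy_pos alpha (negm mu) (posm nu)).

(* The energy of a signed measure is defined and finite iff the kernel is
   integrable with respect to the product of |mu| with itself. *)
Definition finite_energy mu : Prop :=
  energy_pos alpha (tvm mu) (tvm mu) < +oo.

Definition strong_norm mu : R := Num.sqrt (fine (energy mu mu)).

End signed_energy.

Section concentration.
Context {R : realType} {n : nat} {alpha : R}.
Local Notation T := (euclid R n).
Implicit Types (A : set T) (mu : radon_pos n alpha).

Definition concentrated mu A : Prop := mu.-negligible (~` A).

Definition Eplus A : set (radon_pos n alpha) :=
  [set mu : radon_pos n alpha | energy_pos alpha mu mu < +oo /\ concentrated mu A].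

Definition Eplus1 A : set (radon_pos n alpha) :=
  [set mu : radon_pos n alpha | Eplus A mu /\ mu setT = 1].

End concentration.

Section capacity.
Context {R : realType} {n : nat}.
Variable alpha : R.
Local Notation T := (euclid R n).
Implicit Types A B F : set T.

(* [0^-1 = +oo] and [+oo^-1 = 0] in [\bar R]. *)
Definition inner_capacity A : \bar R :=
  (ereal_inf [set energy_pos alpha mu mu | mu in Eplus1 (alpha := alpha) A])^-1.

Definition Phi F : set (T -> \bar R) :=
  [set g | [/\ lower_semicontinuous (g : subspace F -> \bar R),
               forall x, F x -> g x != -oo &
               ~ compact F -> forall x, F x -> 0 <= g x]].

Definition set_dist A B : \bar R :=
  ereal_inf [set (enorm (x - y : T)%R)%:E | x in A & y in B].

End capacity.

Section minimizers.
Context {R : realType} {n : nat} {alpha : R}.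
Local Notation T := (euclid R n).
(* [D] is the closed set on which the field [f] is given; the values of [f]
   outside [D] are irrelevant. *)
Variables (D : set T) (f : T -> \bar R).
Implicit Types (Q : set T) (mu : radon_pos n alpha).

Definition Eplus1f Q : set (radon_pos n alpha) :=
  [set mu : radon_pos n alpha | Eplus1 Q mu /\ mu.-integrable D f].

Definition weighted_energy mu : \bar R :=
  energy_pos alpha mu mu + 2%:E * \int[mu]_(x in D) f x.

Definition weighted_inf Q : \bar R :=
  ereal_inf [set weighted_energy mu | mu in Eplus1f Q].

Definition is_minimizer Q mu : Prop :=
  [/\ Eplus1f Q mu, weighted_energy mu = weighted_inf Q &
      weighted_inf Q \is a fin_num].

Definition equilibrium_constant mu : \bar R :=
  \int[mu]_(x in D) (potential_pos alpha mu x + f x).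

End minimizers.

Section nets.
Context {R : realType} {n : nat} {alpha : R}.
Local Notation T := (euclid R n).

Definition compacts_of (A : set T) : set (set T) :=
  [set K | compact K /\ K `<=` A].

(* the filter of tails of the directed set of compact subsets of A *)
Definition compacts_up (A : set T) : set_system (set T) :=
  filter_from (compacts_of A) (fun K0 => [set K | compacts_of A K /\ K0 `<=` K]).

Global Instance compacts_up_filter (A : set T) : ProperFilter (compacts_up A).
Proof.
apply: filter_from_proper => [|K0 cK0]; last by exists K0; split.
apply: filter_from_filter.
  by exists set0; split; [exact: compact0|exact: sub0set].
move=> K L [cK KA] [cL LA]; exists (K `|` L).
  by split; [exact: compactU|rewrite subUset; split].
by move=> M [cM]; rewrite subUset => -[KM LM]; split.
Qed.

Definition strong_cvg (F : set_system (set T)) (mu_ : set T -> radon_pos n alpha)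
    (mu : radon_pos n alpha) : Prop :=
  strong_norm (radon_sub (mu_ K) mu) @[K --> F] --> (0 : R)%R.

Definition vague_cvg (F : set_system (set T)) (mu_ : set T -> radon_pos n alpha)
    (mu : radon_pos n alpha) : Prop :=
  forall phi : T -> R, continuous phi ->
    compact (closure [set x | phi x != 0%R]) ->
    (\int[mu_ K]_x phi x)%R @[K --> F] --> (\int[mu]_x phi x)%R.

End nets.

(* Main.v *)
(* Write [beta = (n - alpha) / 2] and [v x = 1 / (1 + |x|^2)].  The Riesz kernel
   is [(v x * v y) ^ beta * (1 - u x y) ^ (- beta)], where [u x y] lies in
   [[0, 1]] and is the inner product of finitely many coordinates of [x] and [y]
   (those of the stereographic projection).  The binomial series therefore writes
   [I(mu, nu)] as a sum over multi-indices, with nonnegative coefficients, of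
   products of real moments of [mu] and [nu].  This makes the energy a positive
   semidefinite symmetric form, gives the Cauchy-Schwarz inequality, and shows
   that strong convergence implies convergence of every moment; by Bernstein
   approximation in the same coordinates, convergence of the moments of
   probability measures implies vague convergence.

   If [mu] and [nu] are admissible for [Q], so is their midpoint, and the
   parallelogram identity gives
     [||mu - nu||^2 <= 2 (I_f mu - w_f Q) + 2 (I_f nu - w_f Q)].
   On a compact [K] a minimizing sequence is thus strongly Cauchy, and a weak
   limit of it along an ultrafilter is a minimizer by lower semicontinuity.
   Inner regularity of [lambda_A] gives [w_f K -> w_f A], and the same inequality
   with [Q = A] then yields [||lambda_K - lambda_A||^2 <= 2 (w_f K - w_f A)].
   Finally [c_{K,f} = (w_f K + I lambda_K) / 2].  The bounded part [omega] enters
   only through a potential which is continuous on the closure of [A], so it can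
   be absorbed into [psi]. *)

From HB Require Import structures.
From mathcomp Require Import all_boot all_order all_algebra.
From mathcomp Require Import all_classical all_reals all_analysis.
From mathcomp Require Import measurable_realfun.
From mathcomp Require Import ring lra.
Require Import Defs.

Set Implicit Arguments.
Unset Strict Implicit.
Unset Printing Implicit Defensive.

Import Order.TTheory GRing.Theory Num.Theory.
Import numFieldNormedType.Exports.

Local Open Scope classical_set_scope.
Local Open Scope ring_scope.

(** * Partial sums of the binomial series *)

Section binomial_series.
Context {R : realType}.
Implicit Types (b x u : R) (k N : nat).

(** No single mode of convergence carries a minimizing sequence to its limit. The potential of
    [theta] need not be continuous, so the integrals against it pass to the limit through strong
    convergence and Cauchy-Schwarz; [psi] is only lower semicontinuous and may be infinite, so its
    integral is controlled through weak convergence. The moments tie the two together: they are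
    weakly continuous, and each truncation of the binomial series is a finite positive semidefinite
    form in them. Energy distances are therefore suprema of weakly continuous quantities, and the
    weak limit of a strongly Cauchy minimizing sequence is also its strong limit. The quadratic
    inequalities are proved for the truncations and then passed to the limit; a difference of two
    measures enters only through its moments until the final translation into [strong_norm]. *)

Definition bincoef b k : R := \prod_(i < k) ((b + i%:R) / i.+1%:R).

Definition binsum b N u : R := \sum_(k < N) bincoef b k * u ^+ k.

Lemma bincoefS b k : k.+1%:R * bincoef b k.+1 = (b + k%:R) * bincoef b k.
Proof.
rewrite /bincoef big_ord_recr /=; set p := \prod_(_ < _) _.
by rewrite mulrC -mulrA divfK ?pnatr_eq0// mulrC.
Qed.

Lemma bincoef_ge0 b k : 0 <= b -> 0 <= bincoef b k.
Proof.
by move=> b0; apply: prodr_ge0 => i _; rewrite divr_ge0 ?addr_ge0.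
Qed.

(** Coefficientwise form of the fact that [(1 - u)^(-b)] has derivative [b (1 - u)^(-(b + 1))]. *)
Lemma bincoef_shift b k : k.+1%:R * bincoef b k.+1 = b * bincoef (b + 1) k.
Proof.
elim: k => [|k IH]; first by rewrite bincoefS /bincoef !big_ord0 addr0.
rewrite bincoefS -natr1.
apply: (@mulfI _ k.+1%:R); first by rewrite pnatr_eq0.
by rewrite mulrCA IH [RHS]mulrCA bincoefS; ring.
Qed.

Lemma binsumS b N u : binsum b N.+1 u = binsum b N u + bincoef b N * u ^+ N.
Proof. by rewrite /binsum big_ord_recr. Qed.

Lemma binsum_ge0 b N u : 0 <= b -> 0 <= u -> 0 <= binsum b N u.
Proof.
by move=> b0 u0; apply: sumr_ge0 => k _; rewrite mulr_ge0 ?bincoef_ge0 ?exprn_ge0.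
Qed.

Lemma nondecreasing_binsum b u : 0 <= b -> 0 <= u ->
  nondecreasing_seq (fun N => binsum b N u).
Proof.
move=> b0 u0; apply/nondecreasing_seqP => N.
by rewrite binsumS lerDl mulr_ge0 ?bincoef_ge0 ?exprn_ge0.
Qed.

Lemma ler_binsum b N u x : 0 <= b -> 0 <= u -> u <= x ->
  binsum b N u <= binsum b N x.
Proof.
move=> b0 u0 ux; apply: ler_sum => k _.
by rewrite ler_wpM2l ?bincoef_ge0// lerXn2r ?nnegrE// (le_trans u0).
Qed.

Let dbinsum b N x : R := \sum_(k < N) bincoef b k * (k%:R * x ^+ k.-1).

Let is_derive_binsum b N x : is_derive x 1 (binsum b N) (dbinsum b N x).
Proof.
elim: N => [|N IH].
  have -> : binsum b 0 = cst 0 by apply/funext => y; rewrite /binsum big_ord0.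
  by rewrite /dbinsum big_ord0; exact: is_derive_cst.
have -> : binsum b N.+1 = binsum b N + (bincoef b N \*: (fun y => y ^+ N)).
  by apply/funext => y; rewrite binsumS.
rewrite /dbinsum big_ord_recr/=; apply: is_deriveD.
have h : is_derive x 1 (fun y : R => y ^+ N) (N%:R * x ^+ N.-1).
  split; first exact: exprn_derivable.
  by rewrite exp_derive /GRing.scale /= mulr1.
exact: is_deriveZ.
Qed.

(** The function [(1 - x)^(-b)] solves [(1 - x) y' = b y]; a partial sum solves it up to one term,
    the others cancelling by [bincoefS]. *)
Let dbinsumE b N x : (1 - x) * dbinsum b N x =
  b * binsum b N x - N%:R * bincoef b N * x ^+ N.-1.
Proof.
elim: N => [|N IH].
  by rewrite /dbinsum /binsum !big_ord0 !mul0r !mulr0 subr0.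
rewrite /dbinsum big_ord_recr /= -/(dbinsum b N x) mulrDr IH binsumS.
rewrite bincoefS; case: N {IH} => [|N] /=; first by rewrite !expr0; ring.
by rewrite exprS; ring.
Qed.

(* The derivative of [g b N] telescopes to the single term in [is_derive_g],
   which bounds [1 - g b N u] on both sides by the mean value theorem. *)
Let g b N x : R := binsum b N x * expR (b * ln (1 - x)).

Let is_derive_g b N x : x < 1 -> is_derive x 1 (g b N)
  (- (N%:R * bincoef b N * x ^+ N.-1 * expR (b * ln (1 - x)) / (1 - x))).
Proof.
move=> x1; have x1' : 1 - x != 0 by rewrite subr_eq0 gt_eqF.
have dS := is_derive_binsum b N x.
have d1 : is_derive x 1 (fun y => 1 - y) (-1).
  by have := is_deriveB (is_derive_cst (1 : R) x (1 : R)) (is_derive_id x (1 : R)); rewrite sub0r.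
have dln : is_derive (1 - x) 1 (@ln R) (1 - x)^-1.
  by apply: is_derive1_ln; rewrite subr_gt0.
have d2 := @is_derive1_comp _ (@ln R) (fun y => 1 - y) x _ _ dln d1.
have d3 : is_derive x 1 (fun y => b * ln (1 - y)) (b * ((1 - x)^-1 * -1)).
  exact: is_deriveZ.
have d4 := @is_derive1_comp _ (@expR R) _ x _ _ (is_derive_expR _) d3.
have d5 := is_deriveM dS d4.
apply: is_derive_eq.
rewrite /GRing.scale /=; set e := expR _.
have := dbinsumE b N x; set d := dbinsum b N x => /(canRL (mulKf x1')) ->.
by field.
Qed.

Let g_MVT b N u : 0 < b -> 0 < u -> u < 1 ->
  exists2 c : R, 0 < c < u & g b N u - g b N 0 =
  - (N%:R * bincoef b N * c ^+ N.-1 * expR (b * ln (1 - c)) / (1 - c)) * u.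
Proof.
move=> b0 u0 u1.
have dg x : x <= u -> is_derive x 1 (g b N)
    (- (N%:R * bincoef b N * x ^+ N.-1 * expR (b * ln (1 - x)) / (1 - x))).
  by move=> xu; apply: is_derive_g; exact: le_lt_trans u1.
have [||c] := @MVT _ (g b N) (fun x => - (N%:R * bincoef b N * x ^+ N.-1 *
  expR (b * ln (1 - x)) / (1 - x))) 0 u u0.
- by move=> x; rewrite in_itv/= => /andP[_ /ltW xu]; exact: dg.
- apply: derivable_within_continuous => x; rewrite in_itv/= => /andP[_ xu].
  by have := dg _ xu.
- by rewrite in_itv/= => c0u eq; exists c => //; rewrite eq subr0.
Qed.

Lemma binsum0 b N : binsum b N.+1 0 = 1.
Proof.
rewrite /binsum big_ord_recl /= big1.
  by rewrite addr0 /bincoef big_ord0 mul1r.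
by move=> i _; rewrite exprS mul0r mulr0.
Qed.

Let g0 b N : g b N.+1 0 = 1.
Proof. by rewrite /g subr0 ln1 mulr0 expR0 mulr1 binsum0. Qed.

Let gE b N u : u < 1 -> g b N u = binsum b N u * (1 - u) `^ b.
Proof. by move=> u1; rewrite /g /powR ifF// subr_eq0 gt_eqF. Qed.

Lemma binsum_le b N u : 0 < b -> 0 <= u -> u < 1 ->
  binsum b N u <= (1 - u) `^ (- b).
Proof.
move=> b0; rewrite le_eqVlt => /orP[/eqP<- _|u0 u1].
  rewrite subr0 powR1.
  by case: N => [|N]; rewrite ?binsum0// /binsum big_ord0 ler01.
(* The value at 0 is 1 only when the sum contains its constant term, hence [N.+1]. *)
apply: (@le_trans _ _ (binsum b N.+1 u)).
  by apply: nondecreasing_binsum; rewrite ?ltW.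
have h0 : 0 < (1 - u) `^ b by rewrite powR_gt0// subr_gt0.
rewrite powRN -[leRHS]mul1r ler_pdivlMr// -gE// -(g0 b N) -subr_le0.
have [c /andP[c0 cu] ->] := @g_MVT b N.+1 u b0 u0 u1.
rewrite mulNr oppr_le0; apply: mulr_ge0; last exact: ltW.
have c1 : 0 <= 1 - c by rewrite subr_ge0 ltW// (lt_trans cu).
by rewrite !mulr_ge0 ?invr_ge0 ?expR_ge0 ?bincoef_ge0 ?exprn_ge0 ?(ltW b0) ?(ltW c0).
Qed.

Lemma cvg_binsum b u : 0 < b -> 0 <= u -> u < 1 ->
  binsum b N u @[N --> \oo] --> (1 - u) `^ (- b).
Proof.
move=> b0; rewrite le_eqVlt => /orP[/eqP<- _|u0 u1].
  rewrite subr0 powR1.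
  apply/cvgrPdist_le => e e0; exists 1%N => // -[|N]//= _.
  by rewrite binsum0 subrr normr0 ltW.
have u1' : 0 < 1 - u by rewrite subr_gt0.
(* After a shift of the index, [bincoef_shift] makes this [b * u] times the general term of the
   series of exponent [b + 1], whose partial sums are bounded by [binsum_le]. *)
have t0 : (N%:R * bincoef b N * u ^+ N) @[N --> \oo] --> (0 : R).
  suff : (N.+1%:R * bincoef b N.+1 * u ^+ N.+1) @[N --> \oo] --> (0 : R).
    by rewrite (cvg_shiftS (fun N => N%:R * bincoef b N * u ^+ N)).
  rewrite (_ : (fun N => _) = (fun N => (b * u) * (bincoef (b + 1) N * u ^+ N))).
    rewrite -[X in _ --> X](mulr0 (b * u)); apply: cvgMl_tmp.
    apply: cvg_series_cvg_0; apply: nondecreasing_is_cvgn.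
      apply/nondecreasing_seqP => N; rewrite /series/= big_nat_recr//=.
      by rewrite lerDl mulr_ge0 ?bincoef_ge0 ?exprn_ge0 ?ltW// ltr_wpDl ?ltW.
    exists ((1 - u) `^ (- (b + 1))) => _ [N _ <-].
    rewrite /series/= big_mkord; apply: binsum_le => //; last exact: ltW.
    by rewrite ltr_wpDl// ltW.
  by apply/funext => N; rewrite bincoef_shift exprS; ring.
have h0 : 0 < (1 - u) `^ b by rewrite powR_gt0// subr_gt0.
suff : g b N u @[N --> \oo] --> (1 : R).
  move=> gc; have -> : (fun N => binsum b N u) = (fun N => g b N u * (1 - u) `^ (- b)).
    by apply/funext => N; rewrite gE// powRN mulfK ?gt_eqF.
  rewrite -[X in _ --> X]mul1r; exact: cvgMr_tmp.
(* In the derivative given by [g_MVT] at some [c < u], the power of [c] is replaced by that of [u],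
   the exponential is at most 1, and [(1 - c)^-1 <= (1 - u)^-1]. *)
have lo : \forall N \near \oo, 1 - (N%:R * bincoef b N * u ^+ N) * (1 - u)^-1 <= g b N u <= 1.
  exists 1%N => // -[|N]//= _; apply/andP; split; last first.
    rewrite gE// -ler_pdivlMr// -powRN mul1r; apply: binsum_le => //; exact: ltW.
  rewrite lerBlDr -lerBlDl -[X in X - _ <= _](g0 b N).
  have [c /andP[c0 cu] /(congr1 -%R)] := @g_MVT b N.+1 u b0 u0 u1.
  rewrite opprB => ->; rewrite mulNr opprK -[u ^+ N.+1]/(u ^+ N.+1) exprSr.
  have c1 : c < 1 by exact: lt_trans u1.
  have e1 : expR (b * ln (1 - c)) <= 1.
    rewrite -expR0 ler_expR mulr_ge0_le0 ?(ltW b0)// ln_le0// expR0.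
    by rewrite lerBlDr lerDl ltW.
  rewrite -[N.+1.-1]/N.
  have A0 : 0 <= N.+1%:R * bincoef b N.+1 by rewrite mulr_ge0 ?bincoef_ge0 ?ltW.
  rewrite [leLHS](_ : _ = N.+1%:R * bincoef b N.+1 * (c ^+ N * u) *
    (expR (b * ln (1 - c)) / (1 - c))); last by ring.
  rewrite ler_pM//.
  - by rewrite mulr_ge0// mulr_ge0 ?exprn_ge0 ?(ltW c0) ?(ltW u0).
  - by rewrite mulr_ge0 ?expR_ge0 ?invr_ge0 ?subr_ge0 ?(ltW c1).
  - by rewrite ler_wpM2l// ler_wpM2r ?(ltW u0)// lerXn2r ?nnegrE ?(ltW c0) ?(ltW u0) ?(ltW cu).
  - rewrite -[leRHS]mul1r ler_pM ?expR_ge0 ?invr_ge0 ?subr_ge0 ?(ltW c1)//.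
    by rewrite lef_pV2 ?posrE ?subr_gt0// lerD2l lerN2 ltW.
apply: (squeeze_cvgr lo); last exact: cvg_cst.
rewrite -[X in _ --> X]subr0; apply: cvgB; first exact: cvg_cst.
by rewrite -[X in _ --> X](mul0r (1 - u)^-1); apply: cvgMr_tmp.
Unshelve. all: by end_near. Qed.

Lemma binsum1_cvg b : 0 < b -> binsum b N 1 @[N --> \oo] --> +oo%R.
Proof.
move=> b0; apply/cvgryPge => M.
pose M1 := Num.max M 1 + 1.
have M11 : 1 < M1 by rewrite ltr_pwDr// le_max lexx orbT.
have M10 : 0 < M1 by exact: lt_trans M11.
(* Chosen so that [c] to the power [- b] is [M1]: the sums at [1 - c] tend to [M1 > M] and lie below
   those at 1. *)
pose c := M1 `^ (- b^-1).
have c0 : 0 < c by rewrite powR_gt0.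
have c1 : c < 1.
  rewrite /c powRN invf_lt1 ?powR_gt0// -[ltLHS](congr1 (@^~ b^-1) (@powR1 R)).
  by rewrite gt0_ltr_powR ?invr_gt0// nnegrE ltW.
have : binsum b N (1 - c) @[N --> \oo] --> M1.
  rewrite -[M1 in X in _ --> X]powRr1 ?(ltW M10)// -[1 in X in _ --> X](@mulVf _ b) ?gt_eqF//.
  rewrite -[X in X * b]opprK mulNr -mulrN powRrM -/c -[X in X `^ _](subKr 1).
  by apply: cvg_binsum; rewrite ?subr_ge0 ?ltrBlDr ?ltrDl ?ltW.
have MM1 : M < M1 by rewrite (@le_lt_trans _ _ (Num.max M 1)) ?le_max ?lexx// ltrDl.
move/cvgr_gt => /(_ M MM1); apply: filterS => N /ltW /le_trans; apply.
by apply: ler_binsum; rewrite ?subr_ge0 ?gerBl ?ltW.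
Qed.

End binomial_series.

(** * Expansion of the Riesz kernel *)

Section kernel_expansion.
Context {R : realType} {n : nat}.
Local Notation T := (euclid R n).
Implicit Types x y : T.

Definition sqnorm x : R := \sum_(i < n) x ord0 i ^+ 2.

Definition dotp x y : R := \sum_(i < n) x ord0 i * y ord0 i.

Definition vweight x : R := (1 + sqnorm x)^-1.

(* Stereographic coordinates up to rotation and scaling, so that the kernel
   becomes a function of the inner product [ufun], see [ufun1B]. *)
Definition feature x (d : bool + 'I_n) : R :=
  match d with
  | inl true => vweight x
  | inl false => vweight x * sqnorm x
  | inr i => vweight x * (Num.sqrt 2%:R * x ord0 i)
  end.

Definition ufun x y : R := \sum_d feature x d * feature y d.

Lemma sqnorm_ge0 x : 0 <= sqnorm x.
Proof. by apply: sumr_ge0 => i _; exact: sqr_ge0. Qed.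

Lemma sqnorm_eq0 x : (sqnorm x == 0) = (x == 0).
Proof.
apply/eqP/eqP => [/psumr_eq0P h|->].
  apply/rowP => i; apply/eqP; rewrite mxE -sqrf_eq0; apply/eqP.
  by apply: h => // j _; exact: sqr_ge0.
by apply: big1 => i _; rewrite mxE expr0n.
Qed.

Lemma vden_gt0 x : 0 < 1 + sqnorm x.
Proof. by rewrite ltr_pwDl// sqnorm_ge0. Qed.

Lemma vweight_gt0 x : 0 < vweight x.
Proof. by rewrite invr_gt0 vden_gt0. Qed.

Lemma vweight_le1 x : vweight x <= 1.
Proof. by rewrite invf_le1 ?vden_gt0// lerDl sqnorm_ge0. Qed.

Lemma sqnormDZ (a b : R) x y : sqnorm (a *: x + b *: y)%R =
  a ^+ 2 * sqnorm x + 2%:R * a * b * dotp x y + b ^+ 2 * sqnorm y.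
Proof.
rewrite /sqnorm /dotp !mulr_sumr -!big_split/=; apply: eq_bigr => i _.
by rewrite !mxE; ring.
Qed.

Lemma sqnormB x y : sqnorm (x - y)%R = sqnorm x - 2%:R * dotp x y + sqnorm y.
Proof.
have := sqnormDZ 1 (-1) x y; rewrite scale1r scaleN1r => ->; ring.
Qed.

Lemma ufunE x y :
  ufun x y = vweight x * vweight y * (1 + sqnorm x * sqnorm y + 2%:R * dotp x y).
Proof.
rewrite /ufun big_sumType/= big_bool/= /dotp.
transitivity (vweight x * vweight y + vweight x * sqnorm x * (vweight y * sqnorm y)
  + vweight x * vweight y * (2%:R * \sum_(i < n) x ord0 i * y ord0 i)); last by ring.
congr (_ + _); rewrite !mulr_sumr; apply: eq_bigr => i _.
rewrite -[2%:R in RHS](@sqr_sqrtr R) ?ler0n//; ring.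
Qed.

Lemma ufun1B x y : 1 - ufun x y = sqnorm (x - y)%R * (vweight x * vweight y).
Proof.
rewrite ufunE sqnormB /vweight; field.
by rewrite !gt_eqF// vden_gt0.
Qed.

(** Multiplied by [sqnorm x], the last factor in [ufunE] becomes [sqnorm (x + sqnorm x *: y)]. *)
Lemma ufun_ge0 x y : 0 <= ufun x y.
Proof.
rewrite ufunE !mulr_ge0 ?(ltW (vweight_gt0 _))//.
have [/eqP|sx] := eqVneq (sqnorm x) 0.
  rewrite sqnorm_eq0 => /eqP ->; rewrite [dotp _ _]big1 ?mulr0 ?addr0.
    by rewrite addr_ge0// mulr_ge0// sqnorm_ge0.
  by move=> i _; rewrite mxE mul0r.
have sx0 : 0 < sqnorm x by rewrite lt_def sx sqnorm_ge0.
rewrite -(pmulr_rge0 _ sx0).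
have := sqnorm_ge0 (1 *: x + sqnorm x *: y); rewrite sqnormDZ.
by rewrite (_ : 1 ^+ 2 * _ + _ + _ =
   sqnorm x * (1 + sqnorm x * sqnorm y + 2%:R * dotp x y)); last by ring.
Qed.

Lemma ufun_le1 x y : ufun x y <= 1.
Proof.
by rewrite -subr_ge0 ufun1B mulr_ge0 ?sqnorm_ge0// mulr_ge0// ltW// vweight_gt0.
Qed.

Lemma ufun_eq1 x y : (ufun x y == 1) = (x == y).
Proof.
rewrite -[RHS]subr_eq0 -sqnorm_eq0 -[LHS]subr_eq0 -oppr_eq0 opprB ufun1B.
by rewrite !mulf_eq0 !(gt_eqF (vweight_gt0 _)) !orbF.
Qed.

(** The squares of the features of [x] add up to [ufun x x]. *)
Lemma feature_le1 x d : `|feature x d| <= 1.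
Proof.
have : feature x d ^+ 2 <= 1.
  apply: le_trans (ufun_le1 x x).
  by rewrite /ufun (bigD1 d)//= -expr2 lerDl sumr_ge0// => i _; rewrite -expr2 sqr_ge0.
by move=> h; rewrite -ler_sqr ?nnegrE// expr1n real_normK ?num_real.
Qed.

Section exponent.
Variable alpha : R.
Hypothesis alphan : alpha < n%:R.

Definition hexp : R := (n%:R - alpha) / 2%:R.

Lemma hexp_gt0 : 0 < hexp.
Proof. by rewrite divr_gt0// subr_gt0. Qed.

Definition wweight x : R := vweight x `^ hexp.

Lemma wweight_gt0 x : 0 < wweight x.
Proof. by rewrite powR_gt0// vweight_gt0. Qed.

Lemma wweight_le1 x : wweight x <= 1.
Proof.
rewrite -(congr1 (@^~ hexp) (@powR1 R)) ge0_ler_powR ?nnegrE ?vweight_le1//.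
  exact: ltW hexp_gt0.
exact: ltW (vweight_gt0 _).
Qed.

Lemma enormE x : enorm x = Num.sqrt (sqnorm x). Proof. by []. Qed.

Lemma enorm_ge0 x : 0 <= enorm x. Proof. exact: sqrtr_ge0. Qed.

Lemma enorm_powR x : enorm x `^ (alpha - n%:R) = sqnorm x `^ (- hexp).
Proof.
rewrite enormE -powR12_sqrt ?sqnorm_ge0// -powRrM; congr (_ `^ _).
by rewrite /hexp; field.
Qed.

(* The kernel is [wweight x * wweight y * (1 - ufun x y) `^ (- hexp)], which is
   expanded by the binomial series; the limit is [+oo] on the diagonal. *)
Lemma cvg_riesz_kernel x y :
  (wweight x * wweight y * binsum hexp N (ufun x y))%:E @[N --> \oo] -->
  riesz_kernel alpha x y.
Proof.
have w0 : 0 < wweight x * wweight y by rewrite mulr_gt0 ?wweight_gt0.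
rewrite /riesz_kernel -ufun_eq1; case: ifPn => [/eqP ->|u1].
  apply/cvgeryP; apply/cvgryPge => A.
  have /cvgryPge/(_ (A / (wweight x * wweight y))) := binsum1_cvg hexp_gt0.
  by apply: filterS => N; rewrite ler_pdivrMr// mulrC.
apply: cvg_EFin; first by near=> N.
rewrite enorm_powR (_ : _ `^ _ = wweight x * wweight y * (1 - ufun x y) `^ (- hexp)).
  apply: cvgMl_tmp; apply: cvg_binsum; first exact: hexp_gt0.
    exact: ufun_ge0.
  by rewrite lt_neqAle u1 ufun_le1.
have v0 : 0 < vweight x * vweight y by rewrite mulr_gt0 ?vweight_gt0.
rewrite ufun1B powRM ?sqnorm_ge0 ?(ltW v0)// [X in _ * (_ * X)]powRN.
rewrite powRM ?(ltW (vweight_gt0 _))// -/(wweight x) -/(wweight y).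
by rewrite mulrCA divff ?mulr1// gt_eqF.
Unshelve. all: by end_near. Qed.

Lemma riesz_kernel_ge0 x y : (0 <= riesz_kernel alpha x y)%E.
Proof. by rewrite /riesz_kernel; case: ifP => // _; rewrite lee_fin powR_ge0. Qed.

End exponent.
End kernel_expansion.

(** * Moments and energy *)

Section cvg_big.
Context {R : realType} {U : Type} (F : set_system U) {FF : Filter F}.

Lemma cvg_bigsum (I : Type) (s : seq I) (f : I -> U -> R) (l : I -> R) :
  (forall i, f i x @[x --> F] --> l i) ->
  \sum_(i <- s) f i x @[x --> F] --> \sum_(i <- s) l i.
Proof.
move=> fl; elim: s => [|i s IH].
  by under eq_fun do rewrite big_nil; rewrite big_nil; exact: cvg_cst.
by under eq_fun do rewrite big_cons; rewrite big_cons; exact: cvgD.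
Qed.

Lemma cvg_bigprod (I : Type) (s : seq I) (f : I -> U -> R) (l : I -> R) :
  (forall i, f i x @[x --> F] --> l i) ->
  \prod_(i <- s) f i x @[x --> F] --> \prod_(i <- s) l i.
Proof.
move=> fl; elim: s => [|i s IH].
  by under eq_fun do rewrite big_nil; rewrite big_nil; exact: cvg_cst.
by under eq_fun do rewrite big_cons; rewrite big_cons; exact: cvgM.
Qed.

End cvg_big.

(** * Continuity and Borel measurability of the weights and features *)

Section borel_euclid.
Context {R : realType} {n : nat}.
Local Notation T := (euclid R n).

Lemma continuous_measurable_euclid (f : T -> R) :
  continuous f -> measurable_fun setT f.
Proof.
move=> /continuousP cf; apply: (measurability _ (RGenOpens.measurableE R)).
move=> _ [_ [a [b ->] <-]]; rewrite setTI; apply: open_measurable_euclid.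
exact/cf/interval_open.
Qed.

Lemma continuous_sqnorm : continuous (@sqnorm R n).
Proof.
move=> x; rewrite /sqnorm.
apply: (@cvg_bigsum _ _ (nbhs x)) => i.
have h : (fun y : T => y ord0 i) @ x --> x ord0 i by exact: coord_continuous.
exact: (cvgM h h).
Qed.

Lemma continuous_vweight : continuous (@vweight R n).
Proof.
move=> x; have h0 : 1 + sqnorm x != 0 by rewrite gt_eqF// vden_gt0.
apply: (@continuousV _ _ (fun y => 1 + sqnorm y) x h0).
have h1 : {for x, continuous (cst 1 : T -> R)} by exact: cst_continuous.
by have := continuousD h1 (@continuous_sqnorm x).
Qed.

Lemma continuous_feature (d : bool + 'I_n) : continuous ((@feature R n)^~ d).
Proof.
move=> x; have hv := @continuous_vweight x; case: d => [[]|i] /=.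
- exact: hv.
- by apply: (continuousM hv); exact: continuous_sqnorm.
- apply: (continuousM hv).
  apply: (@continuousM _ _ (cst (Num.sqrt 2%:R)) (fun y : T => y ord0 i)).
    exact: cst_continuous.
  exact: coord_continuous.
Qed.

Lemma continuous_wweight (alpha : R) : continuous (@wweight R n alpha).
Proof.
move=> x.
have h : derivable (fun t : R => t `^ (@hexp R n alpha)) (vweight x) 1.
  by apply: derivable_powR; rewrite in_itv/= andbT vweight_gt0.
have /derivable1_diffP/differentiable_continuous c := h.
exact: (continuous_comp (@continuous_vweight x) c).
Qed.

Lemma continuous_enorm : continuous (@enorm R n).
Proof.
move=> x; apply: (continuous_comp (@continuous_sqnorm x)).
exact: sqrt_continuous.
Qed.

End borel_euclid.

Lemma Rintegral_sum d (T : measurableType d) (R : realType)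
  (mu : {measure set T -> \bar R}) (D : set T) (I : Type) (s : seq I) (F : I -> T -> R) :
  measurable D -> (forall i, mu.-integrable D (EFin \o F i)) ->
  mu.-integrable D (EFin \o (fun x => \sum_(i <- s) F i x)) /\
  \int[mu]_(x in D) (\sum_(i <- s) F i x) = \sum_(i <- s) \int[mu]_(x in D) F i x.
Proof.
move=> mD iF; elim: s => [|i s [IH1 IH2]].
  under [X in EFin \o X]eq_fun do rewrite big_nil.
  under eq_Rintegral do rewrite big_nil.
  by split; [exact: integrable0|rewrite big_nil Rintegral_cst// mul0r].
under [X in EFin \o X]eq_fun do rewrite big_cons.
under eq_Rintegral do rewrite big_cons.
split; last by rewrite big_cons RintegralD// IH2.
by apply: (integrableD mD (iF i) IH1).
Qed.

(** * Energies as limits of finite forms in the moments *)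

Section moments.
Context {R : realType} {n : nat}.
Variable alpha : R.
Hypothesis alphan : alpha < n%:R.
Local Notation T := (euclid R n).
Local Notation D := (bool + 'I_n)%type.
Local Notation w := (@wweight R n alpha).
Local Notation h := (@hexp R n alpha).
Implicit Types mu nu : {measure set T -> \bar R}.

(** Multi-indices are words of length [k], ordered and with repetitions, so that the [k]-th power of
    [ufun] expands without multinomial coefficients. *)
Definition feature_prod k (I : {ffun 'I_k -> D}) (x : T) : R :=
  w x * \prod_(j < k) feature x (I j).

Lemma continuous_feature_prod k (I : {ffun 'I_k -> D}) :
  continuous (feature_prod I).
Proof.
move=> x; have h i := @continuous_feature R n (I i) x.
apply: (continuousM (@continuous_wweight R n alpha x)).
exact: (@cvg_bigprod _ _ (nbhs x)).
Qed.

Lemma feature_prod_le k (I : {ffun 'I_k -> D}) x : `|feature_prod I x| <= w x.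
Proof.
rewrite normrM gtr0_norm ?wweight_gt0// ler_piMr ?(ltW (wweight_gt0 _ _))//.
by rewrite normr_prod prodr_ile1// => i _; rewrite normr_ge0 feature_le1.
Qed.

Lemma binsum_featureE N x y : w x * w y * binsum h N (ufun x y) =
  \sum_(k < N) \sum_(I : {ffun 'I_k -> D})
    bincoef h k * feature_prod I x * feature_prod I y.
Proof.
rewrite /binsum mulr_sumr; apply: eq_bigr => k _.
have -> : ufun x y ^+ k = \prod_(j < k) ufun x y by rewrite prodr_const card_ord.
rewrite /ufun bigA_distr_bigA/=.
rewrite !mulr_sumr; apply: eq_bigr => I _.
by rewrite big_split/= /feature_prod; ring.
Qed.

Definition moment mu k (I : {ffun 'I_k -> D}) : R := \int[mu]_x feature_prod I x.

(** The families are arbitrary, not necessarily moments of measures, so that the form applies to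
    differences of moments. *)
Definition moment_form N (m m' : forall k, {ffun 'I_k -> D} -> R) : R :=
  \sum_(k < N) bincoef h k * \sum_(I : {ffun 'I_k -> D}) m k I * m' k I.

(** The weight decays at infinity like the kernel; the condition holds for every [radon_pos]
    ([radon_wintegrable]) and makes all moments finite. *)
Definition wintegrable mu := mu.-integrable setT (EFin \o w).

Lemma feature_prod_integrable mu k (I : {ffun 'I_k -> D}) : wintegrable mu ->
  mu.-integrable setT (EFin \o feature_prod I).
Proof.
move=> wi; apply: (le_integrable measurableT _ _ wi) => [|x _ /=].
  apply/measurable_EFinP; apply: continuous_measurable_euclid.
  exact: continuous_feature_prod.
by rewrite lee_fin (ger0_norm (ltW (wweight_gt0 _ x))) feature_prod_le.
Qed.

Let kern N x y : R := w x * w y * binsum h N (ufun x y).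

Let kern_ge0 N x y : 0 <= kern N x y.
Proof.
rewrite /kern !mulr_ge0 ?(ltW (wweight_gt0 _ _))//.
by rewrite binsum_ge0 ?ufun_ge0// ltW// hexp_gt0.
Qed.

Let kern_nd x y : nondecreasing_seq (fun N => (kern N x y)%:E).
Proof.
move=> N M NM; rewrite lee_fin ler_wpM2l ?mulr_ge0 ?(ltW (wweight_gt0 _ _))//.
by apply: nondecreasing_binsum; rewrite ?ufun_ge0 ?(ltW (hexp_gt0 _)).
Qed.

Let measurable_kern N x : measurable_fun setT (fun y => (kern N x y)%:E).
Proof.
apply/(@measurable_EFinP _ _ _ setT (kern N x)).
rewrite (funext (binsum_featureE N x : kern N x =1 _)).
apply: measurable_sum => k; apply: measurable_sum => I.
apply: measurable_funM => //; apply: continuous_measurable_euclid.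
exact: continuous_feature_prod.
Qed.

(** Potential of [nu] for the kernel cut after [N] terms ([integral_kern]): a finite combination of
    feature products. *)
Let pot N nu x : R :=
  \sum_(k < N) \sum_(I : {ffun 'I_k -> D}) bincoef h k * feature_prod I x * moment nu I.

Let integral_kern N nu x : wintegrable nu ->
  (\int[nu]_y (kern N x y)%:E = (pot N nu x)%:E)%E.
Proof.
move=> wi; rewrite /kern; under eq_integral do rewrite binsum_featureE.
have i1 k (I : {ffun 'I_k -> D}) : nu.-integrable setT
    (EFin \o (fun y => bincoef h k * feature_prod I x * feature_prod I y)).
  by have := integrableZl measurableT (bincoef h k * feature_prod I x) (feature_prod_integrable I wi).
have i2 (k : nat) := Rintegral_sum (index_enum _) measurableT (i1 k).
have [i3 e3] := Rintegral_sum (index_enum 'I_N) measurableT (fun k => (i2 k).1).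
rewrite -[LHS]fineK; last exact: integrable_fin_num i3.
congr (_%:E); rewrite [LHS]e3; apply: eq_bigr => k _.
rewrite (i2 k).2; apply: eq_bigr => I _.
by rewrite RintegralZl//; exact: feature_prod_integrable.
Qed.

Let potE N nu x : pot N nu x =
  \sum_(k < N) \sum_(I : {ffun 'I_k -> D}) (bincoef h k * moment nu I) * feature_prod I x.
Proof. by apply: eq_bigr => k _; apply: eq_bigr => I _; rewrite mulrAC. Qed.

Let measurable_pot N nu : measurable_fun setT (fun x => (pot N nu x)%:E).
Proof.
apply/(@measurable_EFinP _ _ _ setT (pot N nu)).
rewrite (funext (potE N nu)).
apply: measurable_sum => k; apply: measurable_sum => I.
apply: measurable_funM => //; apply: continuous_measurable_euclid.
exact: continuous_feature_prod.
Qed.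

Let integral_pot N mu nu : wintegrable mu ->
  (\int[mu]_x (pot N nu x)%:E = (moment_form N (@moment mu) (@moment nu))%:E)%E.
Proof.
move=> wi; under eq_integral do rewrite potE.
have i1 k (I : {ffun 'I_k -> D}) : mu.-integrable setT
    (EFin \o (fun x => (bincoef h k * moment nu I) * feature_prod I x)).
  by have := integrableZl measurableT (bincoef h k * moment nu I) (feature_prod_integrable I wi).
have i2 (k : nat) := Rintegral_sum (index_enum _) measurableT (i1 k).
have [i3 e3] := Rintegral_sum (index_enum 'I_N) measurableT (fun k => (i2 k).1).
rewrite -[LHS]fineK; last exact: integrable_fin_num i3.
congr (_%:E); rewrite [LHS]e3; apply: eq_bigr => k _.
rewrite (i2 k).2 mulr_sumr; apply: eq_bigr => I _.
by rewrite RintegralZl//; [rewrite -mulrA [moment nu I * _]mulrC|exact: feature_prod_integrable].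
Qed.

Lemma cvg_potential_pos nu x : wintegrable nu ->
  ((pot N nu x)%:E @[N --> \oo] --> potential_pos alpha nu x)%E.
Proof.
move=> wi; under eq_fun do rewrite -(integral_kern _ _ wi).
rewrite /potential_pos.
have -> : (fun y => riesz_kernel alpha x y) = (fun y => limn (fun N => (kern N x y)%:E)).
  by apply/funext => y; apply/esym/cvg_lim => //; exact: cvg_riesz_kernel.
apply: (@cvg_monotone_convergence _ _ _ nu setT measurableT
  (fun N y => (kern N x y)%:E)) => [N|N y _|y _].
- exact: measurable_kern.
- by rewrite lee_fin.
- exact: kern_nd.
Qed.

Let pot_ge0 N nu x : wintegrable nu -> (0 <= (pot N nu x)%:E)%E.
Proof.
by move=> wi; rewrite -integral_kern//; apply: integral_ge0 => y _; rewrite lee_fin.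
Qed.

Let pot_nd nu x : wintegrable nu -> nondecreasing_seq (fun N => (pot N nu x)%:E).
Proof.
move=> wi N M NM; rewrite -!integral_kern//; apply: ge0_le_integral => //.
- by move=> y _; rewrite lee_fin.
- by move=> y _; exact: kern_nd.
Qed.

Let potential_posE nu : wintegrable nu ->
  potential_pos alpha nu = fun x => limn (fun N => (pot N nu x)%:E).
Proof.
move=> wi; apply/funext => x; apply/esym/cvg_lim => //.
exact: cvg_potential_pos.
Qed.

Lemma measurable_potential_pos nu : wintegrable nu ->
  measurable_fun setT (potential_pos alpha nu).
Proof.
move=> wi; apply: (@emeasurable_fun_cvg _ _ _ _ (fun N x => (pot N nu x)%:E)) => //.
by move=> x _; exact: cvg_potential_pos.
Qed.

Lemma potential_pos_ge0 nu x : (0 <= potential_pos alpha nu x)%E.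
Proof. by apply: integral_ge0 => y _; exact: riesz_kernel_ge0. Qed.

(** The truncated kernels increase because [ufun] is nonnegative, so monotone convergence applies in
    [y] ([cvg_potential_pos]) and then in [x]. *)
Lemma cvg_energy_pos mu nu : wintegrable mu -> wintegrable nu ->
  ((moment_form N (@moment mu) (@moment nu))%:E @[N --> \oo] --> energy_pos alpha mu nu)%E.
Proof.
move=> wm wn; under eq_fun do rewrite -(integral_pot _ _ wm).
have -> : energy_pos alpha mu nu = (\int[mu]_x limn (fun N => (pot N nu x)%:E))%E.
  by rewrite -potential_posE.
apply: (@cvg_monotone_convergence _ _ _ mu setT measurableT
  (fun N x => (pot N nu x)%:E)) => [N|N x _|x _].
- exact: measurable_pot.
- exact: pot_ge0.
- exact: pot_nd.
Qed.

Lemma nondecreasing_moment_form mu nu : wintegrable mu -> wintegrable nu ->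
  nondecreasing_seq (fun N => moment_form N (@moment mu) (@moment nu)).
Proof.
move=> wm wn N M NM; rewrite -lee_fin -!integral_pot//.
apply: ge0_le_integral => // [x _|x _]; first exact: pot_ge0.
exact: pot_nd.
Qed.

Lemma energy_pos_sup mu nu : wintegrable mu -> wintegrable nu ->
  energy_pos alpha mu nu =
  ereal_sup (range (fun N => (moment_form N (@moment mu) (@moment nu))%:E)).
Proof.
move=> wm wn; have /(cvg_unique (@ereal_hausdorff R)) h := cvg_energy_pos wm wn.
by apply/h/ereal_nondecreasing_cvgn => N M NM; rewrite lee_fin nondecreasing_moment_form.
Qed.

Lemma moment_form_le_energy mu nu N : wintegrable mu -> wintegrable nu ->
  ((moment_form N (@moment mu) (@moment nu))%:E <= energy_pos alpha mu nu)%E.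
Proof. by move=> wm wn; rewrite energy_pos_sup//; apply: ereal_sup_ubound; exists N. Qed.

Lemma energy_pos_le mu nu (M : \bar R) : wintegrable mu -> wintegrable nu ->
  (forall N, ((moment_form N (@moment mu) (@moment nu))%:E <= M)%E) ->
  (energy_pos alpha mu nu <= M)%E.
Proof.
by move=> wm wn h; rewrite energy_pos_sup//; apply: ge_ereal_sup => _ [N _ <-].
Qed.

Lemma energy_pos_ge0 mu nu : (0 <= energy_pos alpha mu nu)%E.
Proof. by apply: integral_ge0 => x _; exact: potential_pos_ge0. Qed.

Lemma moment_formC N m m' : moment_form N m m' = moment_form N m' m.
Proof.
apply: eq_bigr => k _; congr (_ * _); apply: eq_bigr => I _; exact: mulrC.
Qed.

Lemma moment_form_linear N (a b : R) m m' m'' :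
  moment_form N (fun k I => a * m k I + b * m' k I) m'' =
  a * moment_form N m m'' + b * moment_form N m' m''.
Proof.
rewrite /moment_form !mulr_sumr -big_split/=; apply: eq_bigr => k _.
rewrite !mulr_sumr -big_split/=; apply: eq_bigr => I _; ring.
Qed.

Lemma moment_form_ge0 N m : 0 <= moment_form N m m.
Proof.
apply: sumr_ge0 => k _; rewrite mulr_ge0 ?bincoef_ge0 ?(ltW (hexp_gt0 _))//.
by apply: sumr_ge0 => I _; rewrite -expr2 sqr_ge0.
Qed.

Lemma moment_form_quad N (a b : R) m m' :
  moment_form N (fun k I => a * m k I + b * m' k I) (fun k I => a * m k I + b * m' k I) =
  a ^+ 2 * moment_form N m m + 2%:R * a * b * moment_form N m m' +
  b ^+ 2 * moment_form N m' m'.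
Proof.
rewrite moment_form_linear [X in a * X]moment_formC [X in b * X]moment_formC.
rewrite !moment_form_linear (moment_formC N m' m); ring.
Qed.

Lemma moment_form_le_half N m m' :
  moment_form N m m' <= (moment_form N m m + moment_form N m' m') / 2%:R.
Proof.
have := moment_form_ge0 N (fun k I => 1 * m k I + (-1) * m' k I).
rewrite moment_form_quad; lra.
Qed.

Definition fin_energy mu := wintegrable mu /\ (energy_pos alpha mu mu < +oo)%E.

Definition energyR mu nu : R := fine (energy_pos alpha mu nu).

(** By [moment_form_le_half], every truncation of the mutual energy is at most the mean of the two
    self-energies. *)
Lemma energy_posE mu nu : fin_energy mu -> fin_energy nu ->
  energy_pos alpha mu nu = (energyR mu nu)%:E.
Proof.
move=> [wm em] [wn en]; rewrite fineK// ge0_fin_numE ?energy_pos_ge0//.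
have fm : energy_pos alpha mu mu \is a fin_num by rewrite ge0_fin_numE ?energy_pos_ge0.
have fn : energy_pos alpha nu nu \is a fin_num by rewrite ge0_fin_numE ?energy_pos_ge0.
apply: (@le_lt_trans _ _ ((energyR mu mu + energyR nu nu) / 2%:R)%:E); last exact: ltry.
apply: energy_pos_le => // N; rewrite lee_fin (le_trans (moment_form_le_half _ _ _))//.
rewrite ler_pM2r ?invr_gt0// lerD// -lee_fin fineK//; exact: moment_form_le_energy.
Qed.

Lemma energyR_ge0 mu nu : 0 <= energyR mu nu.
Proof. by rewrite fine_ge0 ?energy_pos_ge0. Qed.

Lemma cvg_energyR mu nu : fin_energy mu -> fin_energy nu ->
  moment_form N (@moment mu) (@moment nu) @[N --> \oo] --> energyR mu nu.
Proof.
move=> fm fn; apply: (@fine_cvg _ _ _ _ (fun N => (moment_form N (@moment mu) (@moment nu))%:E)).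
by rewrite -energy_posE//; apply: cvg_energy_pos; [exact: fm.1|exact: fn.1].
Qed.

Lemma energyRC mu nu : fin_energy mu -> fin_energy nu ->
  energyR mu nu = energyR nu mu.
Proof.
move=> fm fn; apply: (cvg_unique _ (cvg_energyR fm fn)) => //.
rewrite /= (funext (fun N => moment_formC N _ _)); exact: cvg_energyR.
Qed.

(* The squared energy norm of [mu - nu], which need not be a measure. *)
Definition dist2 mu nu : R := energyR mu mu - 2%:R * energyR mu nu + energyR nu nu.

Definition moment_diff mu nu k (I : {ffun 'I_k -> D}) : R := moment mu I - moment nu I.

Lemma moment_form_diff N mu nu :
  moment_form N (moment_diff mu nu) (moment_diff mu nu) =
  moment_form N (@moment mu) (@moment mu) - 2%:R * moment_form N (@moment mu) (@moment nu)
  + moment_form N (@moment nu) (@moment nu).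
Proof.
have := moment_form_quad N 1 (-1) (@moment mu) (@moment nu).
have -> : (fun k (I : {ffun 'I_k -> D}) => 1 * moment mu I + -1 * moment nu I) = moment_diff mu nu.
  by apply: functional_extensionality_dep => k; apply/funext => I; rewrite /moment_diff mul1r mulN1r.
by move=> ->; ring.
Qed.

Lemma cvg_dist2 mu nu : fin_energy mu -> fin_energy nu ->
  moment_form N (moment_diff mu nu) (moment_diff mu nu) @[N --> \oo] --> dist2 mu nu.
Proof.
move=> fm fn; rewrite (funext (fun N => moment_form_diff N mu nu)).
apply: cvgD; last exact: cvg_energyR.
apply: cvgB; first exact: cvg_energyR.
by apply: cvgMl_tmp; exact: cvg_energyR.
Qed.

(** Each new term is a nonnegative multiple of a sum of squares. This covers differences of moments,
    so [dist2] is a supremum of finite forms. *)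
Lemma nondecreasing_moment_form_diag m : nondecreasing_seq (fun N => moment_form N m m).
Proof.
apply/nondecreasing_seqP => N; rewrite /moment_form big_ord_recr/= lerDl.
rewrite mulr_ge0 ?bincoef_ge0 ?(ltW (hexp_gt0 _))//.
by apply: sumr_ge0 => I _; rewrite -expr2 sqr_ge0.
Qed.

Lemma moment_form_le_dist2 N mu nu : fin_energy mu -> fin_energy nu ->
  moment_form N (moment_diff mu nu) (moment_diff mu nu) <= dist2 mu nu.
Proof.
move=> fm fn; have h := cvg_dist2 fm fn.
rewrite -(cvg_lim _ h)//; apply: nondecreasing_cvgn_le.
  exact: nondecreasing_moment_form_diag.
by apply/cvg_ex; exists (dist2 mu nu).
Qed.

Lemma dist2_le mu nu (M : R) : fin_energy mu -> fin_energy nu ->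
  (forall N, moment_form N (moment_diff mu nu) (moment_diff mu nu) <= M) ->
  dist2 mu nu <= M.
Proof.
move=> fm fn h; have c := cvg_dist2 fm fn; rewrite -(cvg_lim _ c)//.
by apply: limr_le; [apply/cvg_ex; exists (dist2 mu nu)|exact: nearW].
Qed.

Lemma dist2_ge0 mu nu : fin_energy mu -> fin_energy nu -> 0 <= dist2 mu nu.
Proof.
move=> fm fn; apply: (le_trans (moment_form_ge0 0%N (moment_diff mu nu))).
exact: moment_form_le_dist2.
Qed.

Lemma quad_CS (a b c : R) : 0 <= a -> 0 <= c ->
  (forall t, 0 <= a + 2%:R * t * b + t ^+ 2 * c) -> b ^+ 2 <= a * c.
Proof.
move=> a0 c0 h; have [c00|cn0] := eqVneq c 0.
  rewrite c00 mulr0; have [->|b0] := eqVneq b 0; first by rewrite expr0n.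
  (* This value of [t] turns the quadratic expression into -1. *)
  have := h (- (a + 1) / (2%:R * b)).
  rewrite c00 mulr0 addr0 (_ : _ * b = - (a + 1)); last by field.
  lra.
have cp : 0 < c by rewrite lt_def cn0.
have := h (- b / c); rewrite (_ : _ + _ = a - b ^+ 2 / c); last by field.
by rewrite subr_ge0 ler_pdivrMr.
Qed.

Lemma energyR_CS p q : fin_energy p -> fin_energy q ->
  energyR p q ^+ 2 <= energyR p p * energyR q q.
Proof.
move=> fp fq; apply: quad_CS; rewrite ?energyR_ge0// => t.
have c : moment_form N (@moment p) (@moment p) + 2%:R * t * moment_form N (@moment p) (@moment q)
    + t ^+ 2 * moment_form N (@moment q) (@moment q) @[N --> \oo] -->
    energyR p p + 2%:R * t * energyR p q + t ^+ 2 * energyR q q.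
  apply: cvgD; last by apply: cvgMl_tmp; exact: cvg_energyR.
  by apply: cvgD; [|apply: cvgMl_tmp]; exact: cvg_energyR.
rewrite -(cvg_lim _ c)//; apply: limr_ge.
  by apply/cvg_ex; eexists; exact: c.
apply: nearW => N; have := moment_form_ge0 N (fun k I => 1 * moment p I + t * moment q I).
by rewrite moment_form_quad expr1n mul1r mulr1.
Qed.

(** Cauchy-Schwarz between [p] and the difference of [mu] and [nu], carried out on moments since the
    difference need not be a measure. It turns strong convergence into convergence of mutual
    energies. *)
Lemma energyR_diff_CS p mu nu : fin_energy p -> fin_energy mu -> fin_energy nu ->
  (energyR p mu - energyR p nu) ^+ 2 <= energyR p p * dist2 mu nu.
Proof.
move=> fp fm fn; apply: quad_CS; rewrite ?energyR_ge0 ?dist2_ge0// => t.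
pose q k (I : {ffun 'I_k -> D}) : R := moment_diff mu nu I.
have c : moment_form N (@moment p) (@moment p) + 2%:R * t *
   (moment_form N (@moment p) (@moment mu) - moment_form N (@moment p) (@moment nu))
    + t ^+ 2 * moment_form N (moment_diff mu nu) (moment_diff mu nu) @[N --> \oo] -->
    energyR p p + 2%:R * t * (energyR p mu - energyR p nu) + t ^+ 2 * dist2 mu nu.
  apply: cvgD; last by apply: cvgMl_tmp; exact: cvg_dist2.
  apply: cvgD; first exact: cvg_energyR.
  by apply: cvgMl_tmp; apply: cvgB; exact: cvg_energyR.
rewrite -(cvg_lim _ c)//; apply: limr_ge.
  by apply/cvg_ex; eexists; exact: c.
apply: nearW => N; have := moment_form_ge0 N (fun k I => 1 * moment p I + t * moment_diff mu nu I).
rewrite moment_form_quad expr1n mul1r mulr1.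
suff -> : moment_form N (@moment p) (moment_diff mu nu) =
  moment_form N (@moment p) (@moment mu) - moment_form N (@moment p) (@moment nu) by [].
rewrite ![moment_form N (@moment p) _]moment_formC.
have := moment_form_linear N 1 (-1) (@moment mu) (@moment nu) (@moment p).
rewrite mul1r mulN1r => <-; congr moment_form.
by apply: functional_extensionality_dep => k; apply/funext => I; rewrite /moment_diff mul1r mulN1r.
Qed.

(** Reverse triangle inequality: self-energies converge under strong convergence. *)
Lemma sqrt_energyR_diff mu nu : fin_energy mu -> fin_energy nu ->
  (Num.sqrt (energyR mu mu) - Num.sqrt (energyR nu nu)) ^+ 2 <= dist2 mu nu.
Proof.
move=> fm fn; rewrite sqrrB !sqr_sqrtr ?energyR_ge0// lerD2r lerD2l lerN2.
rewrite -[leRHS]mulr_natl ler_wpM2l// -sqrtrM ?energyR_ge0//.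
rewrite -[leLHS]ger0_norm ?energyR_ge0// -sqrtr_sqr ler_wsqrtr//; exact: energyR_CS.
Qed.

End moments.

(** * Weak compactness of probabilities on a compact set *)

Lemma nested_compact (T : topologicalType) (K : set T) (Z : nat -> set T) :
  compact K -> (forall k, closed (Z k)) -> (forall k, Z k.+1 `<=` Z k) ->
  (forall k, Z k `<=` K) -> (forall k, Z k !=set0) -> exists p, forall k, Z k p.
Proof.
move=> cK cZ dZ ZK Z0.
have ndZ i j : (i <= j)%N -> Z j `<=` Z i.
  move=> /subnK <-; elim: (j - i)%N => [//|k IH]; rewrite addSn.
  exact: subset_trans (dZ _) IH.
have PF : ProperFilter (filter_from [set: nat] Z).
  apply: filter_from_proper => [|k _]; last exact: Z0.
  apply: filter_from_filter; first by exists 0%N.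
  move=> i j _ _; exists (maxn i j) => //.
  by rewrite subsetI; split; apply: ndZ; rewrite ?leq_maxl ?leq_maxr.
have FK : filter_from [set: nat] Z K by exists 0%N.
have [p [_ clp]] := cK _ PF FK.
exists p => k; apply: cZ => B Bp; apply: clp => //; by exists k.
Qed.

Lemma ultra_cvg_bounded {R : realType} {I : Type} (U : set_system I) (r : I -> R) a b :
  UltraFilter U -> (forall i, a <= r i <= b) -> exists l : R, r i @[i --> U] --> l.
Proof.
move=> UU rab; have cK := @segment_compact R a b.
have PF : ProperFilter (r @ U) by apply: fmap_proper_filter; exact: ultra_proper.
have FK : (r @ U) `[a, b]%classic by apply: (@filterE _ U) => i /=; rewrite in_itv /=; exact: rab.
have [l [_ cll]] := cK _ PF FK.
exists l => V Vl; have [//|nV] := in_ultra_setVsetC (r @^-1` V) UU.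
have [z [nz Vz]] := cll (~` V) V nV Vl.
by [].
Qed.

Lemma lee_of_lt_real {R : realType} (x y : \bar R) :
  (forall a : R, (a%:E < x)%E -> (a%:E <= y)%E) -> (x <= y)%E.
Proof.
move=> h; rewrite leNgt; apply/negP => yx.
case: y yx h => [r| |]; case: x => [s| |]//=; rewrite ?lte_fin.
- move=> rs /(_ ((r + s) / 2%:R)); rewrite lte_fin lee_fin midf_lt// => /(_ isT).
  by rewrite leNgt midf_lt.
- by move=> _ /(_ (r + 1)); rewrite ltry lee_fin gerDl ler10 => /(_ isT).
- by move=> _ /(_ (s - 1)); rewrite lte_fin ltrBlDr ltrDl ltr01 leeNy_eq => /(_ isT).
- by move=> _ /(_ 0); rewrite ltry leeNy_eq => /(_ isT).
Qed.

Section weak_compactness.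
Context {R : realType} {n : nat}.
Local Notation T := (euclid R n).
Variable K : set T.
Hypothesis cptK : compact K.
Variable mu : nat -> {measure set T -> \bar R}.
Hypothesis mu1 : forall j, mu j setT = 1%E.
Hypothesis muK : forall j, mu j (~` K) = 0%E.
Variable U : set_system nat.
Hypothesis UU : UltraFilter U.

Let FU : ProperFilter U. Proof. exact: ultra_proper. Qed.

Let mK : measurable K. Proof. exact: compact_measurable_euclid. Qed.

Let mu_le1 j (B : set T) : measurable B -> (mu j B <= 1)%E.
Proof. by move=> mB; rewrite -(mu1 j); apply: le_measure; rewrite ?inE. Qed.

Let mu_fin j (B : set T) : measurable B -> mu j B \is a fin_num.
Proof. by move=> mB; rewrite ge0_fin_numE// (le_lt_trans (mu_le1 j mB))// ltry. Qed.

(* The limit along the ultrafilter is only a finitely additive content.  It is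
   turned into a measure by placing consecutive intervals of [0, 1[ with the
   content of the cells as lengths, and mapping a point of [0, 1[ to the point
   of [K] in the closures of all the cells whose intervals contain it. *)
Let content_ex (B : set T) : exists l : R, measurable B -> fine (mu j B) @[j --> U] --> l.
Proof.
have [mB|nB] := pselect (measurable B); last by exists 0.
have [j|l hl] := @ultra_cvg_bounded R nat U (fun j => fine (mu j B)) 0 1 UU.
  by rewrite fine_ge0//= -lee_fin fineK ?mu_fin// mu_le1.
by exists l.
Qed.

Let content (B : set T) : R := sval (cid (content_ex B)).

Let contentP (B : set T) : measurable B -> fine (mu j B) @[j --> U] --> content B.
Proof. exact: (svalP (cid (content_ex B))). Qed.

Let content_ge0 B : measurable B -> 0 <= content B.
Proof.
move=> mB; have h := contentP mB; rewrite -(cvg_lim _ h)//.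
apply: limr_ge; first by apply/cvg_ex; eexists; exact: h.
by apply: nearW => j; rewrite fine_ge0.
Qed.

Let contentI A B : measurable A -> measurable B ->
  content A = content (A `&` B) + content (A `&` ~` B).
Proof.
move=> mA mB; have mAB := measurableI _ _ mA mB.
have mAC := measurableI _ _ mA (measurableC mB).
apply: (cvg_unique _ (contentP mA)) => //.
rewrite /= (_ : (fun j => _) = (fun j => fine (mu j (A `&` B)) + fine (mu j (A `&` ~` B)))).
  exact: cvgD (contentP mAB) (contentP mAC).
apply/funext => j; rewrite -fineD ?mu_fin//; congr fine; rewrite -measureU//.
  by rewrite -setIUr setUv setIT.
by rewrite setIACA setICr setI0.
Qed.

Let contentK : content K = 1.
Proof.
apply: (cvg_unique _ (contentP mK)) => //.
rewrite /= (_ : (fun j => _) = cst 1); first exact: cvg_cst.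
apply/funext => j; have := mu1 j; rewrite -(setUv K) measureU ?setICr//; last exact: measurableC.
by rewrite [X in (_ + X)%E](muK j) adde0 => ->.
Qed.

(** Half-spaces with rational bounds, enumerated by [pickle]; an index that codes no pair gives the
    empty set, which splits no cell. *)
Let C (k : nat) : set T :=
  if unpickle k is Some (i, q) then [set x : T | x ord0 i < ratr q] else set0.

Let mC k : measurable (C k).
Proof.
rewrite /C; case: unpickle => [[i q]|]; last exact: measurable0.
apply: open_measurable_euclid.
rewrite (_ : [set x : T | _] = (fun x : T => x ord0 i) @^-1` [set r : R | r < ratr q])//.
apply: open_comp; last exact: open_lt.
by move=> x _; exact: coord_continuous.
Qed.

(** A rational strictly between two distinct coordinates gives a half-space such that neither its
    closure nor that of its complement contains both points. The disjunctions keep the statement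
    symmetric, for the [wlog]. *)
Let separated (x y : T) : x != y -> exists k,
  ((~ closure (C k) x) \/ ~ closure (C k) y) /\
  ((~ closure (~` C k) x) \/ ~ closure (~` C k) y).
Proof.
wlog [i xy] : x y / exists i, x ord0 i < y ord0 i.
  move=> h xy; have /rV0Pn[i] : x - y != 0 by rewrite subr_eq0.
  rewrite !mxE subr_eq0 neq_lt => /orP[]lt; first by apply: h => //; exists i.
  have [//||k hk] := h y x _ _; [by exists i|by rewrite eq_sym|].
  by exists k; case: hk => [[?|?] [?|?]]; split; tauto.
move=> _; have [q /=] := rat_in_itvoo xy; rewrite in_itv/= => /andP[xq qy].
exists (pickle (i, q)); rewrite /C pickleK.
have ci : continuous (fun z : T => z ord0 i) by move=> z; exact: coord_continuous.
split.
  right => /(_ [set z : T | ratr q < z ord0 i]) [].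
    apply: open_nbhs_nbhs; split => //.
    rewrite (_ : [set z : T | _] = (fun z : T => z ord0 i) @^-1` [set r : R | ratr q < r])//.
    by apply: open_comp; [move=> z _; exact: ci|exact: open_gt].
  by move=> z [/= zq qz]; move: (lt_trans zq qz); rewrite ltxx.
left => /(_ [set z : T | z ord0 i < ratr q]) [].
  apply: open_nbhs_nbhs; split => //.
  rewrite (_ : [set z : T | _] = (fun z : T => z ord0 i) @^-1` [set r : R | r < ratr q])//.
  by apply: open_comp; [move=> z _; exact: ci|exact: open_lt].
by move=> z [].
Qed.

(** Words grow at the head; the letter added at depth [k] selects a side of [C k], so the cells of
    the words of length [k] partition [K]. *)
Let Fixpoint cell (s : seq bool) : set T :=
  if s is b :: s' then cell s' `&` (if b then C (size s') else ~` C (size s')) else K.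

Let mcell s : measurable (cell s).
Proof.
elim: s => [//|b s IH] /=; apply: measurableI => //; case: b => //.
exact: measurableC.
Qed.

Let cellK s : cell s `<=` K.
Proof. by elim: s => [//|b s IH] x [/IH]. Qed.

Let m s := content (cell s).

Let m_ge0 s : 0 <= m s. Proof. exact: content_ge0. Qed.

Let mS s : m s = m (true :: s) + m (false :: s).
Proof. exact: contentI. Qed.

(** Left end of the interval of length [m s] attached to [cell s]; its two children share it, [true]
    on the left. *)
Let Fixpoint lft (s : seq bool) : R :=
  if s is b :: s' then (if b then lft s' else lft s' + m (true :: s')) else 0.

(** For [u] in [0, 1[, the word of length [k] whose interval contains [u] ([codeP], [code_eq]). *)
Let Fixpoint code (u : R) (k : nat) : seq bool :=
  if k is k'.+1 then (u < lft (code u k') + m (true :: code u k')) :: code u k' else [::].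

Let size_code u k : size (code u k) = k.
Proof. by elim: k => [//|k /= ->]. Qed.

Let lft_ge0 s : 0 <= lft s.
Proof. by elim: s => [//|[] s IH] //=; rewrite addr_ge0. Qed.

Let lft_sub s b : lft s <= lft (b :: s) /\ lft (b :: s) + m (b :: s) <= lft s + m s.
Proof.
case: b; rewrite [lft (_ :: _)]/= (mS s); first by split; rewrite // lerD2l lerDl.
by rewrite -addrA lerDl.
Qed.

Let lft_le1 s : lft s + m s <= 1.
Proof.
elim: s => [|b s]; first by rewrite /= add0r /m /= contentK.
by apply: le_trans; exact: (lft_sub s b).2.
Qed.

Let codeP u k : 0 <= u < 1 ->
  lft (code u k) <= u < lft (code u k) + m (code u k).
Proof.
move=> u01; elim: k => [|k /andP[IH1 IH2]]; first by rewrite /= add0r /m/= contentK.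
rewrite [code u k.+1]/=; case: ltP => h; first by rewrite IH1.
by rewrite [lft (_ :: _)]/= h/= -addrA -mS.
Qed.

Let code_eq u s : lft s <= u < lft s + m s -> code u (size s) = s.
Proof.
elim: s => [//|b s IH] /andP[h1 h2].
have [h3 h4] := lft_sub s b.
have cs : code u (size s) = s by apply: IH; rewrite (le_trans h3)// (lt_le_trans h2).
rewrite /= cs; congr (_ :: _); case: b h1 h2 {h3 h4} => /= h1 h2; first by rewrite h2.
by rewrite ltNge h1.
Qed.

Let D : set (measurableTypeR R) := `[0, 1[%classic.
Let mD : measurable D. Proof. exact: measurable_itv. Qed.
Let P : {measure set (measurableTypeR R) -> \bar R} := mrestr (@lebesgue_measure R) mD.

(** Outside [0, 1[ a code may designate an empty cell; these points, not charged by [P], are sent to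
    0. *)
Let clamp (u : R) : R := if 0 <= u < 1 then u else 0.

Let clamp01 u : 0 <= clamp u < 1.
Proof. by rewrite /clamp; case: ifPn => // _; rewrite lexx ltr01. Qed.

Let kode u k := code (clamp u) k.

Let code_preimage s : D `&` [set u | kode u (size s) = s] = `[lft s, lft s + m s[%classic.
Proof.
apply/seteqP; split => u /=.
  rewrite /D/= !in_itv/= => -[u01]; rewrite /kode /clamp u01 => us.
  by have := codeP (size s) u01; rewrite us.
rewrite /D/= !in_itv/= => h; have u01 : 0 <= u < 1.
  case/andP: h => h1 h2; rewrite (le_trans (lft_ge0 s) h1)/=.
  exact: lt_le_trans h2 (lft_le1 s).
by split=> //; rewrite /kode /clamp u01; exact: code_eq.
Qed.

Let P_kode s : P [set u | kode u (size s) = s] = (m s)%:E.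
Proof.
rewrite /P /= /mrestr setIC code_preimage lebesgue_measure_itv/= lte_fin ltrDl.
case: ltP => h; first by rewrite -EFinD addrAC subrr add0r.
by congr EFin; apply/le_anti; rewrite h m_ge0.
Qed.

Let measurable_kode s : measurable ([set u | kode u (size s) = s] : set (measurableTypeR R)).
Proof.
have mc : measurable_fun setT (clamp : measurableTypeR R -> measurableTypeR R).
  apply: measurable_fun_if => //.
  - apply: (@measurable_fun_bool _ _ _ _ true); rewrite setTI.
    by rewrite (_ : _ @^-1` _ = D)// /D; apply/seteqP; split => u; rewrite /= in_itv.
suff h : measurable ([set u | code u (size s) = s] : set (measurableTypeR R)).
  by have := mc measurableT _ h; rewrite setTI.
elim: s => [|b s IH].
  by rewrite (_ : [set _ | _] = setT)//; apply/seteqP; split.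
set c := lft s + m (true :: s).
rewrite (_ : [set _ | _] = [set u | code u (size s) = s] `&`
    (if b then [set` `]-oo, c[] else [set` `[c, +oo[])).
  by apply: measurableI => //; case: b; exact: measurable_itv.
apply/seteqP; split => u /=.
  move=> [h1 h2]; rewrite h2; split=> //; rewrite h2 in h1.
  by case: b h1 => /= h1; rewrite in_itv/= ?andbT// leNgt; apply: negbT.
move=> [->] h; congr (_ :: _); case: b h => /=; rewrite in_itv/= ?andbT//.
by rewrite leNgt => /negbTE.
Qed.

(** The interval containing [clamp u] has positive length, and the empty set has content 0. *)
Let cell_kode u k : cell (kode u k) !=set0.
Proof.
have /andP[h1 h2] := codeP k (clamp01 u).
have m0 : 0 < m (kode u k) by have := le_lt_trans h1 h2; rewrite ltrDl.
apply/set0P/eqP => c0; move: m0; rewrite /m c0.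
have -> : content set0 = 0.
  apply: (cvg_unique _ (contentP measurable0)) => //.
  rewrite /= (_ : (fun j => _) = cst 0); first exact: cvg_cst.
  by apply/funext => j; rewrite measure0.
by rewrite ltxx.
Qed.

Let cellS s b : cell (b :: s) `<=` cell s.
Proof. by move=> x []. Qed.

Let closure_cellK s : closure (cell s) `<=` K.
Proof.
have cK : closed K by apply: compact_closed cptK; exact: norm_hausdorff.
by apply: subset_trans (closure_subset (@cellK s)) _; rewrite -(closure_id K).1.
Qed.

Let X_ex u : exists p, forall k, closure (cell (kode u k)) p.
Proof.
apply: (@nested_compact _ K) => // k.
- exact: closed_closure.
- by apply: closure_subset; rewrite /kode/=; exact: cellS.
- have [x hx] := cell_kode u k; exists x; exact: subset_closure.
Qed.

Let X u : T := sval (cid (X_ex u)).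

Let XP u k : closure (cell (kode u k)) (X u).
Proof. exact: (svalP (cid (X_ex u))). Qed.

Let XK u : K (X u).
Proof. exact: (@closure_cellK (kode u 0%N) _ (@XP u 0%N)). Qed.

(** Otherwise compactness gives a point outside [V] common to all the closures; a half-space
    separating it from [X u] then contradicts the next cell of the code. *)
Let cell_near u V : open V -> V (X u) -> exists k, closure (cell (kode u k)) `<=` V.
Proof.
move=> oV Vx; apply: contrapT => /forallNP h.
have [p hp] : exists p, forall k, (closure (cell (kode u k)) `&` ~` V) p.
  apply: (@nested_compact _ K) => // k.
  - by apply: closedI; [exact: closed_closure|exact: open_closedC].
  - by apply: setSI; apply: closure_subset; rewrite /kode/=; exact: cellS.
  - by move=> x [/closure_cellK].
  - apply/set0P/eqP => e; apply: (h k) => x cx; apply: contrapT => nV.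
    by have : set0 x by rewrite -e.
have pX : p != X u by apply/eqP => e; case: (hp 0%N) => _; rewrite e.
have [k [h1 h2]] := separated pX.
have {hp} [cp _] := hp k.+1; have cX := @XP u k.+1.
move: cp cX; rewrite /kode; set s := code (clamp u) k.
pose b := clamp u < lft s + m (true :: s).
have -> : code (clamp u) k.+1 = b :: s by [].
have ss : size s = k by exact: size_code.
have sub : closure (cell (b :: s)) `<=` closure (if b then C k else ~` C k).
  by apply: closure_subset => x /= []; rewrite ss.
by move=> /sub hp /sub; case: b hp {sub} => hp hX; [case: h1|case: h2].
Qed.

(** By [cell_near], [X u] lies in an open [V] exactly when some cell of the code of [u] has its
    closure in [V]. These countably many conditions give the measurability of [X]. *)
Let kset (V : set T) (i : nat) : set (measurableTypeR R) :=
  if unpickle i is Some s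
  then [set u | closure (cell s) `<=` V /\ kode u (size s) = s] else set0.

Let measurable_kset V i : measurable (kset V i).
Proof.
rewrite /kset; case: (unpickle i) => [s|]; last exact: measurable0.
have [h|h] := pselect (closure (cell s) `<=` V).
  rewrite (_ : [set _ | _] = [set u | kode u (size s) = s]); first exact: measurable_kode.
  by apply/seteqP; split => u //= [].
rewrite (_ : [set _ | _] = set0); first exact: measurable0.
by rewrite -subset0 => u [].
Qed.

Let mX : measurable_fun setT (X : measurableTypeR R -> T).
Proof.
apply: (@measurability _ _ _ T setT X (@open 'rV[R]_n)) => //.
move=> _ [V oV <-].
rewrite setTI (_ : X @^-1` V = \bigcup_i kset V i).
  by apply: bigcup_measurable => i _; exact: measurable_kset.
apply/seteqP; split => u /=.
  move=> Vu; have [k hk] := cell_near oV Vu.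
  exists (pickle (kode u k)) => //; rewrite /kset pickleK; split=> //.
  by rewrite /kode size_code.
move=> [i _]; rewrite /kset; case: (unpickle i) => [s|]// [h us].
by apply: h; rewrite -us; exact: XP.
Qed.

Let lam : {measure set T -> \bar R} :=
  measure_function_pushforward__canonical__measure_function_Measure P mX.

Let lam1 : lam setT = 1%E.
Proof.
have := P_kode [::]; rewrite /m /= contentK => <-.
by congr (P _); apply/seteqP; split.
Qed.

Let lamK : lam (~` K) = 0%E.
Proof.
rewrite /lam /= /pushforward (_ : X @^-1` _ = set0) ?measure0//.
by rewrite -subset0 => u; apply; exact: XK.
Qed.

(** * Lower semicontinuity of the integral under the weak limit *)

Section test_function.
Variable g : T -> \bar R.
Hypothesis mg : measurable_fun setT g.
Hypothesis g0 : forall x, (0 <= g x)%E.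
Hypothesis g_lsc : forall x (a : R), K x -> (a%:E < g x)%E ->
  exists2 V, open V /\ V x & forall y, V y -> K y -> (a%:E < g y)%E.

(** The index [k] is both the depth of the cells and a cap; the cap keeps the value real where the
    infimum is +oo, as on an empty cell. *)
Let F k s : R := fine (mine (ereal_inf (g @` cell s)) k%:R%:E).

Let F_inf k s : (F k s)%:E = mine (ereal_inf (g @` cell s)) k%:R%:E.
Proof.
rewrite fineK// ge0_fin_numE; first by rewrite gt_min ltry orbT.
rewrite le_min lee_fin ler0n andbT; apply: le_ereal_inf_tmp => _ [x _ <-].
exact: g0.
Qed.

Let F_ge0 k s : 0 <= F k s.
Proof.
rewrite -lee_fin F_inf le_min lee_fin ler0n andbT.
by apply: le_ereal_inf_tmp => _ [x _ <-]; exact: g0.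
Qed.

Let F_le k s x : cell s x -> ((F k s)%:E <= g x)%E.
Proof.
move=> sx; rewrite F_inf ge_min; apply/orP; left.
by apply: ereal_inf_lbound; exists x.
Qed.

Let cell_inj s t x : size s = size t -> cell s x -> cell t x -> s = t.
Proof.
elim: s t => [|b s IH] [|c t]//= [st] [sx bx] [tx cx].
rewrite (IH t)//; congr (_ :: _); rewrite st in bx.
by case: b c bx cx => -[].
Qed.

Let integral_ge j k :
  (\sum_(s : k.-tuple bool) (F k s)%:E * mu j (cell s) <= \int[mu j]_x g x)%E.
Proof.
have e : (\int[mu j]_x \sum_(s : k.-tuple bool) (F k s)%:E * (\1_(cell s) x)%:E =
    \sum_(s : k.-tuple bool) (F k s)%:E * mu j (cell s))%E.
  rewrite ge0_integral_sum//.
  - apply: eq_bigr => s _; rewrite ge0_integralZl//.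
    + by rewrite integral_indic// setIT.
    + by apply/measurable_EFinP; exact: measurable_indic.
    + by rewrite lee_fin.
  - move=> s; apply: measurable_funeM; apply/measurable_EFinP; exact: measurable_indic.
  - by move=> s x _; rewrite mule_ge0// lee_fin.
rewrite -e; apply: ge0_le_integral => //.
- by move=> x _; apply: sume_ge0 => s _; rewrite mule_ge0// lee_fin.
- apply: emeasurable_sum => s; apply: measurable_funeM; apply/measurable_EFinP.
  exact: measurable_indic.
move=> x _; have [[s sx]|ns] := pselect (exists s : k.-tuple bool, cell s x).
  rewrite (bigD1 s)//= big1 ?adde0; last first.
    move=> t ts; rewrite indicE memNset ?mule0// => tx.
    move/eqP: ts; apply; apply: val_inj; apply: (@cell_inj _ _ x) => //.
    by rewrite !size_tuple.
  by rewrite indicE mem_set// mule1; exact: F_le.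
rewrite big1 ?g0// => s _; rewrite indicE memNset ?mule0// => sx.
by apply: ns; exists s.
Qed.

Let integral_kode k :
  (\int[P]_u (F k (kode u k))%:E = (\sum_(s : k.-tuple bool) F k s * m s)%:E)%E.
Proof.
transitivity (\int[P]_u \sum_(s : k.-tuple bool)
    (F k s)%:E * (\1_([set v | kode v (size s) = s]) u)%:E)%E.
  apply: eq_integral => u _.
  have sz : size (kode u k) == k by rewrite size_code.
  rewrite (bigD1 (Tuple sz))//= big1 ?adde0.
    by rewrite indicE mem_set/= ?mule1// size_code.
  move=> s /eqP ns; rewrite indicE memNset ?mule0//= => us.
  by apply: ns; apply: val_inj; rewrite /= -[LHS]us size_tuple.
rewrite ge0_integral_sum//.
- rewrite -sumEFin; apply: eq_bigr => s _; rewrite ge0_integralZl//.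
  + by rewrite integral_indic// setIT EFinM P_kode.
  + by apply/measurable_EFinP; exact: measurable_indic.
  + by rewrite lee_fin.
- move=> s; apply: measurable_funeM; apply/measurable_EFinP; exact: measurable_indic.
- by move=> s x _; rewrite mule_ge0// lee_fin.
Qed.

Let F_nd u : nondecreasing_seq (fun k => (F k (kode u k))%:E).
Proof.
apply/nondecreasing_seqP => k; rewrite !F_inf le_min !ge_min; apply/andP; split.
  apply/orP; left; apply: ereal_inf_le_tmp => _ [x + <-]; rewrite /kode /= => -[xs _].
  by exists x.
by rewrite lee_fin ler_nat leqnSn orbT.
Qed.

Let g_le_lim u : (g (X u) <= limn (fun k => (F k (kode u k))%:E))%E.
Proof.
have -> := cvg_lim _ (ereal_nondecreasing_cvgn (F_nd u)) => //.
apply: lee_of_lt_real => a ag.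
have [V [oV Vx] hV] := g_lsc (XK u) ag.
have [k hk] := cell_near oV Vx.
(* Deep enough for the cell to lie in [V], with a cap above [a]. *)
pose k' := maxn k (Num.truncn `|a|).+1.
apply: (@le_trans _ _ (F k' (kode u k'))%:E); last by apply: ereal_sup_ubound; exists k'.
rewrite F_inf le_min; apply/andP; split.
  apply: le_ereal_inf_tmp => _ [x + <-] => xk; apply/ltW/hV; last exact: (cellK xk).
  apply: hk; apply: subset_closure.
  have : (k <= k')%N by exact: leq_maxl.
  elim: (k') xk => [|l IH]; first by rewrite leqn0 => + /eqP ->.
  by rewrite leq_eqVlt ltnS => xk /orP[/eqP->//|]; apply: IH; move: xk; rewrite /kode/= => -[].
rewrite lee_fin (le_trans (ler_norm _))//.
apply: (@le_trans _ _ (Num.truncn `|a|).+1%:R); last by rewrite ler_nat leq_maxr.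
by rewrite ltW// truncnS_gt.
Qed.

(** At fixed depth, the step minorant of [g] has as integral a finite combination of contents, hence
    a limit along [U] of sums lying below the integrals of [g] against [mu j]. Monotone convergence
    then lets the depth grow. *)
Lemma test_function_le M : U [set j | (\int[mu j]_x g x <= M%:E)%E] ->
  (\int[lam]_x g x <= M%:E)%E.
Proof.
move=> UM; have -> : (\int[lam]_x g x = \int[pushforward P X]_x g x)%E by [].
rewrite ge0_integral_pushforward//.
have mF k : measurable_fun setT (fun u : measurableTypeR R => (F k (kode u k))%:E).
  apply: (eq_measurable_fun (fun u => \sum_(s : k.-tuple bool)
    (F k s)%:E * (\1_([set v | kode v (size s) = s]) u)%:E)%E).
    move=> u _; have sz : size (kode u k) == k by rewrite size_code.
    rewrite (bigD1 (Tuple sz))//= big1 ?adde0.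
      by rewrite indicE mem_set/= ?mule1// size_code.
    move=> s /eqP ns; rewrite indicE memNset ?mule0//= => us.
    by apply: ns; apply: val_inj; rewrite /= -[LHS]us size_tuple.
  apply: emeasurable_sum => s; apply: measurable_funeM; apply/measurable_EFinP.
  apply: measurable_indic; exact: measurable_kode.
have mono := @monotone_convergence _ _ _ P setT measurableT
  (fun k u => (F k (kode u k))%:E) mF _ _.
apply: (@le_trans _ _ (\int[P]_u limn (fun k => (F k (kode u k))%:E))%E).
  rewrite preimage_setT; apply: ge0_le_integral => //.
  - by move=> u _; exact: g0.
  - exact: measurableT_comp.
  - apply: (@emeasurable_fun_cvg _ _ _ _ (fun k u => (F k (kode u k))%:E)) => // u _.
    by apply: ereal_nondecreasing_is_cvgn; exact: F_nd.
  - by move=> u _; exact: g_le_lim.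
rewrite mono//; last by move=> k u _; rewrite lee_fin.
apply: lime_le.
  apply: ereal_nondecreasing_is_cvgn => k l kl; apply: ge0_le_integral => //.
    by move=> u _; rewrite lee_fin.
  by move=> u _; exact: F_nd.
apply: nearW => k; rewrite integral_kode lee_fin.
have c : \sum_(s : k.-tuple bool) F k s * fine (mu j (cell s)) @[j --> U] -->
    \sum_(s : k.-tuple bool) F k s * m s.
  by apply: cvg_bigsum => s; apply: cvgMl_tmp; exact: contentP.
rewrite -(cvg_lim _ c)//; apply: limr_le.
  by apply/cvg_ex; eexists; exact: c.
apply: filterS UM => j /= /(le_trans (integral_ge j k)).
rewrite -lee_fin -sumEFin; apply: le_trans.
apply: lee_sum => s _; rewrite EFinM (fineK (mu_fin j (mcell s))).
exact: lexx.
Qed.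

End test_function.

(** The limit is characterized by an inequality for nonnegative, possibly infinite functions, lower
    semicontinuous along [K]; convergence for bounded continuous functions is deduced from it in
    [weak_limit_continuous]. *)
Theorem prob_weak_compact : exists lam : {measure set T -> \bar R},
  [/\ lam setT = 1%E, lam (~` K) = 0%E &
   forall g : T -> \bar R, measurable_fun setT g -> (forall x, 0 <= g x)%E ->
   (forall x (a : R), K x -> (a%:E < g x)%E ->
     exists2 V, open V /\ V x & forall y, V y -> K y -> (a%:E < g y)%E) ->
   forall M : R, U [set j | (\int[mu j]_x g x <= M%:E)%E] ->
   (\int[lam]_x g x <= M%:E)%E].
Proof.
by exists lam; split; [exact: lam1|exact: lamK|move=> g mg g0 hg M; exact: test_function_le].
Qed.

End weak_compactness.

(** * Inner regularity of finite Borel measures *)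

Section inner_regularity.
Context {R : realType} {n : nat}.
Local Notation T := (euclid R n).
Local Open Scope ereal_scope.
Variable m : {measure set T -> \bar R}.
Hypothesis mfin : m setT < +oo.

Lemma measure_vanishing (E : nat -> set T) (e : R) : (0 < e)%R ->
  (forall k, measurable (E k)) -> (forall k, E k.+1 `<=` E k) ->
  (forall x, exists k, ~ E k x) -> exists k, m (E k) < e%:E.
Proof.
move=> e0 mE dE E0.
have I0 : \bigcap_k E k = set0.
  by rewrite -subset0 => x Ex; have [k] := E0 x; apply; exact: Ex.
have h : (m \o E) k @[k --> \oo] --> 0.
  rewrite -(measure0 m) -I0; apply: nonincreasing_cvg_mu => //.
  - by apply: le_lt_trans mfin; apply: le_measure; rewrite ?inE.
  - by rewrite I0.
  - by apply/nonincreasing_seqP => k; rewrite subsetEset; exact: dE.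
have e0' : 0 < e%:E by rewrite lte_fin.
have [k _ hk] := h _ (open_nbhs_nbhs (conj (@open_ereal_lt_ereal _ e%:E) e0')).
by exists k; exact: hk (leqnn k).
Qed.

(** Approximating [B] and its complement together makes the property stable under complements. *)
Let approx (B : set T) : Prop := forall e : R, (0 < e)%R ->
  exists F G, [/\ closed F, closed G, F `<=` B, G `<=` ~` B & m (~` (F `|` G)) <= e%:E].

Let approx_bigcup (B : nat -> set T) : (forall k, approx (B k)) -> approx (\bigcup_k B k).
Proof.
move=> aB e e0.
have e2 : (0 < e / 2)%R by rewrite divr_gt0.
have /choice[F /choice[G FG]] : forall k, exists F, exists G,
    [/\ closed F, closed G, F `<=` B k, G `<=` ~` B k &
        m (~` (F `|` G)) <= ((e / 2) / (2 ^ k.+1)%:R)%:E].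
  by move=> k; apply: aB; rewrite divr_gt0// ltr0n expn_gt0.
pose FN N := \big[setU/set0]_(i < N) F i.
have cF k : closed (F k) by case: (FG k).
have mF k : measurable (F k) by exact: closed_measurable_euclid.
have mG k : measurable (G k) by apply: closed_measurable_euclid; case: (FG k).
have cFN N : closed (FN N) by apply: closed_bigsetU.
have mFN N : measurable (FN N) by exact: closed_measurable_euclid.
have mU : measurable (\bigcup_k F k) by exact: bigcup_measurable.
(* A countable union of closed sets need not be closed; a finite part of it misses mass less than
   [e / 2]. *)
have [||||N hN] := @measure_vanishing (fun N => \bigcup_k F k `\` FN N) (e / 2).
- exact: e2.
- by move=> k; apply: measurableD.
- by move=> k; apply: setDS; rewrite /FN big_ord_recr/=; exact: subsetUl.
- move=> x; have [[k _ Fkx]|nF] := pselect ((\bigcup_k F k) x).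
    exists k.+1 => -[_]; apply; rewrite /FN big_ord_recr/=; by right.
  by exists 0%N => -[].
exists (FN N), (\bigcap_k G k); split.
- exact: cFN.
- by apply: closed_bigI => k _; case: (FG k).
- rewrite /FN => x; rewrite -bigcup_mkord => -[k _ Fx]; exists k => //.
  by case: (FG k) => _ _ h _ _; exact: h.
- move=> x Gx [k _ Bx]; case: (FG k) => _ _ _ h _.
  by apply: (h x) => //; exact: Gx.
have mI : measurable (\bigcap_k G k) by exact: bigcap_measurable.
pose H k := ~` (F k `|` G k).
have mH k : measurable (H k) by apply: measurableC; exact: measurableU.
have mUH : measurable (\bigcup_k H k) by exact: bigcup_measurable.
apply: (@le_trans _ _ (m (\bigcup_k H k `|` (\bigcup_k F k `\` FN N)))).
  apply: le_measure; rewrite ?inE.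
  - by apply: measurableC; exact: measurableU.
  - by apply: measurableU => //; exact: measurableD.
  move=> x /= nx; have nF : ~ FN N x by move=> ?; apply: nx; left.
  have /existsNP[k /not_implyP[_ nG]] : ~ (\bigcap_k G k) x by move=> ?; apply: nx; right.
  have [Fx|nFx] := pselect (F k x); first by right; split => //; exists k.
  by left; exists k => // -[].
apply: (@le_trans _ _ (m (\bigcup_k H k) + m (\bigcup_k F k `\` FN N))).
  by apply: measureU2 => //; exact: measurableD.
rewrite [leRHS](_ : _ = (e / 2)%:E + (e / 2)%:E); last by rewrite -EFinD -splitr.
apply: leeD; last exact: ltW.
apply: (le_trans (measure_sigma_subadditive m mH mUH (@subset_refl _ _))).
have := @epsilon_trick R (fun=> 0%E) (e / 2)%R xpredT (fun=> lexx _) (ltW e2).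
rewrite [X in _ <= X + _]eseries0// add0e; apply: le_trans.
by apply: lee_nneseries => // k _; rewrite add0e; case: (FG k).
Qed.

Let approx_open (V : set T) : open V -> approx V.
Proof.
move=> oV e e0.
pose F k := \bigcap_(y in ~` V) [set x : T | (k.+1%:R^-1 <= `|x - y|)%R].
have cF k : closed (F k).
  apply: closed_bigI => y _.
  rewrite (_ : [set _ | _] = (fun x : T => `|x - y|)%R @^-1` [set r : R | (k.+1%:R^-1 <= r)%R])//.
  apply: preimage_closed; last exact: closed_ge.
  move=> x _; apply: (@continuous_comp _ _ _ (fun x : T => x - y)%R); last exact: norm_continuous.
  by apply: (@continuousB _ _ _ id (cst y)); [exact: cvg_id|exact: cst_continuous].
have FV k : F k `<=` V.
  move=> x Fx; apply: contrapT => nV; have := Fx x nV; rewrite /= subrr normr0.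
  by rewrite leNgt invr_gt0 ltr0n.
have [||||k hk] := @measure_vanishing (fun k => V `\` F k) e.
- exact: e0.
- by move=> k; apply: measurableD; [exact: open_measurable_euclid|exact: closed_measurable_euclid].
- move=> k; apply: setDS => x Fx y /Fx /=; apply: le_trans.
  by rewrite lef_pV2 ?posrE ?ltr0n// ler_nat.
- move=> x; have [Vx|nV] := pselect (V x); last by exists 0%N => -[].
  have /nbhs_ballP[r /= r0 rV] : nbhs x V by exact: open_nbhs_nbhs.
  exists (Num.truncn r^-1) => -[_]; apply => y nVy /=.
  rewrite leNgt; apply/negP => h; apply: nVy; apply: rV.
  rewrite -ball_normE /=; apply: (lt_trans h).
  by rewrite invf_plt ?posrE ?ltr0n// truncnS_gt.
exists (F k), (~` V); split => //; first exact: open_closedC.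
by rewrite setCU setCK setIC; exact: ltW.
Qed.

Lemma closed_inner_regular (B : set T) (e : R) : measurable B -> (0 < e)%R ->
  exists F, [/\ closed F, F `<=` B & m (B `\` F) <= e%:E].
Proof.
move=> mB e0; suff /(_ B mB e e0)[F [G [cF cG FB GB h]]] : @measurable _ T `<=` approx.
  exists F; split => //; apply: le_trans h; apply: le_measure; rewrite ?inE.
  - by apply: measurableD => //; exact: closed_measurable_euclid.
  - by apply: measurableC; apply: measurableU; exact: closed_measurable_euclid.
  by move=> x [Bx nF] []// /GB.
apply: smallest_sub; last exact: approx_open.
split => [e' e'0|A aA e' /aA[F [G [cF cG FA GA h]]]|]; last exact: approx_bigcup.
- exists set0, setT; split => //; rewrite ?setU0 ?setUT ?setCT ?measure0 ?lee_fin ?ltW//.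
    exact: closed0.
  by rewrite setC0.
- exists G, F; split => //; rewrite ?setTD ?setCK// setUC; exact: h.
Qed.

Lemma compact_inner_regular (B : set T) (e : R) : measurable B -> (0 < e)%R ->
  exists F, [/\ compact F, F `<=` B & m (B `\` F) <= e%:E].
Proof.
move=> mB e0; have e2 : (0 < e / 2)%R by rewrite divr_gt0.
have [F [cF FB h]] := closed_inner_regular mB e2.
pose S (k : nat) : set T := [set x | (`|x| <= k%:R)%R].
have cS k : closed (S k).
  rewrite (_ : S k = (fun x : T => `|x|%R) @^-1` [set r : R | (r <= k%:R)%R])//.
  apply: preimage_closed; last exact: closed_le.
  by move=> x _; exact: norm_continuous.
have mS k : measurable (S k) by exact: closed_measurable_euclid.
have mF : measurable F by exact: closed_measurable_euclid.
have [||||k hk] := @measure_vanishing (fun k => F `\` S k) (e / 2).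
- exact: e2.
- by move=> k; exact: measurableD.
- by move=> k; apply: setDS => x /= /le_trans; apply; rewrite ler_nat.
- move=> x; exists (Num.truncn `|x|%R).+1 => -[_]; apply.
  by rewrite /S /= ltW// truncnS_gt.
exists (F `&` S k); split.
- apply: bounded_closed_compact; last exact: closedI.
  exists k%:R; split; first exact: num_real.
  by move=> x kx y /= [_ /le_trans]; apply; exact: ltW.
- by move=> x [/FB].
rewrite [leRHS](_ : _ = (e / 2)%:E + (e / 2)%:E); last by rewrite -EFinD -splitr.
apply: le_trans (leeD h (ltW hk)).
apply: (@le_trans _ _ (m ((B `\` F) `|` (F `\` S k)))); last first.
  by apply: measureU2; exact: measurableD.
apply: le_measure; rewrite ?inE.
- by apply: measurableD => //; exact: measurableI.
- by apply: measurableU; exact: measurableD.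
move=> x [Bx nFS]; have [Fx|nF] := pselect (F x); last by left.
by right; split => // Sx; apply: nFS.
Qed.

End inner_regularity.

(** * Constructions of Radon measures *)

Section integral_transfer.
Context d (T : measurableType d) (R : realType).
Local Open Scope ereal_scope.

Lemma ge0_integral_mrestr (m : {measure set T -> \bar R}) (E D : set T) (mE : measurable E)
    (f : T -> \bar R) : measurable D -> measurable_fun D f ->
  (forall x, D x -> 0 <= f x) ->
  \int[mrestr m mE]_(x in D) f x = \int[m]_(x in D `&` E) f x.
Proof.
move=> mD mf f0.
have mDE := measurableI _ _ mD mE.
have mfDE : measurable_fun (D `&` E) f by apply: measurable_funS mf.
have f0' x : (D `&` E) x -> 0 <= f x by move=> [/f0].
rewrite (@ge0_negligible_integral _ _ _ (mrestr m mE) D (~` E))//; last first.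
- by rewrite /= /mrestr setICl measure0.
- exact: measurableC.
rewrite setDE setCK; apply: eq_measure_integral => A mA AE.
by rewrite /= /mrestr setIidl// => x /AE[].
Qed.

(** A proportionality known for nonnegative functions extends to integrable ones through positive
    and negative parts; it serves midpoints and scaled restrictions. *)
Lemma integral_rel (m' m : {measure set T -> \bar R}) (D D' : set T) (c : R) (f : T -> \bar R) :
  (0 <= c)%R -> measurable D -> measurable D' ->
  (forall g : T -> \bar R, measurable_fun D g -> (forall x, D x -> 0 <= g x) ->
     \int[m']_(x in D) g x = c%:E * \int[m]_(x in D') g x) ->
  measurable_fun D f -> m.-integrable D' f ->
  m'.-integrable D f /\ \int[m']_(x in D) f x = c%:E * \int[m]_(x in D') f x.
Proof.
move=> c0 mD mD' h mf fi; split.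
  apply/integrableP; split=> //; rewrite h//; last exact: measurableT_comp.
  by move/integrableP : fi => [_ fi]; rewrite lte_mul_pinfty// ge0_fin_numE// integral_ge0.
rewrite [LHS]integralE [in RHS]integralE !h//.
- by rewrite [RHS]muleBr//; exact: integrable_add_def.
- exact: measurable_funeneg.
- exact: measurable_funepos.
Qed.

End integral_transfer.

Section radon_constructions.
Context {R : realType} {n : nat} {alpha : R}.
Hypothesis alphan : (alpha < n%:R)%R.
Local Notation T := (euclid R n).
Local Open Scope ereal_scope.

Lemma measurable_wweight (D : set T) : measurable_fun D (EFin \o @wweight R n alpha).
Proof.
apply: (measurable_funS measurableT) => //; apply/measurable_EFinP.
apply: continuous_measurable_euclid; exact: continuous_wweight.
Qed.

Lemma finite_wintegrable (m : {measure set T -> \bar R}) : m setT < +oo ->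
  wintegrable alpha m.
Proof.
move=> mfin; apply: measurable_bounded_integrable => //.
  apply: continuous_measurable_euclid; exact: continuous_wweight.
exists 1%R; split; first exact: num_real.
move=> x x1 y _ /=; rewrite ger0_norm ?(ltW (wweight_gt0 _ _))//.
by rewrite (le_trans _ (ltW x1))// wweight_le1.
Qed.

Lemma measurable_powR_enorm (D : set T) :
  measurable_fun D (fun y : T => ((enorm y) `^ (alpha - n%:R))%:E).
Proof.
apply/measurable_EFinP; apply: (measurable_funS measurableT) => //.
have me : measurable_fun setT (@enorm R n).
  by apply: continuous_measurable_euclid; exact: continuous_enorm.
exact: (measurableT_comp (@measurable_powR R _) me).
Qed.

Lemma measurable_enorm_gt1 : measurable [set y : T | (1 < enorm y)%R].
Proof.
apply: open_measurable_euclid.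
rewrite (_ : [set y : T | _] = (@enorm R n) @^-1` [set r : R | (1 < r)%R])//.
by apply: open_comp; [move=> x _; exact: continuous_enorm|exact: open_gt].
Qed.

Lemma compact_enorm_le (r : R) : compact [set y : T | (enorm y <= r)%R].
Proof.
apply: bounded_closed_compact; last first.
  rewrite (_ : [set y : T | _] = (@enorm R n) @^-1` [set s : R | (s <= r)%R])//.
  by apply: preimage_closed; [move=> x _; exact: continuous_enorm|exact: closed_le].
exists r; split; first exact: num_real.
move=> s rs y /= yr.
have s0 : (0 <= s)%R by rewrite (le_trans (enorm_ge0 y))// (le_trans yr)// ltW.
change (mx_norm (y : 'M[R]_(1, n)) <= s)%R.
have [->//|/mx_norm_neq0[[i j] ->]] := eqVneq (mx_norm (y : 'M[R]_(1, n))) 0%R.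
apply: le_trans (ltW rs); apply: le_trans yr.
rewrite /= ord1 /enorm -sqrtr_sqr ler_wsqrtr// (bigD1 j)//= lerDl.
by apply: sumr_ge0 => k _; exact: sqr_ge0.
Qed.

Lemma wweight_le_enorm (y : T) : (1 < enorm y)%R ->
  (@wweight R n alpha y <= enorm y `^ (alpha - n%:R))%R.
Proof.
move=> y1; rewrite enorm_powR /wweight /vweight -powR_inv1 ?(ltW (vden_gt0 _))//.
have s0 : (0 < sqnorm y)%R.
  rewrite lt_def sqnorm_ge0 andbT; apply/negP => /eqP e0.
  by move: y1; rewrite enormE e0 sqrtr0 ltr10.
rewrite -powRrM mulN1r !powRN lef_pV2 ?posrE ?powR_gt0 ?vden_gt0//.
by rewrite ge0_ler_powR ?nnegrE ?(ltW (hexp_gt0 _)) ?sqnorm_ge0 ?(ltW (vden_gt0 _))// lerDr.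
Qed.

(** Outside the unit ball the weight is below the integrand of the growth condition; inside it is at
    most 1 and local finiteness applies. *)
Lemma radon_wintegrable (mu : radon_pos n alpha) : wintegrable alpha mu.
Proof.
have mE := measurable_enorm_gt1.
apply/integrableP; split; first exact: measurable_wweight.
have mw D' : measurable_fun D' (fun y : T => (@wweight R n alpha y)%:E).
  exact: measurable_wweight.
have w0 (y : T) : 0 <= (@wweight R n alpha y)%:E by rewrite lee_fin ltW// wweight_gt0.
under eq_integral do rewrite /comp gee0_abs//.
rewrite -(setUv [set y : T | (1 < enorm y)%R]) ge0_integral_setU//=; last first.
- by apply/disj_setPS; rewrite setICr.
- exact: measurableC.
apply: lte_add_pinfty.
  apply: le_lt_trans (radon_growth mu); apply: ge0_le_integral => //.
  - exact: measurable_powR_enorm.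
  - by move=> y /= y1; rewrite lee_fin; exact: wweight_le_enorm.
have -> : ~` [set y : T | (1 < enorm y)%R] = [set y : T | (enorm y <= 1)%R].
  by apply/seteqP; split => y /=; [move/negP; rewrite -leNgt|rewrite leNgt => /negP].
apply: le_lt_trans (radon_locally_finite mu (@compact_enorm_le 1%R)).
rewrite -[leRHS]mul1e -integral_cst; last exact: compact_measurable_euclid (@compact_enorm_le 1%R).
apply: ge0_le_integral => //.
- exact: compact_measurable_euclid (@compact_enorm_le 1%R).
- by move=> y _; rewrite lee_fin wweight_le1.
Qed.

(** Where the norm exceeds 1 the integrand of the growth condition is at most 1. Weak limits,
    midpoints and restrictions become [radon_pos] in this way. *)
Lemma finite_radon (m : {measure set T -> \bar R}) : m setT < +oo ->
  exists mu : radon_pos n alpha, radon_measure mu = m.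
Proof.
move=> mfin; unshelve eexists (RadonPos (radon_measure := m) _ _) => //.
- move=> K cK; apply: le_lt_trans mfin; apply: le_measure; rewrite ?inE//.
  exact: compact_measurable_euclid.
- have mE := measurable_enorm_gt1.
  apply: (@le_lt_trans _ _ (m [set y : T | (1 < enorm y)%R])); last first.
    by apply: le_lt_trans mfin; apply: le_measure; rewrite ?inE.
  rewrite -[leRHS]mul1e -integral_cst//; apply: ge0_le_integral => //.
  - by move=> y _; rewrite lee_fin powR_ge0.
  - exact: measurable_powR_enorm.
  - move=> y /= y1; rewrite lee_fin -[leRHS](powRr0 (enorm y)) ler_powR ?(ltW y1)//.
    by rewrite subr_le0 ltW.
Qed.

Definition half_nng : {nonneg R} := ((2^-1)%:nng)%R.

Definition midmeasure (p q : {measure set T -> \bar R}) : {measure set T -> \bar R} :=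
  mscale half_nng (measure_add p q).

Lemma ge0_integral_mid (p q : {measure set T -> \bar R}) (D : set T) (f : T -> \bar R) :
  measurable D -> measurable_fun D f -> (forall x, D x -> 0 <= f x) ->
  \int[midmeasure p q]_(x in D) f x =
  2^-1%:E * (\int[p]_(x in D) f x + \int[q]_(x in D) f x).
Proof.
by move=> mD mf f0; rewrite ge0_integral_mscale// ge0_integral_measure_add.
Qed.

Lemma integral_mid (p q : {measure set T -> \bar R}) (D : set T) (f : T -> \bar R) :
  measurable D -> p.-integrable D f -> q.-integrable D f ->
  (midmeasure p q).-integrable D f /\
  \int[midmeasure p q]_(x in D) f x =
  2^-1%:E * (\int[p]_(x in D) f x + \int[q]_(x in D) f x).
Proof.
move=> mD pf qf; rewrite -integral_measure_add//.
have mf : measurable_fun D f by exact: measurable_int pf.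
apply: integral_rel => //.
- by move=> g mg g0; rewrite ge0_integral_mscale.
- apply/integrableP; split=> //; rewrite ge0_integral_measure_add//; last exact: measurableT_comp.
  by apply: lte_add_pinfty; [move/integrableP : pf => []|move/integrableP : qf => []].
Qed.

Definition scaled_restr (c : {nonneg R}) (m : {measure set T -> \bar R}) (C : set T)
    (mC : measurable C) : {measure set T -> \bar R} :=
  mscale c (mrestr m mC).

Lemma ge0_integral_scaled_restr (c : {nonneg R}) (m : {measure set T -> \bar R}) (C : set T) (mC : measurable C) (D : set T)
    (f : T -> \bar R) :
  measurable D -> measurable_fun D f -> (forall x, D x -> 0 <= f x) ->
  \int[scaled_restr c m mC]_(x in D) f x = c%:num%:E * \int[m]_(x in D `&` C) f x.
Proof.
move=> mD mf f0; rewrite -(ge0_integral_mrestr m mC mD mf f0).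
have := @ge0_integral_mscale _ _ _ (mrestr m mC : {measure set T -> \bar R}) D mD c f mf f0.
by [].
Qed.

Lemma integral_scaled_restr (c : {nonneg R}) (m : {measure set T -> \bar R}) (C : set T) (mC : measurable C) (D : set T)
    (f : T -> \bar R) :
  measurable D -> m.-integrable D f ->
  (scaled_restr c m mC).-integrable D f /\
  \int[scaled_restr c m mC]_(x in D) f x = c%:num%:E * \int[m]_(x in D `&` C) f x.
Proof.
move=> mD fi; have mDC := measurableI _ _ mD mC.
apply: integral_rel => //.
- by move=> g mg g0; rewrite ge0_integral_scaled_restr.
- exact: measurable_int fi.
- exact: integrableS fi.
Qed.

(** Both sides are suprema of the same symmetric moment forms. *)
Lemma energy_posC (p q : {measure set T -> \bar R}) :
  wintegrable alpha p -> wintegrable alpha q ->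
  energy_pos alpha p q = energy_pos alpha q p.
Proof.
move=> wp wq; rewrite !energy_pos_sup//.
by congr ereal_sup; apply: eq_imagel => N _; rewrite moment_formC.
Qed.

Section midpoint.
Variables p q : {measure set T -> \bar R}.
Hypotheses (fp : fin_energy alpha p) (fq : fin_energy alpha q).
Local Notation mid := (midmeasure p q).

Lemma mid_wintegrable : wintegrable alpha mid.
Proof. by have [] := integral_mid measurableT fp.1 fq.1. Qed.

Lemma energy_pos_mid (nu : {measure set T -> \bar R}) : wintegrable alpha nu ->
  energy_pos alpha mid nu = 2^-1%:E * (energy_pos alpha p nu + energy_pos alpha q nu).
Proof.
move=> wn; apply: ge0_integral_mid => //; first exact: measurable_potential_pos.
by move=> x _; exact: potential_pos_ge0.
Qed.

(** Parallelogram identity: the energy is expanded in one argument, then in the other by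
    symmetry. *)
Lemma energy_pos_midmid : energy_pos alpha mid mid =
  ((energyR alpha p p + energyR alpha q q) / 2 - dist2 alpha p q / 4)%:E.
Proof.
have wm := mid_wintegrable; have [wp ep] := fp; have [wq eq] := fq.
rewrite energy_pos_mid// (energy_posC wp wm) (energy_posC wq wm) !energy_pos_mid//.
rewrite !energy_posE// -!EFinD -!EFinM (energyRC alphan fq fp) /dist2.
by congr EFin; field.
Qed.

Lemma mid_fin_energy : fin_energy alpha mid.
Proof. by split; [exact: mid_wintegrable|rewrite energy_pos_midmid ltry]. Qed.

End midpoint.

(** * Jordan parts of a difference and the strong norm *)

Section jordan.
Variables p q : radon_pos n alpha.
Let rho := radon_sub p q.

Let null_sub (m : {measure set T -> \bar R}) (S S' : set T) :
  measurable S -> measurable S' -> S `<=` S' -> m S' = 0 -> m S = 0.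
Proof.
move=> mS mS' SS h; apply/eqP; rewrite eq_le measure_ge0 andbT -h.
by apply: le_measure; rewrite ?inE.
Qed.

Let ring_sing : exists P : set T,
  [/\ measurable P, negm rho P = 0 & posm rho (~` P) = 0].
Proof. exact: mutually_singular rho. Qed.

(** Minimality of the Jordan decomposition: [posm rho] lives on [P], where [negm rho] vanishes and
    [radon_subP] reads [posm rho + q = p]. *)
Lemma posm_radon_sub_le (A : set T) : measurable A -> posm rho A <= p A.
Proof.
move=> mA; have [P [mP nP pP]] := ring_sing.
have h : posm rho A = posm rho (A `&` P).
  rewrite (measureDI (posm rho) mA mP) [X in X + _](_ : _ = 0) ?add0e//.
  apply: (@null_sub _ _ (~` P)) => //; [exact: measurableD|exact: measurableC].
have mAP := measurableI _ _ mA mP.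
rewrite h; apply: (@le_trans _ _ (posm rho (A `&` P) + q (A `&` P))).
  by rewrite leeDl.
rewrite radon_subP// [X in X + _](_ : _ = 0) ?add0e.
  by apply: le_measure; rewrite ?inE//; exact: subIsetl.
by apply: (@null_sub _ _ P) => //; exact: subIsetr.
Qed.

Lemma negm_radon_sub_le (A : set T) : measurable A -> negm rho A <= q A.
Proof.
move=> mA; have [P [mP nP pP]] := ring_sing.
have mAP := measurableI _ _ mA mP; have mAD := measurableD mA mP.
have h : negm rho A = negm rho (A `\` P).
  rewrite (measureDI (negm rho) mA mP) [X in _ + X](_ : _ = 0) ?adde0//.
  by apply: (@null_sub _ _ P) => //; exact: subIsetr.
rewrite h; apply: (@le_trans _ _ (negm rho (A `\` P) + p (A `\` P))).
  by rewrite leeDl.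
rewrite -radon_subP// [X in X + _](_ : _ = 0) ?add0e.
  by apply: le_measure; rewrite ?inE//; exact: subDsetl.
by apply: (@null_sub _ _ (~` P)) => //; exact: measurableC.
Qed.

Lemma energy_pos_mono (m1 m2 : {measure set T -> \bar R}) :
  wintegrable alpha m1 -> wintegrable alpha m2 ->
  (forall S, measurable S -> m1 S <= m2 S) ->
  energy_pos alpha m1 m1 <= energy_pos alpha m2 m2.
Proof.
move=> w1 w2 m12; apply: (@le_trans _ _ (energy_pos alpha m1 m2)).
  apply: ge0_le_integral => //.
  - by move=> x _; exact: potential_pos_ge0.
  - exact: measurable_potential_pos.
  - exact: measurable_potential_pos.
  - move=> x _; apply: le_measure_nnintegral => // y; exact: riesz_kernel_ge0.
by apply: le_measure_nnintegral => // x; exact: potential_pos_ge0.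
Qed.

Hypotheses (fp : fin_energy alpha p) (fq : fin_energy alpha q).

Let fP : fin_energy alpha (posm rho).
Proof.
split; first exact: radon_wintegrable.
apply: le_lt_trans fp.2; apply: energy_pos_mono; [exact: radon_wintegrable|exact: fp.1|].
exact: posm_radon_sub_le.
Qed.

Let fN : fin_energy alpha (negm rho).
Proof.
split; first exact: radon_wintegrable.
apply: le_lt_trans fq.2; apply: energy_pos_mono; [exact: radon_wintegrable|exact: fq.1|].
exact: negm_radon_sub_le.
Qed.

(** Feature products are integrated against the two equal sums of measures in [radon_subP]. *)
Let moment_diffE : moment_diff alpha (posm rho) (negm rho) = moment_diff alpha p q.
Proof.
apply: functional_extensionality_dep => k; apply/funext => I; rewrite /moment_diff.
have i1 (m : radon_pos n alpha) := feature_prod_integrable I (radon_wintegrable m).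
have h : \int[measure_add (posm rho) q]_x (feature_prod alpha I x)%:E =
         \int[measure_add (negm rho) p]_x (feature_prod alpha I x)%:E.
  apply: eq_measure_integral => A mA _.
  by rewrite [LHS]measure_addE [RHS]measure_addE; exact: radon_subP.
rewrite !integral_measure_add// in h; try exact: i1.
have e (m : radon_pos n alpha) : \int[m]_x (feature_prod alpha I x)%:E = (moment alpha m I)%:E.
  by rewrite -[LHS]fineK//; exact: integrable_fin_num (i1 m).
rewrite !e -!EFinD in h; case: h => h.
by apply/eqP; rewrite subr_eq addrAC eq_sym subr_eq h; apply/eqP; rewrite addrC.
Qed.

(** Translates the norm defined by Jordan parts into [dist2]: the two squares are limits of the same
    forms in moment differences. *)
Lemma strong_norm_radon_sub : strong_norm rho = Num.sqrt (dist2 alpha p q).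
Proof.
rewrite /strong_norm; congr Num.sqrt.
have -> : dist2 alpha p q = dist2 alpha (posm rho) (negm rho).
  apply: (cvg_unique _ (cvg_dist2 alphan fp fq)) => //.
  by rewrite -moment_diffE; exact: cvg_dist2.
rewrite /energy !energy_posE// -!EFinD /= (energyRC alphan fN fP) /dist2; ring.
Qed.

End jordan.

End radon_constructions.

(** * The weighted minimization problem *)

Section weak_limit.
Context {R : realType} {n : nat}.
Local Notation T := (euclid R n).
Local Open Scope ereal_scope.

Lemma integrable_bounded_prob (m : {measure set T -> \bar R}) (phi : T -> R) :
  m setT = 1 -> continuous phi -> (forall x, `|phi x| <= 1)%R ->
  m.-integrable setT (EFin \o phi).
Proof.
move=> m1 cphi b; apply: measurable_bounded_integrable => //.
- by rewrite m1 ltry.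
- exact: continuous_measurable_euclid.
- exists 1%R; split; first exact: num_real.
  by move=> x x1 y _ /=; exact: le_trans (b y) (ltW x1).
Qed.

Lemma integral_cst1D (m : {measure set T -> \bar R}) (phi : T -> R) :
  m setT = 1 -> continuous phi -> (forall x, `|phi x| <= 1)%R ->
  \int[m]_x (1 + phi x)%:E = (1 + \int[m]_x phi x)%:E.
Proof.
move=> m1 cphi b; have ip := integrable_bounded_prob m1 cphi b.
have i1 : m.-integrable setT (EFin \o cst 1%R).
  apply: integrable_bounded_prob => //; first exact: cst_continuous.
  by move=> x; rewrite normr1.
have h : \int[m]_x (1 + phi x)%:E = \int[m]_x (1%:E + (phi x)%:E) by [].
rewrite h integralD//= integral_cst// m1 mule1 EFinD; congr (_ + _).
by rewrite fineK//; exact: integrable_fin_num ip.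
Qed.

Variables (K : set T) (mu : nat -> {measure set T -> \bar R}) (U : set_system nat).
Hypotheses (UU : UltraFilter U) (mu1 : forall j, mu j setT = 1).
Variable lam : {measure set T -> \bar R}.
Hypothesis lam1 : lam setT = 1.
Hypothesis hlam : forall g : T -> \bar R, measurable_fun setT g -> (forall x, 0 <= g x) ->
   (forall x (a : R), K x -> (a%:E < g x)%E ->
     exists2 V, open V /\ V x & forall y, V y -> K y -> (a%:E < g y)%E) ->
   forall M : R, U [set j | (\int[mu j]_x g x <= M%:E)%E] ->
   (\int[lam]_x g x <= M%:E)%E.

(** Lower semicontinuity is applied to [1 + phi], which is nonnegative; all masses being 1, the
    constant cancels. *)
Let weak_limit_le (phi : T -> R) (l : R) : continuous phi -> (forall x, `|phi x| <= 1)%R ->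
  (\int[mu j]_x phi x)%R @[j --> U] --> l -> (\int[lam]_x phi x <= l)%R.
Proof.
move=> cphi b cl; apply/ler_addgt0Pr => e e0.
have FU : ProperFilter U by exact: ultra_proper.
have cphi1 : continuous (fun x => 1 + phi x)%R.
  by move=> x; apply: continuousD; [exact: cst_continuous|exact: cphi].
have h : \int[lam]_x (1 + phi x)%:E <= (1 + (l + e))%:E.
  apply: hlam.
  - by apply/measurable_EFinP; exact: continuous_measurable_euclid.
  - move=> x; rewrite lee_fin; have := b x; rewrite ler_norml => /andP[+ _].
    by rewrite -lerBlDl sub0r.
  - move=> x a _ ax; exists [set y | (a < 1 + phi y)%R] => //; split=> //.
    rewrite (_ : [set y | _] = (fun y => 1 + phi y)%R @^-1` [set r : R | (a < r)%R])//.
    by apply: open_comp; [move=> y _; exact: cphi1|exact: open_gt].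
  - have hl : (l < l + e)%R by rewrite ltrDl.
    apply: filterS (cvgr_lt l cl _ hl) => j /ltW hj /=.
    by rewrite integral_cst1D// lee_fin lerD2l.
by move: h; rewrite integral_cst1D// lee_fin lerD2l.
Qed.

(** Boundedness gives some limit along [U]; [weak_limit_le] for [phi] and for [- phi] identifies
    it. *)
Lemma weak_limit_continuous (phi : T -> R) : continuous phi -> (forall x, `|phi x| <= 1)%R ->
  (\int[mu j]_x phi x)%R @[j --> U] --> (\int[lam]_x phi x)%R.
Proof.
move=> cphi b; have FU : ProperFilter U by exact: ultra_proper.
have bI (m : {measure set T -> \bar R}) : m setT = 1 -> (-1 <= \int[m]_x phi x <= 1)%R.
  move=> m1; rewrite -ler_norml -lee_fin.
  have ip := integrable_bounded_prob m1 cphi b.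
  apply: le_trans (_ : \int[m]_x (cst 1%:E x) <= _); last by rewrite integral_cst// m1 mule1.
  apply: le_trans; last first.
    apply: (@ge0_le_integral _ _ _ _ _ _ (fun x => `|phi x|%:E) (cst 1%:E)) => //.
    - apply/measurable_EFinP; apply: measurableT_comp => //; exact: continuous_measurable_euclid.
    - by move=> x _; rewrite lee_fin.
  rewrite EFin_normr_Rintegral//; apply: le_trans (le_abse_integral _ _ _) _ => //.
  by apply/measurable_EFinP; exact: continuous_measurable_euclid.
have [l hl] := ultra_cvg_bounded UU (fun j => bI _ (mu1 j)).
suff -> : (\int[lam]_x phi x)%R = l by [].
apply/le_anti/andP; split; first exact: weak_limit_le hl.
have RN (m : {measure set T -> \bar R}) : m setT = 1 ->
    (\int[m]_x (- phi x) = - \int[m]_x phi x)%R.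
  move=> m1; have ip := integrable_bounded_prob m1 cphi b.
  rewrite -[RHS]mulN1r -RintegralZl//; apply: eq_Rintegral => x _.
  by rewrite mulN1r.
rewrite -lerN2 -RN//; apply: weak_limit_le.
- by move=> x; apply: continuousN; exact: cphi.
- by move=> x; rewrite normrN.
- rewrite (_ : (fun j => _) = (fun j => - \int[mu j]_x phi x)%R); first exact: cvgN.
  by apply/funext => j; rewrite RN.
Qed.

End weak_limit.

(** * Minimization in a field that is a lower semicontinuous function plus a difference of
    potentials *)

Section weighted_problem.
Context {R : realType} {n : nat} {alpha : R}.
Hypothesis alphan : (alpha < n%:R)%R.
Local Notation T := (euclid R n).
Local Open Scope ereal_scope.

Variables (D : set T) (f g : T -> \bar R) (tp tn : {measure set T -> \bar R}).
Hypotheses (cD : closed D) (ftp : fin_energy alpha tp) (ftn : fin_energy alpha tn).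
Hypothesis mg : measurable_fun D g.
Hypothesis gNy : forall x, D x -> g x != -oo.
Hypothesis g_lsc : forall x (a : R), D x -> a%:E < g x ->
  exists2 V, open V /\ V x & forall y, V y -> D y -> a%:E < g y.
Hypothesis fE : forall x, D x ->
  f x = g x + (potential_pos alpha tp x - potential_pos alpha tn x).

Let mD : measurable D. Proof. exact: closed_measurable_euclid. Qed.

Section charges_D.
Variable mu : {measure set T -> \bar R}.
Hypotheses (fmu : fin_energy alpha mu) (muD : mu (~` D) = 0).

Lemma integral_potential (nu : {measure set T -> \bar R}) : fin_energy alpha nu ->
  mu.-integrable D (potential_pos alpha nu) /\
  \int[mu]_(x in D) potential_pos alpha nu x = (energyR alpha mu nu)%:E.
Proof.
move=> fnu; have mp : measurable_fun setT (potential_pos alpha nu).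
  by apply: measurable_potential_pos => //; exact: fnu.1.
have e : \int[mu]_(x in D) potential_pos alpha nu x = (energyR alpha mu nu)%:E.
  rewrite -energy_posE// /energy_pos (@ge0_negligible_integral _ _ _ mu setT (~` D))//.
  - by rewrite setDE setCK setTI.
  - exact: measurableC.
  - by move=> x _; exact: potential_pos_ge0.
split=> //; apply/integrableP; split; first exact: measurable_funS mp.
under eq_integral do rewrite gee0_abs ?potential_pos_ge0//.
by rewrite e ltry.
Qed.

Let ip := integral_potential ftp.
Let iN := integral_potential ftn.

Lemma g_integrable_f : mu.-integrable D g ->
  mu.-integrable D f /\ \int[mu]_(x in D) f x =
   \int[mu]_(x in D) g x + (energyR alpha mu tp - energyR alpha mu tn)%:E.
Proof.
move=> ig; have iB := integrableB mD ip.1 iN.1.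
have fE' : {in D, (g \+ (potential_pos alpha tp \- potential_pos alpha tn)) =1 f}.
  by move=> x; rewrite inE => Dx; rewrite fE.
split; first by apply: eq_integrable fE' _ => //; exact: (integrableD mD ig iB).
rewrite -(eq_integral _ _ fE') integralD// integralB//; first by rewrite ip.2 iN.2 -EFinB.
- exact: ip.1.
- exact: iN.1.
Qed.

(** Almost everywhere both potentials are finite, and there the absolute value of [g] is at most
    that of [f] plus the two potentials. *)
Lemma f_integrable_g : mu.-integrable D f -> mu.-integrable D g.
Proof.
move=> jf; apply/integrableP; split=> //.
have h : mu.-integrable D (fun x => `|f x| + (`|potential_pos alpha tp x| + `|potential_pos alpha tn x|)).
  apply: integrableD => //; first exact: integrable_abse.
  by apply: integrableD => //; apply: integrable_abse; [exact: ip.1|exact: iN.1].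
move/integrableP : (h) => [mh hoo]; apply: le_lt_trans hoo.
apply: ae_ge0_le_integral => //.
- exact: measurableT_comp.
- exact: measurableT_comp.
have := integrable_ae mD ip.1; apply: filterS2 (integrable_ae mD iN.1) => x fn fp Dx.
have {}fn := fn Dx; have {}fp := fp Dx.
have -> : g x = f x - (potential_pos alpha tp x - potential_pos alpha tn x).
  by rewrite fE// addeK// fin_numB fp fn.
rewrite [leRHS]gee0_abs; last by rewrite !adde_ge0.
apply: le_trans (lee_abs_sub _ _) _; rewrite leeD2l//.
exact: lee_abs_sub.
Qed.

End charges_D.

(** Real form of [weighted_energy] on admissible measures ([weighted_energyE]), with the integrated
    potentials written as mutual energies. *)
Definition weightedR (mu : {measure set T -> \bar R}) : R :=
  (energyR alpha mu mu + 2 * (fine (\int[mu]_(x in D) g x) +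
    (energyR alpha mu tp - energyR alpha mu tn)))%R.

Lemma Eplus1f_facts (Q : set T) (mu : radon_pos n alpha) : Q `<=` D ->
  Eplus1f D f Q mu ->
  [/\ fin_energy alpha mu, mu (~` D) = 0, mu.-integrable D g & mu setT = 1].
Proof.
move=> QD [[[em cm] m1] jf].
have fmu : fin_energy alpha mu by split => //; exact: radon_wintegrable.
have muD : mu (~` D) = 0.
  apply/negligibleP; first exact: measurableC.
  by apply: negligibleS cm; exact: subsetC.
by split=> //; exact: f_integrable_g.
Qed.

Lemma weighted_energyE (Q : set T) (mu : radon_pos n alpha) : Q `<=` D ->
  Eplus1f D f Q mu -> weighted_energy D f mu = (weightedR mu)%:E.
Proof.
move=> QD hmu; have [fmu muD ig m1] := Eplus1f_facts QD hmu.
rewrite /weighted_energy (g_integrable_f fmu muD ig).2 energy_posE//.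
by rewrite -[X in _ + 2%:E * (X + _)]fineK ?integrable_fin_num.
Qed.

Lemma Eplus1f_intro (Q : set T) (mu : radon_pos n alpha) : Q `<=` D ->
  fin_energy alpha mu -> concentrated mu Q -> mu setT = 1 -> mu.-integrable D g ->
  Eplus1f D f Q mu.
Proof.
move=> QD fmu cmu m1 ig; split; first by split=> //; split=> //; exact: fmu.2.
have muD : mu (~` D) = 0.
  apply/negligibleP; first exact: measurableC.
  by apply: negligibleS cmu; exact: subsetC.
exact: (g_integrable_f fmu muD ig).1.
Qed.

(** Apart from the self-energy, [weightedR] is affine under midpoints, so the correction is that of
    the parallelogram identity. *)
Lemma Eplus1f_mid (Q : set T) (mu nu : radon_pos n alpha) : Q `<=` D ->
  Eplus1f D f Q mu -> Eplus1f D f Q nu ->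
  exists2 rho : radon_pos n alpha, Eplus1f D f Q rho &
    weightedR rho = ((weightedR mu + weightedR nu) / 2 - dist2 alpha mu nu / 4)%R.
Proof.
move=> QD hmu hnu.
have [fmu muD igm m1] := Eplus1f_facts QD hmu.
have [fnu nuD ign n1] := Eplus1f_facts QD hnu.
pose mid := midmeasure mu nu.
have mid1 : mid setT = 1.
  rewrite /mid /= /mscale/= [X in _ * X]measure_addE m1 n1.
  by rewrite -EFinD -EFinM; congr EFin; rewrite -[X in (_ * X)%R]/(2%:R)%R mulVf.
have [rho rhoE] := @finite_radon _ _ alpha alphan mid (eq_ind_r (fun z => z < +oo) (ltry 1) mid1).
have fmid : fin_energy alpha mid by exact: mid_fin_energy.
have [igmid intg] := integral_mid mD igm ign.
have em (z : {measure set T -> \bar R}) : fin_energy alpha z ->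
    energyR alpha mid z = ((energyR alpha mu z + energyR alpha nu z) / 2)%R.
  move=> fz; apply: EFin_inj; rewrite -energy_posE// energy_pos_mid//; last exact: fz.1.
  by rewrite !energy_posE// -EFinD -EFinM mulrC.
exists rho.
  apply: Eplus1f_intro => //; rewrite ?rhoE//.
  have [[[_ [N1 [mN1 N10 sN1]]] _] _] := hmu.
  have [[[_ [N2 [mN2 N20 sN2]]] _] _] := hnu.
  (* [Q] need not be measurable; this measurable set contains its complement and is null for both
     measures. *)
  exists (N1 `&` N2); split; [exact: measurableI| |by rewrite subsetI].
  rewrite rhoE /mid /= /mscale/= [X in _ * X]measure_addE.
  have z (m : radon_pos n alpha) N : measurable N -> m N = 0 -> N1 `&` N2 `<=` N -> m (N1 `&` N2) = 0.
    move=> mN mN0 sN; apply/eqP; rewrite eq_le measure_ge0 andbT -mN0.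
    by apply: le_measure; rewrite ?inE//; exact: measurableI.
  by rewrite (z mu N1)// ?(z nu N2)// adde0 mule0.
have emm : energyR alpha mid mid =
   ((energyR alpha mu mu + energyR alpha nu nu) / 2 - dist2 alpha mu nu / 4)%R.
  by apply: EFin_inj; rewrite -energy_posE// energy_pos_midmid.
rewrite /weightedR rhoE -/mid emm (em _ ftp) (em _ ftn) intg.
have [a ->] : exists a, \int[mu]_(x in D) g x = a%:E.
  by exists (fine (\int[mu]_(x in D) g x)); rewrite fineK//; exact: integrable_fin_num igm.
have [b ->] : exists b, \int[nu]_(x in D) g x = b%:E.
  by exists (fine (\int[nu]_(x in D) g x)); rewrite fineK//; exact: integrable_fin_num ign.
by rewrite -EFinD -EFinM /=; field.
Qed.

Lemma weighted_inf_le (Q : set T) (mu : radon_pos n alpha) : Q `<=` D ->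
  Eplus1f D f Q mu -> weighted_inf (alpha := alpha) D f Q <= (weightedR mu)%:E.
Proof.
move=> QD hmu; rewrite -(weighted_energyE QD hmu).
by apply: ereal_inf_lbound; exists mu.
Qed.

Lemma dist2_le_weighted (Q : set T) (mu nu : radon_pos n alpha) (w : R) : Q `<=` D ->
  w%:E <= weighted_inf (alpha := alpha) D f Q -> Eplus1f D f Q mu -> Eplus1f D f Q nu ->
  (dist2 alpha mu nu <= 2 * (weightedR mu - w) + 2 * (weightedR nu - w))%R.
Proof.
move=> QD wQ hmu hnu; have [rho hrho e] := Eplus1f_mid QD hmu hnu.
have := le_trans wQ (weighted_inf_le QD hrho); rewrite lee_fin e; lra.
Qed.

(** Otherwise the sets where [g] is below [-k] have a cluster point [p] in [K], although lower
    semicontinuity bounds [g] from below near [p]. *)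
Lemma lsc_bounded_below (K : set T) : compact K -> K `<=` D ->
  exists C : R, forall x, K x -> C%:E <= g x.
Proof.
move=> cK KD; apply: contrapT => /forallNP h.
pose Z (k : nat) := [set x | K x /\ g x < (- k%:R)%:E].
have Z0 k : Z k !=set0.
  have /existsNP[x /not_implyP[Kx /negP]] := h (- k%:R)%R.
  by rewrite -ltNge => gx; exists x.
have PF : ProperFilter (filter_from [set: nat] Z).
  apply: filter_from_proper => [|k _]; last exact: Z0.
  apply: filter_from_filter; first by exists 0%N.
  move=> i j _ _; exists (maxn i j) => //= x [Kx gx].
  by split; split => //; apply: lt_le_trans gx _; rewrite lee_fin lerN2 ler_nat ?leq_maxl ?leq_maxr.
have FK : filter_from [set: nat] Z K by exists 0%N => // x [].
have [p [Kp clp]] := cK _ PF FK.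
have [a ag] : exists a : R, a%:E < g p.
  have := gNy (KD _ Kp); case: (g p) => [r| |]// _.
    by exists (r - 1)%R; rewrite lte_fin ltrBlDr ltrDl.
  by exists 0%R; rewrite ltry.
have [V [oV Vp] hV] := g_lsc (KD _ Kp) ag.
pose k := (Num.truncn `|a|%R).+1.
have [x [[Kx gx] Vx]] : (Z k `&` V) !=set0.
  by apply: clp; [exists k|exact: open_nbhs_nbhs].
have := lt_trans (hV x Vx (KD _ Kx)) gx; rewrite lte_fin ltNge => /negP; apply.
rewrite lerNl (le_trans (ler_norm _))// normrN ltW// /k; exact: truncnS_gt.
Qed.

(** * Existence of a minimizer on a compact set *)

Section minimizer_on_compact.
Variables (K : set T) (w : R).
Hypotheses (cK : compact K) (KD : K `<=` D).
Hypothesis wE : weighted_inf (alpha := alpha) D f K = w%:E.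

Let mK : measurable K. Proof. exact: compact_measurable_euclid. Qed.

Let min_seq : exists mu : nat -> radon_pos n alpha, forall j,
  Eplus1f D f K (mu j) /\ (weightedR (mu j) < w + j.+1%:R^-1)%R.
Proof.
have h j : exists mu : radon_pos n alpha,
    Eplus1f D f K mu /\ (weightedR mu < w + j.+1%:R^-1)%R.
  have fin : weighted_inf (alpha := alpha) D f K \is a fin_num by rewrite wE.
  have j0 : (0 < j.+1%:R^-1 :> R)%R by rewrite invr_gt0 ltr0n.
  have [_ [mu hmu <-]] := lb_ereal_inf_adherent j0 fin.
  rewrite -/(weighted_inf D f K) wE (weighted_energyE KD hmu) -EFinD lte_fin => h.
  by exists mu.
by have [mu hmu] := choice h; exists mu.
Qed.

Let mu := sval (cid min_seq).
Let hmu j : Eplus1f D f K (mu j). Proof. by case: (svalP (cid min_seq) j). Qed.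
Let Wmu j : (weightedR (mu j) < w + j.+1%:R^-1)%R.
Proof. by case: (svalP (cid min_seq) j). Qed.

Let fmu j : fin_energy alpha (mu j).
Proof. by case: (Eplus1f_facts KD (hmu j)). Qed.

Let mu1 j : mu j setT = 1.
Proof. by case: (Eplus1f_facts KD (hmu j)). Qed.

Let muK j : mu j (~` K) = 0.
Proof.
apply/negligibleP; first exact: measurableC.
by case: (hmu j) => -[[]].
Qed.

(** Each of the two excesses is below [1 / (j + 1)] and counts twice, whence the 4. *)
Let dist2_mu i j : (j <= i)%N -> (dist2 alpha (mu i) (mu j) <= 4 / j.+1%:R)%R.
Proof.
move=> ji; have wQ : w%:E <= weighted_inf (alpha := alpha) D f K by rewrite wE.
apply: (le_trans (dist2_le_weighted KD wQ (hmu i) (hmu j))).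
have h1 := Wmu i; have h2 := Wmu j.
have h3 : (i.+1%:R^-1 <= j.+1%:R^-1 :> R)%R by rewrite lef_pV2 ?posrE ?ltr0n// ler_nat.
move: h1 h2 h3; move: (weightedR (mu i)) (weightedR (mu j)) (i.+1%:R^-1 : R)%R (j.+1%:R^-1 : R)%R.
move=> p q a b; lra.
Qed.

Let ultra_ex : exists U : set_system nat, UltraFilter U /\ \oo `<=` U.
Proof. exact: ultraFilterLemma. Qed.

Let U := sval (cid ultra_ex).
Let UU : UltraFilter U. Proof. by case: (svalP (cid ultra_ex)). Qed.
Let Uoo : \oo `<=` U. Proof. by case: (svalP (cid ultra_ex)). Qed.
Let FU : ProperFilter U. Proof. exact: ultra_proper. Qed.

Let lim_ex := prob_weak_compact cK mu1 muK UU.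
Let lam : {measure set T -> \bar R} := sval (cid lim_ex).
Let lam1 : lam setT = 1. Proof. by case: (svalP (cid lim_ex)). Qed.
Let lamK : lam (~` K) = 0. Proof. by case: (svalP (cid lim_ex)). Qed.
Let hlam : forall g : T -> \bar R, measurable_fun setT g -> (forall x, 0 <= g x) ->
   (forall x (a : R), K x -> (a%:E < g x)%E ->
     exists2 V, open V /\ V x & forall y, V y -> K y -> (a%:E < g y)%E) ->
   forall M : R, U [set j | (\int[mu j]_x g x <= M%:E)%E] ->
   (\int[lam]_x g x <= M%:E)%E.
Proof. by case: (svalP (cid lim_ex)). Qed.

Let wlam : wintegrable alpha lam.
Proof. by apply: finite_wintegrable => //; rewrite lam1 ltry. Qed.

Let moment_cvg k (I : {ffun 'I_k -> bool + 'I_n}) :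
  moment alpha (mu j) I @[j --> U] --> moment alpha lam I.
Proof.
apply: (weak_limit_continuous UU mu1 lam1 hlam).
  exact: continuous_feature_prod.
move=> x; apply: le_trans (feature_prod_le _ _ _) _ => //.
exact: wweight_le1.
Qed.

Let moment_form_cvg N j :
  moment_form alpha N (moment_diff alpha (mu i) (mu j)) (moment_diff alpha (mu i) (mu j))
   @[i --> U] -->
  moment_form alpha N (moment_diff alpha lam (mu j)) (moment_diff alpha lam (mu j)).
Proof.
have FU' : ProperFilter U := FU.
apply: cvg_bigsum => k; apply: cvgMl_tmp; apply: cvg_bigsum => I.
by apply: cvgM; apply: cvgB; [exact: moment_cvg|exact: cvg_cst|exact: moment_cvg|exact: cvg_cst].
Qed.

(** A truncation is a polynomial in finitely many moments, so it passes to the weak limit; its bound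
    by [dist2] is uniform in [i >= j]. *)
Let moment_form_le N j :
  (moment_form alpha N (moment_diff alpha lam (mu j)) (moment_diff alpha lam (mu j))
   <= 4 / j.+1%:R)%R.
Proof.
have FU' : ProperFilter U := FU.
have c := @moment_form_cvg N j; rewrite -(cvg_lim _ c)//; apply: limr_le.
  by apply/cvg_ex; eexists; exact: c.
apply: Uoo; exists j => // i /= ji.
exact: le_trans (moment_form_le_dist2 alphan N (fmu i) (fmu j)) (dist2_mu ji).
Qed.

Let flam : fin_energy alpha lam.
Proof.
split => //; apply: (@le_lt_trans _ _ (8 + 2 * energyR alpha (mu 0%N) (mu 0%N))%:E); last exact: ltry.
apply: energy_pos_le => // N; rewrite lee_fin.
have h1 := moment_form_le N 0%N; rewrite divr1 in h1.
have h2 : (moment_form alpha N (moment alpha (mu 0%N)) (moment alpha (mu 0%N)) <=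
    energyR alpha (mu 0%N) (mu 0%N))%R.
  rewrite -lee_fin -energy_posE//; apply: moment_form_le_energy => //; exact: (fmu 0%N).1.
(* Positivity at [lam - 2 mu_0] gives [|lam|^2 <= 2 |lam - mu_0|^2 + 2 |mu_0|^2] for the truncated
   form, the first square on the right being at most 4. *)
have := moment_form_ge0 alphan N (fun k (I : {ffun 'I_k -> bool + 'I_n}) =>
   1 * moment alpha lam I + (-2) * moment alpha (mu 0%N) I)%R.
rewrite moment_form_quad; move: h1; rewrite moment_form_diff.
lra.
Qed.

Let dist2_lam j : (dist2 alpha lam (mu j) <= 4 / j.+1%:R)%R.
Proof. by apply: dist2_le => // N; exact: moment_form_le. Qed.

Let rate_cvg : (fun j => 4 / j.+1%:R : R)%R @ \oo --> (0 : R)%R.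
Proof.
rewrite -[X in _ --> X](mulr0 4%R); apply: cvgMl_tmp; exact: cvg_harmonic.
Qed.

Let energy_cvg (nu : {measure set T -> \bar R}) : fin_energy alpha nu ->
  energyR alpha (mu j) nu @[j --> \oo] --> energyR alpha lam nu.
Proof.
move=> fnu; apply/cvgrPdist_le => e e0.
pose c := (energyR alpha nu nu + 1)%R.
have c0 : (0 < c)%R by rewrite ltr_wpDl// energyR_ge0.
have h : (0 < e ^+ 2 / c)%R by rewrite divr_gt0// exprn_gt0.
apply: filterS (cvgr0_norm_le _ rate_cvg _ h) => j hj.
rewrite -(@ler_sqr R) ?nnegrE ?(ltW e0)// real_normK ?num_real//.
rewrite (energyRC alphan (fmu j) fnu) (energyRC alphan flam fnu).
apply: (le_trans (energyR_diff_CS alphan fnu flam (fmu j))).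
have d0 := dist2_ge0 alphan flam (fmu j).
apply: (@le_trans _ _ (c * (e ^+ 2 / c))%R); last by rewrite mulrC divfK// gt_eqF.
rewrite ler_pM ?energyR_ge0//; first by rewrite lerDl.
apply: le_trans (dist2_lam j) _; apply: le_trans hj; exact: ler_norm.
Qed.

Let self_energy_cvg : energyR alpha (mu j) (mu j) @[j --> \oo] --> energyR alpha lam lam.
Proof.
have h : Num.sqrt (energyR alpha (mu j) (mu j)) @[j --> \oo] --> Num.sqrt (energyR alpha lam lam).
  apply/cvgrPdist_le => e e0.
  have h : (0 < e ^+ 2)%R by rewrite exprn_gt0.
  apply: filterS (cvgr0_norm_le _ rate_cvg _ h) => j hj.
  rewrite -(@ler_sqr R) ?nnegrE ?(ltW e0)// real_normK ?num_real//.
  apply: le_trans (sqrt_energyR_diff alphan flam (fmu j)) _.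
  by apply: le_trans (dist2_lam j) _; apply: le_trans hj; exact: ler_norm.
have e (m : {measure set T -> \bar R}) : energyR alpha m m =
    (Num.sqrt (energyR alpha m m) * Num.sqrt (energyR alpha m m))%R.
  by rewrite -expr2 sqr_sqrtr// energyR_ge0.
rewrite (e lam) (_ : (fun j => _) = (fun j => Num.sqrt (energyR alpha (mu j) (mu j)) *
  Num.sqrt (energyR alpha (mu j) (mu j)))%R); first exact: cvgM.
by apply/funext => j; exact: e.
Qed.

Let bnd := lsc_bounded_below cK KD.
Let C : R := sval (cid bnd).
Let gC x : K x -> C%:E <= g x. Proof. exact: (svalP (cid bnd)). Qed.

(** Shifted by its lower bound on [K] and set to 0 elsewhere, [g] becomes nonnegative on the whole
    space, as [hlam] requires. *)
Let gt : T -> \bar R := (fun x => g x - C%:E) \_ K.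

Let mgK : measurable_fun K g. Proof. exact: measurable_funS mg. Qed.

Let measurable_gt : measurable_fun setT gt.
Proof.
have h : measurable_fun K (fun x => g x - C%:E).
  by apply: emeasurable_funB => //; exact: measurable_cst.
exact: (measurable_restrictT _ mK).1 h.
Qed.

Let gt_ge0 x : 0 <= gt x.
Proof.
rewrite /gt /patch; case: ifPn => //; rewrite inE => /gC gx.
by rewrite sube_ge0.
Qed.

Let gt_lsc x (a : R) : K x -> a%:E < gt x ->
  exists2 V, open V /\ V x & forall y, V y -> K y -> a%:E < gt y.
Proof.
move=> Kx; rewrite /gt /patch mem_set// lteBrDr// -EFinD => ax.
have [V oV hV] := g_lsc (KD Kx) ax; exists V => // y Vy Ky.
by rewrite mem_set// lteBrDr// -EFinD; apply: hV => //; exact: KD.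
Qed.

Section prob_on_K.
Variable m : {measure set T -> \bar R}.
Hypotheses (m1 : m setT = 1) (m0 : m (~` K) = 0).

Let mK1 : m K = 1.
Proof.
have := m1; rewrite -(setUv K) measureU ?setICr//; last exact: measurableC.
by rewrite [X in _ + X](m0) adde0.
Qed.

Lemma integral_gt_fin : \int[m]_x gt x < +oo -> m.-integrable D g.
Proof.
move=> hgt; apply/integrableP; split => //.
rewrite (@ge0_negligible_integral _ _ _ m D (~` K))//; first last.
- exact: measurableT_comp.
- exact: measurableC.
rewrite setDE setCK setIidr//.
apply: (@le_lt_trans _ _ (\int[m]_(x in K) (gt x + `|C|%:E))).
  apply: ge0_le_integral => //.
  - exact: measurableT_comp.
  - apply: emeasurable_funD; [exact: measurable_funS measurable_gt|exact: measurable_cst].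
  - move=> x Kx; rewrite /gt /patch mem_set//.
    have := gC Kx; case: (g x) => [r| |]//=.
    rewrite lee_fin => Cr; rewrite -EFinD lee_fin.
    have -> : (`|r| = `|(r - C) + C|)%R by rewrite subrK.
    by apply: (le_trans (ler_normD _ _)); rewrite ger0_norm// subr_ge0.
rewrite ge0_integralD//; last exact: measurable_funS measurable_gt.
rewrite integral_cst// mK1 mule1; apply: lte_add_pinfty; last exact: ltry.
apply: le_lt_trans hgt; apply: ge0_subset_integral => //.
Qed.

Lemma integral_gtE : m.-integrable D g ->
  \int[m]_x gt x = (fine (\int[m]_(x in D) g x) - C)%:E.
Proof.
move=> ig; have igK : m.-integrable K g by exact: integrableS ig.
have e : \int[m]_(x in D) g x = \int[m]_(x in K) g x.
  rewrite (@negligible_integral _ _ _ m D (~` K))//; last exact: measurableC.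
  by rewrite setDE setCK setIidr.
rewrite /gt -integral_mkcond EFinB fineK; last exact: integrable_fin_num ig.
rewrite e integralB//.
- by rewrite integral_cst// mK1 mule1.
- apply/integrableP; split; first exact: measurable_cst.
  by rewrite integral_cst// mK1 mule1 ltry.
Qed.

End prob_on_K.

Let ig j : (mu j).-integrable D g.
Proof. by case: (Eplus1f_facts KD (hmu j)). Qed.

(** The value of the integral of [g] for which [weightedR lam] equals [w]. *)
Let L : R := ((w - energyR alpha lam lam) / 2
   - (energyR alpha lam tp - energyR alpha lam tn))%R.

(** [Wmu] bounds the integrals of [g] against [mu j] by quantities that tend to [L], by convergence
    of the energies; lower semicontinuity carries the bound over to [lam]. *)
Let lam_gt_le : \int[lam]_x gt x <= (L - C)%:E.
Proof.
have FU' : ProperFilter U := FU.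
apply/lee_addgt0Pr => e e0; rewrite -EFinD; apply: hlam => //.
have c : ((w + j.+1%:R^-1 - energyR alpha (mu j) (mu j)) / 2
   - (energyR alpha (mu j) tp - energyR alpha (mu j) tn))%R @[j --> \oo] --> L.
  rewrite /L; apply: cvgB; last by apply: cvgB; exact: energy_cvg.
  apply: cvgMr_tmp; apply: cvgB; last exact: self_energy_cvg.
  rewrite -[X in _ --> X]addr0; apply: cvgD; first exact: cvg_cst.
  exact: cvg_harmonic.
have Le : (L < L + e)%R by rewrite ltrDl.
apply: Uoo; apply: filterS (cvgr_lt _ c _ Le) => j /= hj.
rewrite integral_gtE// lee_fin lerBlDr addrAC subrK.
have := Wmu j; rewrite /weightedR; move: hj.
move: (energyR _ _ _) (energyR _ _ _) (energyR _ _ _) (fine _) (j.+1%:R^-1)%R => a b c' d h.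
lra.
Qed.

Lemma minimizer_on_compact : exists lamK : radon_pos n alpha, is_minimizer D f K lamK.
Proof.
have igl : lam.-integrable D g.
  by apply: integral_gt_fin => //; exact: le_lt_trans lam_gt_le (ltry _).
have [rho rhoE] := @finite_radon _ _ alpha alphan lam (eq_ind_r (fun z => z < +oo) (ltry 1) lam1).
have hrho : Eplus1f D f K rho.
  apply: Eplus1f_intro => //; rewrite ?rhoE//.
  by apply/negligibleP; [exact: measurableC|rewrite rhoE].
exists rho; split => //; last by rewrite wE.
apply/le_anti; rewrite (weighted_energyE KD hrho) weighted_inf_le// andbT.
rewrite wE lee_fin /weightedR rhoE.
have := lam_gt_le; rewrite integral_gtE// lee_fin /L; lra.
Qed.

End minimizer_on_compact.

End weighted_problem.

(** * Approximation of an admissible measure by measures on compact subsets *)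

Section inner_approximation.
Context {R : realType} {n : nat} {alpha : R}.
Hypothesis alphan : (alpha < n%:R)%R.
Local Notation T := (euclid R n).
Local Open Scope ereal_scope.
Variables (D A : set T) (f : T -> \bar R) (mu : radon_pos n alpha).
Hypotheses (mD : measurable D) (AD : A `<=` D) (hmu : Eplus1f D f A mu).

Let mu1 : mu setT = 1. Proof. by case: hmu => -[]. Qed.
Let jf : mu.-integrable D f. Proof. by case: hmu. Qed.
Let fmu : fin_energy alpha mu.
Proof. by split; [exact: radon_wintegrable|case: hmu => -[[]]]. Qed.

(** [A] need not be measurable, so the compact sets below are taken inside the complement of [N]. *)
Let null_ex : exists N : set T, [/\ measurable N, mu N = 0 & ~` A `<=` N].
Proof. by case: hmu => -[[_ []]] N [mN N0 sN] _ _; exists N. Qed.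

Let N := sval (cid null_ex).
Let mN : measurable N. Proof. by case: (svalP (cid null_ex)). Qed.
Let N0 : mu N = 0. Proof. by case: (svalP (cid null_ex)). Qed.
Let sN : ~` N `<=` A.
Proof.
case: (svalP (cid null_ex)) => _ _ h x nNx; apply: contrapT => nA.
by apply: nNx; exact: h.
Qed.

(** With [j.+2] the mass of the compact set is positive already for [j = 0], so the restriction can
    be normalized. *)
Let C_ex j : exists F : set T,
  [/\ compact F, F `<=` ~` N & mu (~` N `\` F) <= (j.+2%:R^-1)%:E].
Proof.
apply: compact_inner_regular; [by rewrite mu1 ltry|exact: measurableC|].
by rewrite invr_gt0 ltr0n.
Qed.

Let C j := sval (cid (C_ex j)).
Let cC j : compact (C j). Proof. by case: (svalP (cid (C_ex j))). Qed.
Let CN j : C j `<=` ~` N. Proof. by case: (svalP (cid (C_ex j))). Qed.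
Let CNle j : mu (~` N `\` C j) <= (j.+2%:R^-1)%:E.
Proof. by case: (svalP (cid (C_ex j))). Qed.

Let K j := \big[setU/set0]_(i < j.+1) C i.

Let cK j : compact (K j). Proof. by apply: bigsetU_compact => i _; exact: cC. Qed.
Let mK j : measurable (K j). Proof. exact: compact_measurable_euclid. Qed.
Let KN j : K j `<=` ~` N.
Proof. by rewrite /K -bigcup_mkord => x [i _ /CN]. Qed.
Let KA j : K j `<=` A. Proof. exact: subset_trans sN. Qed.
Let KD j : K j `<=` D. Proof. exact: subset_trans AD. Qed.
Let K_nd : {homo K : i j / (i <= j)%N >-> (i <= j)%O}.
Proof.
move=> i j ij; rewrite subsetEset /K -!bigcup_mkord => x [k /= ki Ckx].
by exists k => //=; exact: leq_trans ij.
Qed.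

Let muCN : mu (~` N) = 1.
Proof.
have := mu1; rewrite -(setUv N) measureU ?setICr//; last exact: measurableC.
by rewrite [X in X + _]N0 add0e.
Qed.

Let rest_le j : mu (~` N `\` K j) <= (j.+2%:R^-1)%:E.
Proof.
have CK : C j `<=` K j by rewrite /K big_ord_recr/=; exact: subsetUr.
apply: le_trans (CNle j); apply: le_measure; rewrite ?inE.
- by apply: measurableD; [exact: measurableC|exact: mK].
- by apply: measurableD; [exact: measurableC|exact: compact_measurable_euclid].
- exact: setDS.
Qed.

Let muK_ge j : (1 - j.+2%:R^-1)%:E <= mu (K j).
Proof.
have e : mu (K j) + mu (~` N `\` K j) = 1.
  rewrite -muCN (measureDI mu (measurableC mN) (mK j)) addeC.
  by congr (_ + mu _); rewrite setIidr.
rewrite EFinB -e leeBlDr// leeD2l//; exact: rest_le.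
Qed.

Let muK_fin j : mu (K j) \is a fin_num.
Proof.
rewrite ge0_fin_numE//; apply: (@le_lt_trans _ _ (mu setT)); last by rewrite mu1 ltry.
by apply: le_measure; rewrite ?inE.
Qed.

Let m j : R := fine (mu (K j)).

Let m_ge j : (1 - j.+2%:R^-1 <= m j)%R.
Proof. by rewrite -lee_fin fineK. Qed.

Let m_gt0 j : (0 < m j)%R.
Proof.
by apply: lt_le_trans (m_ge j); rewrite subr_gt0 invf_lt1 ?ltr0n// ltr1n.
Qed.

Let m_le1 j : (m j <= 1)%R.
Proof.
by rewrite -lee_fin fineK// -mu1; apply: le_measure; rewrite ?inE.
Qed.

Let c j : R := (m j)^-1%R.
Let c_ge0 j : (0 <= c j)%R. Proof. by rewrite invr_ge0 ltW. Qed.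

Let cvg_c : (c j @[j --> \oo] --> (1 : R))%R.
Proof.
rewrite -[X in _ --> X]invr1; apply: cvgV; first exact: oner_neq0.
have h : \forall j \near \oo, (1 - harmonic j <= m j <= 1)%R.
  apply: nearW => j; rewrite m_le1 andbT; apply: le_trans (m_ge j).
  by rewrite lerD2l lerN2 lef_pV2 ?posrE ?ltr0n// ler_nat.
apply: (squeeze_cvgr h); last exact: cvg_cst.
rewrite -[X in _ --> X]subr0; apply: cvgB; first exact: cvg_cst.
exact: cvg_harmonic.
Qed.

Let nu j := scaled_restr (NngNum (c_ge0 j)) mu (mK j).

Let nu1 j : nu j setT = 1.
Proof.
rewrite /nu /scaled_restr/= /mscale/= /mrestr setTI -[mu _]fineK// -EFinM.
by rewrite mulVf// gt_eqF// m_gt0.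
Qed.

Let nu_rad_ex j : exists rho : radon_pos n alpha, radon_measure rho = nu j.
Proof. by apply: finite_radon => //; rewrite nu1 ltry. Qed.

Let rho j := sval (cid (nu_rad_ex j)).
Let rhoE j : radon_measure (rho j) = nu j. Proof. exact: (svalP (cid (nu_rad_ex j))). Qed.

Let nu_w j : wintegrable alpha (nu j).
Proof. by apply: finite_wintegrable => //; rewrite nu1 ltry. Qed.

(** Restriction and scaling are carried out in one argument at a time, with symmetry in between;
    each gives a factor [c j]. *)
Let nu_energy j : energy_pos alpha (nu j) (nu j) <= (c j ^+ 2 * energyR alpha mu mu)%:E.
Proof.
have pm := @measurable_potential_pos R n alpha alphan.
have p0 (m0 : {measure set T -> \bar R}) x := @potential_pos_ge0 R n alpha m0 x.
have h (m1 : {measure set T -> \bar R}) : wintegrable alpha m1 ->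
    energy_pos alpha (nu j) m1 <= (c j)%:E * energy_pos alpha mu m1.
  move=> w1; have mp := pm _ w1.
  have e : energy_pos alpha (nu j) m1 =
      (c j)%:E * \int[mu]_(x in setT `&` K j) potential_pos alpha m1 x.
    exact: (ge0_integral_scaled_restr (NngNum (c_ge0 j)) mu (mK j) measurableT mp
      (fun x _ => p0 m1 x)).
  rewrite e setTI lee_wpmul2l ?lee_fin//.
  by apply: ge0_subset_integral => // x _; exact: p0.
apply: (le_trans (h _ (nu_w j))).
rewrite (energy_posC alphan fmu.1 (nu_w j)) expr2 -mulrA EFinM.
rewrite lee_wpmul2l ?lee_fin// EFinM -energy_posE//; exact: h fmu.1.
Qed.

Let rho_in j : Eplus1f D f (K j) (rho j).
Proof.
split; last by rewrite rhoE; exact: (integral_scaled_restr _ _ mD jf).1.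
split; last by rewrite rhoE.
split; first by rewrite rhoE; apply: le_lt_trans (nu_energy j) (ltry _).
apply/negligibleP; first exact: measurableC.
by rewrite rhoE /nu /scaled_restr /= /mscale/= /mrestr setICl measure0 mule0.
Qed.

Let a j := fine (\int[mu]_(x in K j) f^\+ x).
Let b j := fine (\int[mu]_(x in K j) f^\- x).

Let jfK j : mu.-integrable (K j) f.
Proof. exact: integrableS jf. Qed.

Let integral_rho j : \int[rho j]_(x in D) f x = (c j * (a j - b j))%:E.
Proof.
rewrite rhoE (integral_scaled_restr _ _ mD jf).2 /= setIidr// EFinM; congr (_ * _).
rewrite integralE EFinB /a /b !fineK//.
- by apply: integrable_neg_fin_num.
- by apply: integrable_pos_fin_num.
Qed.

Let bigcupK : D `\` \bigcup_j K j `<=` N `|` (\bigcap_j (~` N `\` K j)).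
Proof.
move=> x [_ nK]; have [Nx|nN] := pselect (N x); [by left|right].
by move=> j _; split => // Kx; apply: nK; exists j.
Qed.

Let null_rest : mu (D `\` \bigcup_j K j) = 0.
Proof.
have mU : measurable (\bigcup_j K j) by exact: bigcup_measurable.
apply/eqP; rewrite eq_le measure_ge0 andbT.
apply/lee_addgt0Pr => e e0; rewrite add0e.
have he : (0 < e)%R by [].
pose j := Num.truncn e^-1.
apply: (@le_trans _ _ (mu (N `|` (~` N `\` K j)))).
  apply: le_measure; rewrite ?inE.
  - exact: measurableD.
  - by apply: measurableU => //; apply: measurableD => //; exact: measurableC.
  - by move=> x /bigcupK [Nx|h]; [left|right; exact: h].
have mNK : measurable (~` N `\` K j) by apply: measurableD => //; exact: measurableC.
apply: (le_trans (measureU2 _ mN mNK)); rewrite [X in X + _]N0 add0e.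
apply: (le_trans (rest_le j)); rewrite lee_fin.
rewrite invf_ple ?posrE ?ltr0n//; apply: ltW.
by apply: (lt_trans (truncnS_gt _)); rewrite ltr_nat.
Qed.

(** Monotone convergence along the increasing [K j], whose union is [D] up to a null set. *)
Let cvg_part (h : T -> \bar R) : (forall x, 0 <= h x) -> mu.-integrable D h ->
  (fine (\int[mu]_(x in K j) h x) @[j --> \oo] --> fine (\int[mu]_(x in D) h x))%R.
Proof.
move=> h0 jh; have mh : measurable_fun D h by exact: measurable_int jh.
have mU : measurable (\bigcup_j K j) by exact: bigcup_measurable.
have UD : \bigcup_j K j `<=` D by move=> x [j _ /KD].
have e : \int[mu]_(x in D) h x = \int[mu]_(x in \bigcup_j K j) h x.
  rewrite (@ge0_negligible_integral _ _ _ mu D (D `\` \bigcup_j K j))//.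
    by rewrite setDD setIidr.
  exact: measurableD.
apply: (@fine_cvg _ _ _ _ (fun j => \int[mu]_(x in K j) h x)).
rewrite fineK; last exact: integrable_fin_num jh.
rewrite e; apply: ge0_nondecreasing_set_cvg_integral => //.
by move=> j; apply: measurable_funS mh.
Qed.

Lemma inner_approximation (e : R) : (0 < e)%R ->
  exists F (rho : radon_pos n alpha), [/\ compact F, F `<=` A, Eplus1f D f F rho &
    weighted_energy D f rho <= weighted_energy D f mu + e%:E].
Proof.
move=> e0.
pose E := energyR alpha mu mu.
pose Wr (j : nat) : R := (c j ^+ 2 * E + 2 * (c j * (a j - b j)))%R.
(* Kept in the shape of [Wr], with the limit 1 in place of [c j], for a termwise passage to the
   limit. *)
pose W : R := (1 ^+ 2 * E + 2 * (1 * (fine (\int[mu]_(x in D) f^\+ x) - fine (\int[mu]_(x in D) f^\- x))))%R.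
have cW : Wr j @[j --> \oo] --> W.
  apply: cvgD; first by apply: cvgMr_tmp; rewrite expr2; exact: cvgM cvg_c cvg_c.
  apply: cvgMl_tmp; apply: cvgM; first exact: cvg_c.
  by apply: cvgB; apply: cvg_part => //; [exact: integrable_funepos|exact: integrable_funeneg].
have We : (W < W + e)%R by rewrite ltrDl.
have [j _ hj] := cvgr_lt _ cW _ We.
exists (K j), (rho j); split => //.
have -> : weighted_energy D f mu = W%:E.
  have ef : \int[mu]_(x in D) f x =
      (fine (\int[mu]_(x in D) f^\+ x) - fine (\int[mu]_(x in D) f^\- x))%:E.
    rewrite integralE EFinB !fineK//; first exact: integrable_neg_fin_num.
    exact: integrable_pos_fin_num.
  by rewrite /weighted_energy energy_posE// ef /W expr1n !mul1r.
rewrite -EFinD; apply: (@le_trans _ _ (Wr j)%:E); last first.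
  by rewrite lee_fin ltW//; exact: hj (leqnn j).
rewrite /weighted_energy integral_rho.
apply: (@le_trans _ _ ((c j ^+ 2 * E)%:E + 2%:E * (c j * (a j - b j))%:E)); last exact: lexx.
by rewrite leeD2r// rhoE; exact: nu_energy.
Qed.

End inner_approximation.

(** * The potential of a measure with separated support *)

Section support.
Context {R : realType} {n : nat}.
Local Notation T := (euclid R n).
Local Open Scope ereal_scope.
Variable m : {measure set T -> \bar R}.
Hypothesis mfin : m setT < +oo.

Let null_nbhs (x : T) : ~ msupport m x -> exists V, [/\ open V, V x & m V = 0].
Proof.
move=> /existsNP[V /not_implyP[oV /not_implyP[Vx /negP]]].
rewrite -leNgt => mV; exists V; split => //.
by apply/eqP; rewrite eq_le mV measure_ge0.
Qed.

Lemma open_setC_msupport : open (~` msupport m).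
Proof.
rewrite (_ : ~` msupport m = \bigcup_(V in [set V : set T | open V /\ m V = 0]) V).
  by apply: bigcup_open => V [].
apply/seteqP; split => [x /null_nbhs[V [oV Vx mV]]|x [V [oV mV] Vx] /(_ V oV Vx)].
  by exists V.
by rewrite mV ltxx.
Qed.

Let compact_null (F : set T) : compact F -> F `<=` ~` msupport m -> m F = 0.
Proof.
move=> cF FS.
have /choice[V hV] : forall x : T, exists V : set T, F x -> [/\ open V, V x & m V = 0].
  move=> x; have [/FS/null_nbhs[V h]|nF] := pselect (F x); first by exists V.
  by exists set0.
have := cF; rewrite compact_cover => /(_ T F V).
case=> [x Fx|x Fx|E EF FE]; first by case: (hV x Fx).
  by exists x => //; case: (hV x Fx).
have mF : measurable F by exact: compact_measurable_euclid.
have EF' x : x \in finmap.enum_fset E -> F x by move=> /EF; rewrite inE.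
rewrite /cover bigcup_fset in FE.
suff [mU U0] : measurable (\big[setU/set0]_(i <- finmap.enum_fset E) V i) /\ m (\big[setU/set0]_(i <- finmap.enum_fset E) V i) = 0.
  by apply/eqP; rewrite eq_le measure_ge0 andbT -U0; apply: le_measure; rewrite ?inE.
elim: (finmap.enum_fset E) EF' => [|x s IH] h; first by rewrite big_nil measure0.
have [|mU U0] := IH; first by move=> y ys; apply: h; rewrite inE ys orbT.
have [oV _ mV] := hV x (h x (mem_head _ _)).
have mV' : measurable (V x) by exact: open_measurable_euclid.
rewrite big_cons; split; first exact: measurableU.
apply/eqP; rewrite eq_le measure_ge0 andbT.
by apply: (le_trans (measureU2 m mV' mU)); rewrite [X in X + _]mV [X in _ + X]U0 adde0.
Qed.

(** A compact set missing the support is covered by finitely many null open sets; inner regularity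
    then gives the whole complement. *)
Lemma measure_setC_msupport : m (~` msupport m) = 0.
Proof.
have mZ : measurable (~` msupport m).
  by apply: open_measurable_euclid; exact: open_setC_msupport.
apply/eqP; rewrite eq_le measure_ge0 andbT; apply/lee_addgt0Pr => e e0; rewrite add0e.
have [F [cF FZ h]] := compact_inner_regular mfin mZ e0.
have mF : measurable F by exact: compact_measurable_euclid.
apply: le_trans h; rewrite (measureDI m mZ mF) setIidr//.
by rewrite [X in _ + X](compact_null cF FZ) adde0.
Qed.

End support.

Section lsc_along.
Context {R : realType} {n : nat}.
Local Notation T := (euclid R n).
Local Open Scope ereal_scope.
Variables (D : set T) (g : T -> \bar R).
Hypothesis g_lsc : forall x (a : R), D x -> a%:E < g x ->
  exists2 V, open V /\ V x & forall y, V y -> D y -> a%:E < g y.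

Lemma measurable_lsc_along : closed D -> measurable_fun D g.
Proof.
move=> cD; apply: (measurability _ (ErealGenOInfty.measurableE R)).
move=> _ [_ [a ->] <-].
pose W := \bigcup_(V in [set V : set T | open V /\ forall y, V y -> D y -> a%:E < g y]) V.
rewrite (_ : D `&` _ = D `&` W).
  apply: measurableI; first exact: closed_measurable_euclid.
  by apply: open_measurable_euclid; apply: bigcup_open => V [].
apply/seteqP; split => x [Dx] /=.
  rewrite in_itv/= andbT => /(g_lsc Dx)[V [oV Vx] hV]; split => //.
  by exists V.
by move=> [V [_ hV] Vx]; split => //=; rewrite in_itv/= andbT; exact: hV.
Qed.

Variable h : T -> R.
Hypothesis h_cont : forall x (e : R), D x -> (0 < e)%R ->
  exists2 V, open V /\ V x & forall y, V y -> D y -> (`|h y - h x| < e)%R.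

Lemma lsc_along_addr x (a : R) : D x -> a%:E < g x + (h x)%:E ->
  exists2 V, open V /\ V x & forall y, V y -> D y -> a%:E < g y + (h y)%:E.
Proof.
move=> Dx agh.
(* [b] divides the slack: [g] stays above [b], and [h] may drop by less than [b - (a - h x)]. *)
have [b ab bg] : exists2 b : R, (a - h x < b)%R & b%:E < g x.
  have : (a - h x)%:E < g x by rewrite EFinB lteBlDr.
  case: (g x) => [r| |]//; last first.
    by exists (a - h x + 1)%R; [rewrite ltrDl|rewrite ltry].
  rewrite lte_fin => ar; exists (((a - h x) + r) / 2)%R; rewrite ?lte_fin; lra.
have e0 : (0 < b - (a - h x))%R by rewrite subr_gt0.
have [V1 [oV1 V1x] hV1] := g_lsc Dx bg.
have [V2 [oV2 V2x] hV2] := h_cont Dx e0.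
exists (V1 `&` V2); first by split; [exact: openI|split].
move=> y [V1y V2y] Dy; have h1 := hV1 y V1y Dy; have := hV2 y V2y Dy.
rewrite ltr_distl => /andP[h2 _].
rewrite -lteBlDr// -EFinB; apply: lt_trans h1; rewrite lte_fin; lra.
Qed.

End lsc_along.

Section separated_potential.
Context {R : realType} {n : nat} {alpha : R}.
Hypothesis alphan : (alpha < n%:R)%R.
Local Notation T := (euclid R n).
Local Open Scope ereal_scope.
Variables (m : {measure set T -> \bar R}) (D Z : set T) (d : R).
Hypotheses (mfin : m setT < +oo) (mZ : measurable Z) (Z0 : m Z = 0) (d0 : (0 < d)%R).
Hypothesis sep : forall x y, D x -> ~ Z y -> (d <= enorm (x - y : T))%R.

Let ker (x y : T) : R := (enorm (x - y : T) `^ (alpha - n%:R))%R.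

Let kerE x y : D x -> ~ Z y -> riesz_kernel alpha x y = (ker x y)%:E.
Proof.
move=> Dx Zy; rewrite /riesz_kernel; case: eqP => // xy.
have := sep Dx Zy; rewrite xy subrr enormE [sqnorm _](_ : _ = 0)%R ?sqrtr0.
  by rewrite leNgt d0.
by apply/eqP; rewrite sqnorm_eq0.
Qed.

Let ker_le x y : D x -> ~ Z y -> (ker x y <= d `^ (alpha - n%:R))%R.
Proof.
move=> Dx Zy; have h := sep Dx Zy.
rewrite /ker -(opprB n%:R alpha) !powRN lef_pV2 ?posrE ?powR_gt0//; last exact: lt_le_trans h.
rewrite ge0_ler_powR ?nnegrE ?subr_ge0 ?(ltW alphan) ?(ltW d0)//; exact: enorm_ge0.
Qed.

Let ker_cont x y : D x -> ~ Z y -> {for x, continuous (ker^~ y)}.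
Proof.
move=> Dx Zy.
have e0 : (0 < enorm (x - y : T))%R by apply: lt_le_trans (sep Dx Zy).
have c1 : {for x, continuous (fun z : T => enorm (z - y : T)%R)}.
  apply: (@continuous_comp _ _ _ (fun z : T => z - y : T)%R (@enorm R n)); last exact: continuous_enorm.
  by apply: (@continuousB _ _ _ id (cst y)); [exact: cvg_id|exact: cst_continuous].
have h : derivable (fun t : R => t `^ (alpha - n%:R))%R (enorm (x - y : T)%R) 1%R.
  by apply: derivable_powR; rewrite in_itv/= andbT.
have /derivable1_diffP/differentiable_continuous c := h.
exact: (continuous_comp c1 c).
Qed.

Let mZC : measurable (~` Z). Proof. exact: measurableC. Qed.

Let wm : wintegrable alpha m. Proof. exact: finite_wintegrable. Qed.

Let measurable_ker x : D x -> measurable_fun (~` Z) (fun y => (ker x y)%:E).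
Proof.
move=> Dx.
have mk : measurable_fun setT (fun y : T => (enorm (x - y : T) `^ (alpha - n%:R))%R).
  have me : measurable_fun setT (fun y : T => enorm (x - y : T)%R).
    apply: continuous_measurable_euclid => y.
    apply: (@continuous_comp _ _ _ (fun z : T => x - z : T)%R (@enorm R n)); last exact: continuous_enorm.
    by apply: (@continuousB _ _ _ (cst x) id); [exact: cst_continuous|exact: cvg_id].
  exact: (measurableT_comp (@measurable_powR R _) me).
by apply/measurable_EFinP; exact: measurable_funS mk.
Qed.

Let potentialE x : D x ->
  potential_pos alpha m x = \int[m]_(y in ~` Z) (ker x y)%:E.
Proof.
move=> Dx; rewrite /potential_pos.
have mk : measurable_fun setT (riesz_kernel alpha x).
  apply: (@emeasurable_fun_cvg _ _ _ _ (fun N y => (wweight alpha x * wweight alpha y *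
     binsum (@hexp R n alpha) N (ufun x y))%:E)) => // [N|y _]; last exact: cvg_riesz_kernel.
  apply/measurable_EFinP; rewrite (funext (fun y => binsum_featureE alpha N x y)).
  apply: measurable_sum => k; apply: measurable_sum => I.
  apply: measurable_funM => //; apply: continuous_measurable_euclid.
  exact: continuous_feature_prod.
rewrite (@ge0_negligible_integral _ _ _ m setT Z)//; last by move=> y _; exact: riesz_kernel_ge0.
by rewrite setTD; apply: eq_integral => y; rewrite inE => Zy; exact: kerE.
Qed.

Let bound_integrable : m.-integrable (~` Z) (EFin \o cst (d `^ (alpha - n%:R))%R).
Proof.
apply/integrableP; split; first exact/measurable_EFinP.
rewrite (eq_integral (cst (d `^ (alpha - n%:R))%:E)).
  rewrite integral_cst//; apply: lte_mul_pinfty => //; first by rewrite lee_fin powR_ge0.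
  by apply: le_lt_trans mfin; apply: le_measure; rewrite ?inE.
by move=> y _; rewrite /= ger0_norm// powR_ge0.
Qed.

Lemma separated_potential_fin x : D x -> potential_pos alpha m x \is a fin_num.
Proof.
move=> Dx; rewrite ge0_fin_numE ?potential_pos_ge0// potentialE//.
have := bound_integrable => /integrableP[_]; apply: le_lt_trans.
apply: ge0_le_integral => //.
- by move=> y _; rewrite lee_fin powR_ge0.
- exact: measurable_ker.
- by apply: measurableT_comp => //; apply/measurable_EFinP; exact: measurable_cst.
- move=> y Zy; rewrite lee_fin ger0_norm ?powR_ge0//; exact: ker_le.
Qed.

(** Otherwise a sequence in [D] tends to [x] with potentials at least [e] away from that at [x].
    Separation bounds the kernels by a constant, integrable since [m] is finite, and dominated
    convergence contradicts this. *)
Lemma separated_potential_cont x (e : R) : D x -> (0 < e)%R ->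
  exists2 V, open V /\ V x & forall y, V y -> D y ->
   (`|fine (potential_pos alpha m y) - fine (potential_pos alpha m x)| < e)%R.
Proof.
move=> Dx e0; apply: contrapT => H.
have /choice[y hy] : forall k, exists y : T, [/\ ball x (k.+1%:R^-1)%R y, D y &
    (e <= `|fine (potential_pos alpha m y) - fine (potential_pos alpha m x)|)%R].
  move=> k; apply: contrapT => /forallNP h; apply: H.
  exists (ball x (k.+1%:R^-1)%R)°%classic.
    split; first exact: open_interior.
    by apply: nbhsx_ballx; rewrite invr_gt0.
  move=> y /interior_subset yb Dy; rewrite ltNge; apply/negP => ey.
  by apply: (h y).
have yx : y k @[k --> \oo] --> x.
  apply/cvg_ballP => r r0; near=> k.
  have [bk _ _] := hy k; apply: le_ball bk.
  by apply: ltW; near: k; exact: (near_infty_natSinv_lt (PosNum r0)).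
have cv : \int[m]_(z in ~` Z) (ker (y k) z)%:E @[k --> \oo] -->
    \int[m]_(z in ~` Z) (ker x z)%:E.
  have Dy k : D (y k) by case: (hy k).
  have [] := @dominated_convergence _ _ _ m (~` Z) mZC (fun k z => (ker (y k) z)%:E)
    (fun z => (ker x z)%:E) (EFin \o cst (d `^ (alpha - n%:R))%R) _ _ _ bound_integrable _.
  - by move=> k; exact: measurable_ker.
  - exact: measurable_ker.
  - apply: aeW => z Zz; apply: cvg_EFin; first by near=> k.
    exact: (cvg_comp _ _ yx (ker_cont Dx Zz)).
  - apply: aeW => z k Zz; rewrite /= lee_fin ger0_norm ?powR_ge0//; exact: ker_le.
  - by [].
have Dy k : D (y k) by case: (hy k).
have cf : fine (potential_pos alpha m (y k)) @[k --> \oo] --> fine (potential_pos alpha m x).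
  apply: (@fine_cvg _ _ _ _ (fun k => potential_pos alpha m (y k))).
  rewrite fineK ?separated_potential_fin// potentialE//.
  by rewrite (funext (fun k => potentialE (Dy k))).
have /cvgrPdist_lt/(_ e e0)[k _ hk] := cf.
have := hk k (leqnn k); rewrite /= distrC ltNge; case: (hy k) => _ _ ->.
by [].
Unshelve. all: by end_near. Qed.

End separated_potential.

(** * Vague convergence from convergence of moments *)

Section bernstein.
Context {R : realType} {N : nat}.
Local Notation V := 'rV[R]_N.
Implicit Types (G : V -> R) (x z : V) (l : seq 'I_N) (d : R).

(* Expectation of [G] at the endpoint of the random walk from [z] whose
   successive steps, indexed by [l], are [d] in the direction [i] with
   probability [x ord0 i]: a Bernstein polynomial in the coordinates of [x]. *)
Fixpoint walk d l G z x : R :=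
  if l is i :: l' then
    x ord0 i * walk d l' G (z + d *: delta_mx ord0 i) x
    + (1 - x ord0 i) * walk d l' G z x
  else G z.

Lemma walk_linear d l (a : R) G G' z x :
  walk d l (fun y => G y + a * G' y) z x = walk d l G z x + a * walk d l G' z x.
Proof. by elim: l z => [//|i l IH] z /=; rewrite !IH; ring. Qed.

Lemma walk_cst d l (a : R) z x : walk d l (fun=> a) z x = a.
Proof. by elim: l z => [//|i l IH] z /=; rewrite !IH; ring. Qed.

Lemma walk_sum d l (I : Type) (s : seq I) (G : I -> V -> R) z x :
  walk d l (fun y => \sum_(i <- s) G i y) z x = \sum_(i <- s) walk d l (G i) z x.
Proof.
elim: s => [|i s IH].
  rewrite big_nil (_ : (fun y => _) = (fun=> 0)) ?walk_cst//.
  by apply/funext => y; rewrite big_nil.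
rewrite big_cons (_ : (fun y => _) = (fun y => G i y + 1 * \sum_(j <- s) G j y)).
  by rewrite walk_linear IH mul1r.
by apply/funext => y; rewrite big_cons mul1r.
Qed.

Lemma walk_le d l G G' z x : (forall i, 0 <= x ord0 i <= 1) ->
  (forall y, G y <= G' y) -> walk d l G z x <= walk d l G' z x.
Proof.
move=> x01 GG; elim: l z => [//|i l IH] z /=; have /andP[x0 x1] := x01 i.
by rewrite lerD ?ler_wpM2l ?subr_ge0.
Qed.

(** Squared bias plus variance: the steps in direction [j] are [count_mem j l] independent Bernoulli
    variables scaled by [d]. *)
Lemma walk_variance d l (j : 'I_N) (b : R) z x :
  walk d l (fun y => (y ord0 j - b) ^+ 2) z x =
  (z ord0 j + (count_mem j l)%:R * d * x ord0 j - b) ^+ 2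
  + (count_mem j l)%:R * d ^+ 2 * (x ord0 j * (1 - x ord0 j)).
Proof.
elim: l z => [|i l IH] z /=; first by rewrite !mul0r !addr0.
rewrite !IH !mxE eqxx /= eq_sym; case: eqP => [->|_] /=; rewrite natrD; ring.
Qed.

(** With [m] steps of length [1 / m] per direction, the walk from 0 has mean [x] and variance at
    most [1 / m] in each coordinate. *)
Lemma walk_approx G (C e : R) x (m : nat) : (0 < m)%N -> 0 <= C ->
  (forall i, 0 <= x ord0 i <= 1) ->
  (forall z, `|G z - G x| <= e + C * \sum_(i < N) (z ord0 i - x ord0 i) ^+ 2) ->
  `|walk m%:R^-1 (flatten (nseq m (enum 'I_N))) G 0 x - G x| <= e + C * (N%:R / m%:R).
Proof.
move=> m0 C0 x01 hG; pose d : R := m%:R^-1; pose l := flatten (nseq m (enum (ordinal N))).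
rewrite -/d -/l.
have cl j : count_mem j l = m.
  rewrite /l count_flatten map_nseq sumn_nseq.
  by rewrite (count_uniq_mem j (enum_uniq _)) mem_enum mul1n.
have md : m%:R * d = 1 by rewrite mulfV// pnatr_eq0 -lt0n.
pose Bd (y : V) : R := e + C * \sum_(i < N) (y ord0 i - x ord0 i) ^+ 2.
have WQ : walk d l Bd 0 x <= e + C * (N%:R / m%:R).
  rewrite (walk_linear d l C (fun=> e)) walk_cst lerD2l ler_wpM2l//.
  rewrite (walk_sum d l _ (fun i y => (y ord0 i - x ord0 i) ^+ 2)).
  apply: (@le_trans _ _ (\sum_(i < N) d)); last first.
    by rewrite sumr_const card_ord -[leLHS]mulr_natl; exact: lexx.
  apply: ler_sum => i _; rewrite walk_variance cl mxE md add0r mul1r subrr expr0n add0r.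
  have /andP[x0 x1] := x01 i.
  rewrite expr2 (mulrA m%:R) md mul1r ler_piMr ?invr_ge0//.
  by rewrite mulr_ile1// ?subr_ge0// gerBl.
rewrite ler_norml; apply/andP; split.
  rewrite lerBrDr addrC lerBlDr -lerBlDl.
  apply: le_trans WQ; rewrite -{1}(walk_cst d l (G x) 0 x).
  rewrite -[X in _ - X]mul1r -mulNr -walk_linear; apply: walk_le => // y.
  rewrite mulN1r; apply: le_trans (hG y); rewrite -opprB lerNl.
  by have := ler_norm (- (G y - G x)); rewrite normrN lerNl.
rewrite -[X in _ - X <= _](walk_cst d l (G x) 0 x) -[X in _ - X]mul1r -mulNr -walk_linear.
apply: le_trans WQ; apply: walk_le => // y.
by rewrite mulN1r; apply: le_trans (hG y); exact: ler_norm.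
Qed.

(** Near [x] continuity suffices, uniformly by compactness; far from [x] the bound on [G] is
    absorbed by the quadratic term, whose expectation [walk_variance] computes. *)
Lemma modulus G (M : R) (K : set V) (e : R) : continuous G ->
  (forall z, `|G z| <= M) -> compact K -> 0 < e ->
  exists2 C, 0 <= C & forall x, K x -> forall z,
    `|G z - G x| <= e + C * \sum_(i < N) (z ord0 i - x ord0 i) ^+ 2.
Proof.
move=> cG GM cK e0.
have M0 : 0 <= M by apply: le_trans (GM 0).
pose P (k : nat) (x : V) := forall z,
  `|G z - G x| <= e + k%:R * \sum_(i < N) (z ord0 i - x ord0 i) ^+ 2.
have /compact_near_coveringP/(_ nat (nbhs \oo) P _) ncK := cK.
have [|k _ hk] := ncK; last first.
  by exists k%:R => // x Kx z; exact: (hk k (leqnn k) x Kx z).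
move=> p Kp.
have e2 : 0 < e / 2 by rewrite divr_gt0.
have /cvgrPdist_lt/(_ _ e2)/nbhs_ballP[d /= d0 hd] := cG p.
have d2 : 0 < d / 2 by rewrite divr_gt0.
(* From [k0] on, the quadratic term is at least [2 * M] once some coordinates of [z] and [x] differ
   by [d / 2]. *)
pose k0 := (Num.truncn (2 * M / (d / 2) ^+ 2)).+1.
exists (ball p (d / 2), [set k | (k0 <= k)%N]) => /=.
  by split; [exact: nbhsx_ballx|exists k0].
move=> [x k] [/= px k0k] z.
have dist_x : `|G p - G x| < e / 2.
  by apply: hd; apply: le_ball px; have := d0; lra.
have S0 : 0 <= \sum_(i < N) (z ord0 i - x ord0 i) ^+ 2.
  by apply: sumr_ge0 => i _; exact: sqr_ge0.
have [pz|npz] := pselect (ball p d z).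
  have dist_z := hd z pz.
  rewrite (_ : G z - G x = (G p - G x) - (G p - G z)); last by ring.
  apply: (le_trans (ler_normB _ _)).
  apply: (@le_trans _ _ e); last by rewrite lerDl mulr_ge0.
  by rewrite [leRHS](splitr e) lerD ?ltW.
have [j hj] : exists j, d <= `|p ord0 j - z ord0 j|.
  apply: contrapT => /forallNP h; apply: npz; split=> // i j; rewrite ord1.
  by rewrite /ball /= ltNge; apply/negP; exact: h.
have hx : `|p ord0 j - x ord0 j| < d / 2 by exact: px.2 ord0 j.
have hzx : d / 2 <= `|z ord0 j - x ord0 j|.
  have : d <= `|p ord0 j - x ord0 j| + `|z ord0 j - x ord0 j|.
    apply: le_trans hj _; rewrite -normrN in hx *.
    rewrite (_ : p ord0 j - z ord0 j = (p ord0 j - x ord0 j) - (z ord0 j - x ord0 j)); last by ring.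
    by rewrite normrN; exact: ler_normB.
  by move=> h; rewrite -(lerD2l (d / 2)) -splitr (le_trans h)// lerD2r ltW.
have S1 : (d / 2) ^+ 2 <= \sum_(i < N) (z ord0 i - x ord0 i) ^+ 2.
  rewrite (bigD1 j)//=; apply: (@le_trans _ _ ((z ord0 j - x ord0 j) ^+ 2)).
    rewrite -[leRHS](@real_normK R) ?num_real// ler_sqr ?nnegrE// ltW//.
  by rewrite lerDl sumr_ge0// => i _; exact: sqr_ge0.
apply: (@le_trans _ _ (2 * M)).
  by apply: (le_trans (ler_normB _ _)); rewrite mulr_natl mulr2n lerD.
apply: (@le_trans _ _ (k%:R * (d / 2) ^+ 2)); last first.
  by apply: (@le_trans _ _ (k%:R * \sum_(i < N) (z ord0 i - x ord0 i) ^+ 2));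
    rewrite ?ler_wpM2l// lerDr ltW.
rewrite -ler_pdivrMr ?exprn_gt0//; apply: (@le_trans _ _ k0%:R); last by rewrite ler_nat.
by rewrite ltW// truncnS_gt.
Qed.

End bernstein.

(** * Approximation of test functions by polynomials in the features *)

Section feature_polynomials.
Context {R : realType} {n : nat}.
Local Notation T := (euclid R n).
Local Notation D := (bool + 'I_n)%type.
Implicit Types (x y : T) (h : T -> R).

Definition polyfeat h := exists L : seq (R * seq D),
  forall x, h x = \sum_(p <- L) p.1 * \prod_(d <- p.2) feature x d.

Lemma polyfeat_cst (a : R) : polyfeat (fun=> a).
Proof. by exists [:: (a, [::])] => x; rewrite big_seq1 big_nil mulr1. Qed.

Lemma polyfeat_feature d : polyfeat (feature ^~ d).
Proof. by exists [:: (1, [:: d])] => x; rewrite !big_seq1 mul1r. Qed.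

Lemma polyfeatD h h' : polyfeat h -> polyfeat h' -> polyfeat (fun x => h x + h' x).
Proof.
by move=> [L hL] [L' hL']; exists (L ++ L') => x; rewrite big_cat hL hL'.
Qed.

Lemma polyfeatM h h' : polyfeat h -> polyfeat h' -> polyfeat (fun x => h x * h' x).
Proof.
move=> [L hL] [L' hL']; exists [seq (p.1 * q.1, p.2 ++ q.2) | p <- L, q <- L'] => x.
rewrite big_allpairs_dep hL hL' mulr_suml; apply: eq_bigr => p _.
by rewrite mulr_sumr; apply: eq_bigr => q _; rewrite big_cat /=; ring.
Qed.

Lemma polyfeat_walk N d l G z (c : T -> 'rV[R]_N) :
  (forall i, polyfeat (fun x => c x ord0 i)) ->
  polyfeat (fun x => walk d l G z (c x)).
Proof.
move=> hc; elim: l z => [|i l IH] z /=; first exact: polyfeat_cst.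
apply: polyfeatD; apply: polyfeatM => //; apply: polyfeatD; first exact: polyfeat_cst.
rewrite (_ : (fun x => _) = (fun x => -1 * c x ord0 i)).
  by apply: polyfeatM => //; exact: polyfeat_cst.
by apply/funext => x; rewrite mulN1r.
Qed.

Variable alpha : R.
Hypothesis alphan : alpha < n%:R.
Local Notation w := (wweight alpha).

Lemma feature_prod_seq (s : seq D) x :
  w x * \prod_(d <- s) feature x d =
  feature_prod alpha [ffun j : 'I_(size s) => tnth (in_tuple s) j] x.
Proof.
rewrite /feature_prod big_tnth; congr (_ * _); apply: eq_bigr => j _.
by rewrite ffunE.
Qed.

Lemma integrable_feature_term (mu : {measure set T -> \bar R}) k (J : {ffun 'I_k -> D}) (a : R) :
  wintegrable alpha mu ->
  mu.-integrable setT (EFin \o (fun x => a * feature_prod alpha J x)).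
Proof.
by move=> wi; have := integrableZl measurableT a (feature_prod_integrable J wi).
Qed.

Lemma polyfeat_integrable (mu : {measure set T -> \bar R}) h : wintegrable alpha mu ->
  polyfeat h -> mu.-integrable setT (EFin \o (fun x => w x * h x)).
Proof.
move=> wi [L hL].
rewrite (_ : EFin \o _ = EFin \o (fun x => \sum_(p <- L) p.1 *
  feature_prod alpha [ffun j : 'I_(size p.2) => tnth (in_tuple p.2) j] x)); last first.
  apply/funext => x /=; rewrite hL mulr_sumr; congr (_%:E).
  by apply: eq_bigr => p _; rewrite -feature_prod_seq mulrCA.
apply: (proj1 (Rintegral_sum _ measurableT _)) => p; exact: integrable_feature_term.
Qed.

Lemma cvg_polyfeat (I : Type) (F : set_system I) {FF : Filter F}
    (mu_ : I -> {measure set T -> \bar R}) (mu : {measure set T -> \bar R}) h :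
  (forall i, wintegrable alpha (mu_ i)) -> wintegrable alpha mu ->
  (forall k (J : {ffun 'I_k -> D}),
    moment alpha (mu_ i) J @[i --> F] --> moment alpha mu J) ->
  polyfeat h ->
  \int[mu_ i]_x (w x * h x) @[i --> F] --> \int[mu]_x (w x * h x).
Proof.
move=> wi wmu hm [L hL].
pose J (s : seq D) := [ffun j : 'I_(size s) => tnth (in_tuple s) j].
have E (m : {measure set T -> \bar R}) : wintegrable alpha m ->
    \int[m]_x (w x * h x) = \sum_(p <- L) p.1 * moment alpha m (J p.2).
  move=> wm; rewrite (_ : (fun x => _) =
    (fun x => \sum_(p <- L) p.1 * feature_prod alpha (J p.2) x)); last first.
    apply/funext => x /=; rewrite hL mulr_sumr.
    by apply: eq_bigr => p _; rewrite -feature_prod_seq mulrCA.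
  rewrite (proj2 (Rintegral_sum _ measurableT _)) => [|p].
    apply: eq_bigr => p _; rewrite RintegralZl//; exact: feature_prod_integrable.
  exact: integrable_feature_term.
rewrite E// (funext (fun i => E _ (wi i))).
by apply: cvg_bigsum => p; apply: cvgMl_tmp; exact: hm.
Qed.

Lemma euclid_cvg (U : Type) (F : set_system U) {FF : Filter F} (g : U -> T) (l : T) :
  (forall j, g u ord0 j @[u --> F] --> l ord0 j) -> g @ F --> l.
Proof.
move=> h; apply/cvg_ballP => e e0.
have : \forall u \near F, forall j : 'I_n, ball (l ord0 j) e (g u ord0 j).
  by apply: filter_forall => j; move/cvg_ballP : (h j); exact.
apply: filterS => u hu; split=> // i j; rewrite ord1; exact: hu.
Qed.

(** Rescaled features with values in [0, 1], to serve as the probabilities of [walk]; the feature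
    [vweight x * sqnorm x] is [1 - vweight x] and carries no further information. *)
Definition cube_coord x : 'rV[R]_n.+1 := \row_i
  oapp (fun j => 2^-1 + vweight x * x ord0 j) (vweight x) (unlift ord0 i).

Lemma cube_coord01 x i : 0 <= cube_coord x ord0 i <= 1.
Proof.
rewrite mxE; case: unliftP => [j _|_] /=; last by rewrite ltW ?vweight_gt0 ?vweight_le1.
suff : `|vweight x * x ord0 j| <= 2^-1 by rewrite ler_norml; lra.
rewrite normrM gtr0_norm ?vweight_gt0// mulrC /vweight ler_pdivrMr ?vden_gt0//.
have : `|x ord0 j| ^+ 2 <= sqnorm x.
  rewrite real_normK ?num_real// /sqnorm (bigD1 j)//= lerDl.
  by apply: sumr_ge0 => k _; exact: sqr_ge0.
have := sqr_ge0 (`|x ord0 j| - 1).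
set t := `|_|; rewrite sqrrB1 => h1 h2; lra.
Qed.

Lemma polyfeat_cube_coord i : polyfeat (fun x => cube_coord x ord0 i).
Proof.
case: (unliftP ord0 i) => [j ->|->]; last first.
  rewrite (_ : (fun x => _) = feature ^~ (inl true)); first exact: polyfeat_feature.
  by apply/funext => x; rewrite mxE unlift_none.
rewrite (_ : (fun x => _) = (fun x => 2^-1 + (Num.sqrt 2%:R)^-1 * feature x (inr j))).
  apply: polyfeatD; first exact: polyfeat_cst.
  by apply: polyfeatM; [exact: polyfeat_cst|exact: polyfeat_feature].
apply/funext => x; rewrite mxE liftK /= mulrCA mulKf// gt_eqF// sqrtr_gt0.
Qed.

(* The map [cube_coord] is injective with a continuous left inverse defined
   away from [vweight x = 0], so a compactly supported function factors
   through it; the factor is approximated by a Bernstein polynomial. *)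
Lemma compact_support_polyfeat (phi : T -> R) (e : R) : continuous phi ->
  compact (closure [set x | phi x != 0]) -> 0 < e ->
  exists2 h, polyfeat h & forall x, `|w x * h x - phi x| <= e.
Proof.
move=> cphi cS e0; set S := closure _ in cS.
(* Moments carry the factor [w], so [phi / w] is the function to approximate; multiplying back by
   [w <= 1] does not increase the error. *)
pose H x := phi x / w x.
have cH : continuous H.
  move=> x; apply: (continuousM (cphi x)).
  apply: (@continuousV _ _ (wweight alpha) x); first by rewrite gt_eqF// wweight_gt0.
  exact: continuous_wweight.
have H0 x : ~ S x -> H x = 0.
  move=> nSx; rewrite /H; have [->|p0] := eqVneq (phi x) 0; first by rewrite mul0r.
  by exfalso; apply: nSx; exact: subset_closure.
have bnd (g : T -> R) : continuous g -> exists2 M, 0 <= M & forall x, S x -> `|g x| <= M.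
  move=> cg.
  have /compact_bounded[M [Mr hM]] : compact (g @` S).
    by apply: continuous_compact => //; exact: continuous_subspaceT.
  exists (`|M| + 1); first by rewrite addr_ge0.
  by move=> x Sx; apply: hM; [rewrite ltr_pwDr// ler_norm|exists x].
have [MH MH0 hMH] := bnd H cH.
have [M2 M20 hM2] := bnd (@sqnorm R n) (@continuous_sqnorm R n).
(* On [S] the weight is at least [2 * v1]. Below, [r] inverts [cube_coord] where the weight is at
   least [v1], and [chi] falls from 1 at [2 * v1] to 0 at [v1], which makes [G] continuous on the
   whole space. *)
pose v1 := (2 * (1 + M2))^-1.
have v10 : 0 < v1 by rewrite invr_gt0 mulr_gt0// ltr_pwDl.
pose r (z : 'rV[R]_n.+1) : T :=
  \row_j ((z ord0 (lift ord0 j) - 2^-1) / Num.max (z ord0 ord0) v1).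
pose chi (t : R) : R := Num.min 1 (Num.max 0 (t / v1 - 1)).
pose G z := H (r z) * chi (z ord0 ord0).
have cmax : continuous (fun z : 'rV[R]_n.+1 => Num.max (z ord0 ord0) v1).
  by move=> z; apply: (@continuous_max _ _ (fun z : 'rV[R]_n.+1 => z ord0 ord0) (cst v1));
    [exact: coord_continuous|exact: cst_continuous].
have cr : continuous r.
  move=> z; apply: (@euclid_cvg _ (nbhs z)) => j; rewrite [X in _ --> X]mxE.
  rewrite (_ : (fun u => _) = (fun u : 'rV[R]_n.+1 => (u ord0 (lift ord0 j) - 2^-1)
    / Num.max (u ord0 ord0) v1)); last by apply/funext => u; rewrite mxE.
  apply: cvgM; first by apply: cvgB; [exact: coord_continuous|exact: cvg_cst].
  by apply: cvgV; [rewrite gt_eqF// lt_max v10 orbT|exact: cmax].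
have cchi : continuous chi.
  move=> t; apply: (@continuous_min R R (cst 1) (fun t : R => Num.max 0 (t / v1 - 1))).
    exact: cst_continuous.
  apply: (@continuous_max R R (cst 0) (fun t : R => t / v1 - 1)); first exact: cst_continuous.
  by apply: cvgB; [apply: cvgMr_tmp; exact: cvg_id|exact: cvg_cst].
have cG : continuous G.
  move=> z; apply: (@cvgM _ _ (nbhs z) _ (fun z => H (r z)) (fun z => chi (z ord0 ord0))).
    by apply: (@continuous_comp _ _ _ r H); [exact: cr|exact: cH].
  apply: (@continuous_comp _ _ _ (fun z : 'rV[R]_n.+1 => z ord0 ord0) chi).
    exact: coord_continuous.
  exact: cchi.
have chi01 t : 0 <= chi t <= 1 by rewrite /chi le_min ler01 le_max lexx ge_min lexx.
have GM z : `|G z| <= MH.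
  have /andP[c0 c1] := chi01 (z ord0 ord0).
  rewrite normrM (ger0_norm c0); apply: (@le_trans _ _ `|H (r z)|).
    by rewrite ler_piMr.
  by have [/hMH//|/H0 ->] := pselect (S (r z)); rewrite normr0.
have GE x : G (cube_coord x) = H x.
  rewrite /G /chi; have -> : cube_coord x ord0 ord0 = vweight x.
    by rewrite mxE unlift_none.
  have rE : v1 <= vweight x -> r (cube_coord x) = x.
    move=> hv; apply/rowP => j; rewrite !mxE liftK unlift_none/= max_l//.
    by rewrite addrC addKr mulrC mulKf// gt_eqF// vweight_gt0.
  have [Sx|nSx] := pselect (S x).
    have hv : 2 * v1 <= vweight x.
      rewrite /v1 invfM mulrA divff// mul1r lef_pV2 ?posrE ?vden_gt0//; last first.
        by rewrite ltr_pwDl.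
      by rewrite lerD2l; apply: le_trans (hM2 _ Sx); exact: ler_norm.
    rewrite rE; last by apply: le_trans hv; have := v10; lra.
    rewrite min_l ?mulr1// le_max; apply/orP; right.
    by rewrite lerBrDr ler_pdivlMr// -(natrD _ 1 1).
  rewrite (H0 _ nSx); have [hv|hv] := leP v1 (vweight x).
    by rewrite rE// H0// mul0r.
  rewrite max_l; last by rewrite subr_le0 ler_pdivrMr// mul1r ltW.
  by rewrite min_r ?mulr0.
have cK : compact [set z : 'rV[R]_n.+1 | forall i, `[0, 1]%classic (z ord0 i)].
  by apply: (@rV_compact R n.+1 (fun=> `[0, 1]%classic)) => i; exact: segment_compact.
have e2 : 0 < e / 2 by rewrite divr_gt0.
have [C C0 hC] := modulus cG GM cK e2.
pose m := (Num.truncn (C * n.+1%:R / (e / 2))).+1.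
pose W x := walk m%:R^-1 (flatten (nseq m (enum 'I_n.+1))) G 0 (cube_coord x).
exists W; first exact/polyfeat_walk/polyfeat_cube_coord.
move=> x; rewrite (_ : _ - _ = w x * (W x - H x)); last first.
  by rewrite mulrBr; congr (_ - _); rewrite /H mulrC divfK// gt_eqF// wweight_gt0.
rewrite normrM gtr0_norm ?wweight_gt0//.
apply: (@le_trans _ _ `|W x - H x|).
  by rewrite ler_piMl// wweight_le1.
rewrite -GE; apply: le_trans (walk_approx _ C0 (cube_coord01 x) _) _ => //.
  by apply: hC => i; rewrite /= in_itv/= cube_coord01.
rewrite [leRHS](splitr e) lerD2l mulrA ler_pdivrMr ?ltr0n// [leRHS]mulrC -ler_pdivrMr//.
by rewrite ltW// truncnS_gt.
Qed.

(** A uniform approximation costs at most [e / 3] against any probability measure, on either side;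
    convergence of the integrals of the polynomial gives the last third. *)
Lemma vague_of_moments (I : Type) (F : set_system I) {FF : Filter F}
    (mu_ : I -> {measure set T -> \bar R}) (mu : {measure set T -> \bar R})
    (phi : T -> R) :
  (forall i, wintegrable alpha (mu_ i)) -> wintegrable alpha mu ->
  (\forall i \near F, mu_ i setT = 1%E) -> mu setT = 1%E ->
  (forall k (J : {ffun 'I_k -> D}),
    moment alpha (mu_ i) J @[i --> F] --> moment alpha mu J) ->
  continuous phi -> compact (closure [set x | phi x != 0]) ->
  \int[mu_ i]_x phi x @[i --> F] --> \int[mu]_x phi x.
Proof.
move=> wi wmu mi1 m1 hm cphi cS; apply/cvgrPdist_le => e e0.
have e3 : 0 < e / 3 by rewrite divr_gt0.
have [h ph hh] := compact_support_polyfeat cphi cS e3.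
have est (m : {measure set T -> \bar R}) : wintegrable alpha m -> m setT = 1%E ->
    `|\int[m]_x (w x * h x) - \int[m]_x phi x| <= e / 3.
  move=> wm m1'; have ih := polyfeat_integrable wm ph.
  have idiff : m.-integrable setT (EFin \o (fun x => w x * h x - phi x)).
    apply: measurable_bounded_integrable => //; first by rewrite m1' ltry.
      apply: measurable_funB; first by have /integrableP[/measurable_EFinP] := ih.
      exact: continuous_measurable_euclid.
    exists (e / 3); split; first exact: num_real.
    by move=> M eM x _ /=; apply: (le_trans (hh x)); exact: ltW.
  have iphi : m.-integrable setT (EFin \o phi).
    rewrite (_ : EFin \o phi = (fun x => (w x * h x)%:E - (w x * h x - phi x)%:E)%E).
      exact: integrableB.
    by apply/funext => x /=; rewrite -EFinB opprB addrC subrK.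
  rewrite -RintegralB//; apply: (le_trans (le_normr_Rintegral measurableT idiff)).
  have icst : m.-integrable setT (EFin \o cst (e / 3)).
    apply: measurable_bounded_integrable => //; first by rewrite m1' ltry.
    exists (e / 3); split; first exact: num_real.
    by move=> M eM x _ /=; rewrite ger0_norm ?ltW.
  apply: (@le_trans _ _ (\int[m]_x (cst (e / 3) x))); last first.
    by rewrite Rintegral_cst// m1' mulr1.
  by apply: le_Rintegral => //; exact: integrable_norm.
have /cvgrPdist_le hP := @cvg_polyfeat _ _ FF _ _ _ wi wmu hm ph; have := hP _ e3.
apply: filterS2 mi1 => i mi1 hi.
have h1 := est _ wmu m1; have h2 := est _ (wi i) mi1.
move: hi h1 h2; set a := Rintegral _ _ _; set b := Rintegral _ _ _.
set a' := Rintegral _ _ _; set b' := Rintegral _ _ _.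
rewrite !ler_norml; lra.
Qed.

(** The square of one moment difference, times a positive coefficient, is one of the nonnegative
    terms of a form bounded by [dist2]. *)
Lemma moments_of_dist2 (I : Type) (F : set_system I) {FF : Filter F}
    (mu_ : I -> {measure set T -> \bar R}) (mu : {measure set T -> \bar R}) :
  (\forall i \near F, fin_energy alpha (mu_ i)) -> fin_energy alpha mu ->
  dist2 alpha (mu_ i) mu @[i --> F] --> (0 : R) ->
  forall k (J : {ffun 'I_k -> D}),
    moment alpha (mu_ i) J @[i --> F] --> moment alpha mu J.
Proof.
move=> fi fmu hd k J; apply/cvgrPdist_le => e e0.
have b0 : 0 < bincoef (@hexp R n alpha) k.
  apply: prodr_gt0 => j _; rewrite divr_gt0 ?ltr0n//.
  by rewrite ltr_pwDl ?hexp_gt0.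
have be0 : 0 < bincoef (@hexp R n alpha) k * e ^+ 2 by rewrite mulr_gt0// exprn_gt0.
have /cvgrPdist_le hP := hd; have := hP _ be0.
apply: filterS2 fi => i fi; rewrite sub0r normrN ger0_norm ?dist2_ge0// => hi.
rewrite distrC -ler_sqr ?nnegrE ?(ltW e0)// real_normK ?num_real//.
rewrite -(ler_pM2l b0); apply: le_trans hi.
apply: le_trans (moment_form_le_dist2 alphan k.+1 fi fmu).
rewrite /moment_form big_ord_recr /=.
apply: (@le_trans _ _ (bincoef (@hexp R n alpha) k *
    \sum_(J' : {ffun 'I_k -> D}) moment_diff alpha (mu_ i) mu J' * moment_diff alpha (mu_ i) mu J')).
  rewrite ler_pM2l// (bigD1 J)//= -expr2 lerDl.
  by apply: sumr_ge0 => J' _; rewrite -expr2 sqr_ge0.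
by rewrite lerDr; exact: (moment_form_ge0 alphan k).
Qed.

End feature_polynomials.

(** * Convergence of the minimizers *)

Section convergence.
Context {R : realType} {n : nat} {alpha : R}.
Hypothesis alphan : (alpha < n%:R)%R.
Local Notation T := (euclid R n).
Local Open Scope ereal_scope.

Variables (D A : set T) (f g : T -> \bar R) (tp tn : {measure set T -> \bar R}).
Hypotheses (cD : closed D) (ftp : fin_energy alpha tp) (ftn : fin_energy alpha tn).
Hypothesis mg : measurable_fun D g.
Hypothesis gNy : forall x, D x -> g x != -oo.
Hypothesis g_lsc : forall x (a : R), D x -> a%:E < g x ->
  exists2 V, open V /\ V x & forall y, V y -> D y -> a%:E < g y.
Hypothesis fE : forall x, D x ->
  f x = g x + (potential_pos alpha tp x - potential_pos alpha tn x).
Hypothesis AD : A `<=` D.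
Variable lamA : radon_pos n alpha.
Hypothesis hlamA : is_minimizer D f A lamA.

Local Notation inf := (weighted_inf (alpha := alpha) D f).
Local Notation W := (weightedR (alpha := alpha) D g tp tn).
Let w : R := fine (inf A).

Let wE : inf A = w%:E. Proof. by rewrite fineK//; case: hlamA. Qed.
Let inA : Eplus1f D f A lamA. Proof. by case: hlamA. Qed.

Let WE (Q : set T) (mu : radon_pos n alpha) : Q `<=` D ->
  Eplus1f D f Q mu -> weighted_energy D f mu = (W mu)%:E.
Proof. exact: weighted_energyE. Qed.

Let WA : W lamA = w.
Proof. by apply: EFin_inj; rewrite -wE -(WE AD inA); case: hlamA. Qed.

Lemma Eplus1fS (Q Q' : set T) (mu : radon_pos n alpha) : Q `<=` Q' ->
  Eplus1f D f Q mu -> Eplus1f D f Q' mu.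
Proof.
move=> QQ' [[[E c] m1] i]; split=> //; split=> //; split=> //.
by apply: negligibleS c; exact: subsetC.
Qed.

Lemma weighted_infS (Q Q' : set T) : Q `<=` Q' -> inf Q' <= inf Q.
Proof.
by move=> QQ'; apply: le_ereal_inf_tmp => _ [mu hmu <-]; apply: ereal_inf_lbound;
  exists mu => //; exact: Eplus1fS hmu.
Qed.

(** One compact set from [inner_approximation] is enough, as the infimum decreases when the set
    grows. *)
Let near_le (e : R) : (0 < e)%R ->
  \forall K \near compacts_up A, compacts_of A K /\ inf K <= (w + e)%:E.
Proof.
move=> e0; have [F [rho [cF FA hrho le_rho]]] := inner_approximation alphan
  (closed_measurable_euclid cD) AD inA e0.
exists F; first by split.
move=> K [cK FK]; split=> //; apply: (le_trans (weighted_infS FK)).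
apply: (@le_trans _ _ (weighted_energy D f rho)); first by apply: ereal_inf_lbound; exists rho.
by apply: (le_trans le_rho); rewrite (WE AD inA) WA.
Qed.

Lemma minimizers_near :
  \forall K \near compacts_up A, exists lamK, is_minimizer (alpha := alpha) D f K lamK.
Proof.
apply: filterS (near_le ltr01) => K [[cK KA] leK].
apply: (minimizer_on_compact alphan cD ftp ftn mg gNy g_lsc fE cK (w := fine (inf K))).
  exact: subset_trans AD.
(* The infimum over [K] is real: it lies between the one over [A] and [w + 1]. *)
rewrite fineK// fin_numElt (lt_le_trans _ (weighted_infS KA)) ?wE ?ltNyr//=.
by rewrite (le_lt_trans leK) ?ltry.
Qed.

Variable lam : set T -> radon_pos n alpha.
Hypothesis hlam : \forall K \near compacts_up A, is_minimizer D f K (lam K).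

Let near_lam (e : R) : (0 < e)%R -> \forall K \near compacts_up A,
  [/\ Eplus1f D f A (lam K), (w <= W (lam K) <= w + e)%R &
      (0 <= dist2 alpha (lam K) lamA <= 2 * e)%R].
Proof.
move=> e0; apply: filterS2 hlam (near_le e0) => K [hK WK fK] [[cK KA] leK].
have hA := Eplus1fS KA hK.
have hW : (w <= W (lam K) <= w + e)%R.
  by rewrite -!lee_fin -wE -(WE AD hA) WK leK (weighted_infS KA).
split=> //.
have [fl _ _ _] := Eplus1f_facts alphan cD ftp ftn mg fE AD hA.
have [fA _ _ _] := Eplus1f_facts alphan cD ftp ftn mg fE AD inA.
rewrite dist2_ge0//=.
have := dist2_le_weighted alphan cD ftp ftn mg fE AD (w := w) _ hA inA.
rewrite wE lexx => /(_ isT); rewrite WA subrr mulr0 addr0 => /le_trans; apply.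
by rewrite ler_pM2l// lerBlDl; case/andP: hW.
Qed.

Let fin_lam : \forall K \near compacts_up A, fin_energy alpha (lam K).
Proof.
apply: filterS (near_lam ltr01) => K [hA _ _].
by have [] := Eplus1f_facts alphan cD ftp ftn mg fE AD hA.
Qed.

Let fin_lamA : fin_energy alpha lamA.
Proof. by have [] := Eplus1f_facts alphan cD ftp ftn mg fE AD inA. Qed.

Let dist2_cvg : dist2 alpha (lam K) lamA @[K --> compacts_up A] --> (0 : R)%R.
Proof.
apply/cvgrPdist_le => e e0; have e2 : (0 < e / 2)%R by rewrite divr_gt0.
apply: filterS (near_lam e2) => K [_ _ /andP[d0 de]].
by rewrite sub0r normrN ger0_norm// (le_trans de)// mulrC divfK.
Qed.

Lemma minimizers_strong_cvg : strong_cvg (compacts_up A) lam lamA.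
Proof.
have h : Num.sqrt (dist2 alpha (lam K) lamA) @[K --> compacts_up A] --> (0 : R)%R.
  rewrite -(sqrtr0 R); apply: (@continuous_cvg _ _ _ (compacts_up A)) => //.
  exact: sqrt_continuous.
apply: cvg_trans h; apply: near_eq_cvg; apply: filterS fin_lam => K fK.
by rewrite strong_norm_radon_sub.
Qed.

Lemma minimizers_vague_cvg : vague_cvg (compacts_up A) lam lamA.
Proof.
move=> phi cphi cS; apply: (@vague_of_moments _ _ _ alphan _ (compacts_up A)) => //.
- by move=> K; exact: radon_wintegrable.
- exact: radon_wintegrable.
- by apply: filterS (near_lam ltr01) => K [[[_ ]]].
- by case: inA => -[].
- exact: (moments_of_dist2 alphan fin_lam).
Qed.

Let equilibriumE (mu : radon_pos n alpha) : Eplus1f D f A mu ->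
  equilibrium_constant D f mu = ((W mu + energyR alpha mu mu) / 2)%:E.
Proof.
move=> hmu; have [fmu mD jg _] := Eplus1f_facts alphan cD ftp ftn mg fE AD hmu.
have [jp pE] := integral_potential alphan cD fmu mD fmu.
have [jf fEq] := g_integrable_f alphan cD ftp ftn fE fmu mD jg.
rewrite /equilibrium_constant integralD//; last exact: closed_measurable_euclid.
rewrite pE fEq -(fineK (integrable_fin_num (closed_measurable_euclid cD) jg)) -!EFinD.
by congr (_%:E); rewrite /weightedR; field.
Qed.

Let energy_cvg : energyR alpha (lam K) (lam K) @[K --> compacts_up A]
  --> energyR alpha lamA lamA.
Proof.
have h : Num.sqrt (energyR alpha (lam K) (lam K)) @[K --> compacts_up A]
    --> Num.sqrt (energyR alpha lamA lamA).
  apply/cvgrPdist_le => e e0.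
  have /cvgrPdist_le hd := dist2_cvg.
  have e2 : (0 < e ^+ 2)%R by rewrite exprn_gt0.
  apply: filterS2 fin_lam (hd _ e2) => K fK.
  rewrite sub0r normrN ger0_norm ?dist2_ge0// => hK.
  rewrite distrC -ler_sqr ?nnegrE ?(ltW e0)// real_normK ?num_real//.
  by apply: le_trans hK; exact: sqrt_energyR_diff.
have hM := cvgM h h; rewrite -expr2 sqr_sqrtr ?energyR_ge0// in hM.
rewrite (_ : (fun K => _) = (fun K => Num.sqrt (energyR alpha (lam K) (lam K)) *
  Num.sqrt (energyR alpha (lam K) (lam K)))%R); first exact: hM.
by apply/funext => K; rewrite -expr2 sqr_sqrtr ?energyR_ge0.
Qed.

Lemma equilibrium_constant_cvg :
  equilibrium_constant D f (lam K) @[K --> compacts_up A]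
    --> equilibrium_constant D f lamA.
Proof.
rewrite (equilibriumE inA) WA.
have hW : W (lam K) @[K --> compacts_up A] --> w.
  apply/cvgrPdist_le => e e0; apply: filterS (near_lam e0) => K [_ /andP[wW We] _].
  by rewrite distrC ger0_norm ?subr_ge0// lerBlDl.
have h : ((W (lam K) + energyR alpha (lam K) (lam K)) / 2)%:E @[K --> compacts_up A]
   --> ((w + energyR alpha lamA lamA) / 2)%:E.
  apply: cvg_EFin; first by near=> K.
  by apply: cvgMr_tmp; exact: cvgD.
apply: cvg_trans h; apply: near_eq_cvg; apply: filterS (near_lam ltr01) => K [hK _ _].
by rewrite equilibriumE.
Unshelve. all: by end_near. Qed.

End convergence.

(** * Decomposition of the external field *)

Section field.
Context {R : realType} {n : nat} {alpha : R}.
Hypothesis alphan : (alpha < n%:R)%R.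
Local Notation T := (euclid R n).
Local Open Scope ereal_scope.

Lemma wintegrable_add (p q : {measure set T -> \bar R}) :
  wintegrable alpha p -> wintegrable alpha q -> wintegrable alpha (measure_add p q).
Proof.
move=> /integrableP[mp ip] /integrableP[mq iq]; apply/integrableP; split=> //.
have mw : measurable_fun setT (fun x : T => `|(EFin \o @wweight R n alpha) x|).
  by apply: measurableT_comp => //; exact: measurable_wweight.
by rewrite ge0_integral_measure_add//; exact: lte_add_pinfty.
Qed.

Lemma tvmE (mu : radon n alpha) (S : set T) : tvm mu S = posm mu S + negm mu S.
Proof. exact: measure_addE. Qed.

Lemma fin_energy_parts (theta : radon n alpha) : finite_energy theta ->
  fin_energy alpha (posm theta) /\ fin_energy alpha (negm theta).
Proof.
move=> ft; have wp := radon_wintegrable alphan (posm theta).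
have wn := radon_wintegrable alphan (negm theta).
have wt : wintegrable alpha (tvm theta) by exact: wintegrable_add.
by split; split=> //; apply: le_lt_trans ft; apply: energy_pos_mono => // S mS;
  rewrite tvmE ?leeDl ?leeDr.
Qed.

Lemma lsc_along_subspace (D : set T) (g : T -> \bar R) :
  lower_semicontinuous (g : subspace D -> \bar R) ->
  forall x (a : R), D x -> a%:E < g x ->
  exists2 V, open V /\ V x & forall y, V y -> D y -> a%:E < g y.
Proof.
move=> hg x a Dx /hg[V hV gV].
have : within D (nbhs x) V by rewrite (nbhs_subspace_in Dx).
rewrite /within /= nbhsE => -[U [oU Ux] UV].
by exists U => // y Uy Dy; apply: gV; exact: UV.
Qed.

(** For fixed [y], the points at distance at least [d] from [y] form a closed set, so the bound
    passes from [A] to its closure. *)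
Lemma set_dist_closure (S A : set T) : 0 < set_dist S A ->
  exists2 d : R, (0 < d)%R & forall x y, closure A x -> S y -> (d <= enorm (x - y : T))%R.
Proof.
move=> h; have [d d0 hd] : exists2 d : R, (0 < d)%R & d%:E <= set_dist S A.
  move: h; case: (set_dist S A) => [r||] //; first by rewrite lte_fin; exists r.
  (* An infinite distance, as for an empty support, allows any positive [d]. *)
  by exists 1%R => //; rewrite leey.
exists d => // x y Ax Sy; pose C := [set z : T | (d <= enorm (z - y : T))%R].
have cC : closed C.
  rewrite (_ : C = (fun z : T => enorm (z - y : T)%R) @^-1` [set r : R | (d <= r)%R])//.
  apply: preimage_closed; last exact: closed_ge.
  move=> z _; apply: (@continuous_comp _ _ _ (fun z : T => z - y : T)%R (@enorm R n)).
    by apply: (@cvgB _ _ _ (nbhs z) _ id (cst y)); [exact: cvg_id|exact: cvg_cst].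
  exact: continuous_enorm.
apply: cC; apply: closure_subset Ax => z Az; rewrite /C /= -lee_fin.
apply: (le_trans hd); apply: ereal_inf_lbound; exists y => //; exists z => //.
by congr (_%:E); rewrite !enormE /sqnorm; congr Num.sqrt; apply: eq_bigr => i _;
  rewrite !mxE; ring.
Qed.

End field.

Local Open Scope ereal_scope.

Theorem theorem2p3 (R : realType) (n : nat) (alpha : R)
  (hn : (2 <= n)%N) (halpha0 : (0 < alpha)%R) (halphan : (alpha < n%:R)%R)
  (A : set (euclid R n)) (psi : euclid R n -> \bar R)
  (theta omega : radon n alpha) (f : euclid R n -> \bar R)
  (hf : forall x, closure A x -> f x = psi x + potential theta x + potential omega x)
  (hpsi : Phi (closure A) psi)
  (htheta : finite_energy theta)
  (homega : bounded_radon omega)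
  (hdist : 0 < set_dist (msupport (tvm omega)) A)
  (hcap : 0 < inner_capacity alpha [set x | A x /\ psi x < +oo])
  (lamA : radon_pos n alpha)
  (hlamA : is_minimizer (closure A) f A lamA) :
  (\forall K \near compacts_up A,
      exists lamK : radon_pos n alpha, is_minimizer (closure A) f K lamK) /\
  (forall lam : set (euclid R n) -> radon_pos n alpha,
    (\forall K \near compacts_up A, is_minimizer (closure A) f K (lam K)) ->
    [/\ strong_cvg (compacts_up A) lam lamA,
        vague_cvg (compacts_up A) lam lamA &
        equilibrium_constant (closure A) f (lam K) @[K --> compacts_up A]
          --> equilibrium_constant (closure A) f lamA]).
Proof.
have [ftp ftn] := fin_energy_parts halphan htheta.
have [psi_lsc psiNy _] := hpsi.
have [d d0 hd] := set_dist_closure hdist.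
(* [Z] is null for both Jordan parts of [omega], and its complement is at distance at least [d] from
   [closure A]; this makes both potentials finite and continuous along [closure A]. *)
pose Z := ~` msupport (tvm omega).
have mZ : measurable Z by apply: open_measurable_euclid; exact: open_setC_msupport.
have Z0 : tvm omega Z = 0 by exact: measure_setC_msupport.
have sep x y : closure A x -> ~ Z y -> (d <= enorm (x - y : euclid R n))%R.
  by move=> Ax /contrapT; exact: hd.
have parts : [/\ posm omega setT < +oo, posm omega Z = 0,
                 negm omega setT < +oo & negm omega Z = 0].
  have := homega; have := Z0; rewrite /bounded_radon !tvmE.
  have p0 := measure_ge0 (posm omega); have n0 := measure_ge0 (negm omega).
  move=> /eqP; rewrite padde_eq0// => /andP[/eqP pZ /eqP nZ] fin.
  by split=> //; apply: le_lt_trans fin; rewrite ?leeDl ?leeDr.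
have [fp pZ fn nZ] := parts.
(* On [closure A] both potentials are finite, so [fine] keeps their values there. *)
pose h x := (fine (potential_pos alpha (posm omega) x)
             - fine (potential_pos alpha (negm omega) x))%R.
have h_cont x (e : R) : closure A x -> (0 < e)%R ->
    exists2 V, open V /\ V x & forall y, V y -> closure A y -> (`|h y - h x| < e)%R.
  move=> Ax e0; have e2 : (0 < e / 2)%R by rewrite divr_gt0.
  have [V [oV Vx] hV] := separated_potential_cont halphan fp mZ pZ d0 sep Ax e2.
  have [V' [oV' Vx'] hV'] := separated_potential_cont halphan fn mZ nZ d0 sep Ax e2.
  exists (V `&` V'); first by split; [exact: openI|].
  have aux (a a' b b' : R) : (`|b' - b| < e / 2 -> `|a' - a| < e / 2 ->
      `|(a' - b') - (a - b)| < e)%R by rewrite !ltr_norml; lra.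
  by move=> y [Vy Vy'] Ay; exact: aux (hV' y Vy' Ay) (hV y Vy Ay).
pose g x := psi x + (h x)%:E.
have g_lsc := lsc_along_addr (lsc_along_subspace psi_lsc) h_cont.
have mg : measurable_fun (closure A) g.
  by apply: measurable_lsc_along => //; exact: closed_closure.
have gNy x : closure A x -> g x != -oo.
  by move=> /psiNy; rewrite /g; case: (psi x).
have fE x : closure A x -> f x = g x + (potential_pos alpha (posm theta) x
    - potential_pos alpha (negm theta) x).
  move=> Ax; rewrite hf// /g [RHS]addeAC; congr (_ + _ + _).
  have Up := separated_potential_fin halphan fp mZ pZ d0 sep Ax.
  have Un := separated_potential_fin halphan fn mZ nZ d0 sep Ax.
  by rewrite /potential /h EFinB !fineK.
have AD : A `<=` closure A by exact: subset_closure.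
have cD := @closed_closure _ A.
split; first exact: (minimizers_near halphan cD ftp ftn mg gNy g_lsc fE AD hlamA).
move=> lam hlam; split.
- exact: (minimizers_strong_cvg halphan cD ftp ftn mg fE AD hlamA hlam).
- exact: (minimizers_vague_cvg halphan cD ftp ftn mg fE AD hlamA hlam).
- exact: (equilibrium_constant_cvg halphan cD ftp ftn mg fE AD hlamA hlam).
Qed.
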